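(* Let $p>3$ be a prime. (i) Suppose that $p\equiv 1\pmod 4$. Then $$\left|x+\left(\frac{j+k}{p}\right)+\left(\frac{j-k}{p}\right)+\left(\frac{j}{p}\right)y+\left(\frac{k}{p}\right)z+\left(\frac{jk}{p}\right)w\right|_{1\le j,k\le (p-1)/2}$$ $$=(-p)^{(p-5)/4}\left(\left(\frac{p-1}{2}\right)^2wx-\left(\frac{p-1}{2}y-1\right)\left(\frac{p-1}{2}z-1\right)\right),$$ where in the last line the fractions $\frac{p-1}{2}$ are ordinary rational numbers. (ii) When $p\equiv 3\pmod 4$, we have $$\left|x+\left(\frac{j+k}{p}\right)+\left(\frac{j-k}{p}\right)+\left(\frac{j}{p}\right)y+\left(\frac{k}{p}\right)z+\left(\frac{jk}{p}\right)w\right|_{1\le j,k\le (p-1)/2}$$ $$=(-1)^{(h(-p)-1)/2}p^{(p-3)/4}\left(1-\frac{p-1}{2}y-c_p(w+x)+c_p^2(wx-yz)\right)$$ $$\quad+(-1)^{(h(-p)-1)/2}p^{(p-7)/4}\left(\frac{p-1}{2}+2(d_p-c_p^2)\right)\left(z+\frac{p-1}{2}(wx-yz)\right),$$ where $$c_p:=\left(2-\left(\frac{2}{p}\right)\right)h(-p)\quad\text{and}\quad d_p:=\sum_{j,k=1}^{(p-1)/2}\left(\frac{j^2+jk}{p}\right)$$ (in these definitions $\left(\frac{2}{p}\right)$ and $\left(\frac{j^2+jk}{p}\right)$ are Legendre symbols).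
   Context: $\left(\frac{a}{p}\right)$ with $a\in\mathbb{Z}$ denotes the Legendre symbol modulo $p$ (with value $0$ when $p\mid a$). $|a_{jk}|_{1\le j,k\le n}$ denotes the determinant of the matrix $[a_{jk}]_{1\le j,k\le n}$. $h(-p)$ denotes the class number of the imaginary quadratic field $\mathbb{Q}(\sqrt{-p})$. Here $x,y,z,w$ are indeterminates (equivalently, arbitrary complex numbers). *)

(* Defs.v *)
From HB Require Import structures.
From mathcomp Require Import all_boot all_order all_algebra all_field.
From mathcomp Require Import finmap.
From mathcomp Require Import mathcomp_extra boolp classical_sets functions.
From mathcomp Require Import cardinality.

Set Implicit Arguments.
Unset Strict Implicit.
Unset Printing Implicit Defensive.

Import Order.TTheory GRing.Theory Num.Theory.

Local Open Scope classical_set_scope.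
Local Open Scope ring_scope.

Definition legendre (p : nat) (a : int) : int :=
  if (p %| a)%Z then 0
  else if [exists x : 'I_p, (x%:Z ^+ 2 == a %[mod p])%Z] then 1
  else -1.

Section ClassNumber.

(* K is meant to be a subfield of algC of finite degree over the rationals *)
Variable K : set algC.

Definition ring_of_integers : set algC := [set x | K x /\ x \in Aint].

Definition nonzero_ideal (I : set algC) : Prop :=
  [/\ I `<=` ring_of_integers,
      I 0,
      forall x y, I x -> I y -> I (x + y),
      forall r x, ring_of_integers r -> I x -> I (r * x)
    & exists2 x, I x & x != 0].

(* (a) I = (b) J for some nonzero integers a, b of K *)
Definition ideal_equiv (I J : set algC) : Prop :=
  exists a b : algC,
    [/\ ring_of_integers a, ring_of_integers b, a != 0, b != 0
      & [set a * x | x in I] = [set b * x | x in J]].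

Definition ideal_class (I : set algC) : set (set algC) :=
  [set J | nonzero_ideal J /\ ideal_equiv I J].

(* fset_set sends an infinite set to fset0; the set of ideal classes of a number
   field is finite, so the default value is never used for such a field. *)
Definition class_number : nat :=
  #|` fset_set [set ideal_class I | I in nonzero_ideal]|.

End ClassNumber.

Definition quadratic_field (d : int) : set algC :=
  [set x | exists a b : rat, x = ratr a + ratr b * sqrtC d%:~R].

Definition h (d : int) : nat := class_number (quadratic_field d).

Definition c_ (p : nat) : int := (2 - legendre p 2) * (h (- p%:Z))%:Z.

Definition d_ (p : nat) : int :=
  \sum_(1 <= j < (p.-1)./2.+1) \sum_(1 <= k < (p.-1)./2.+1)
     legendre p (j%:Z ^+ 2 + j%:Z * k%:Z).

(* The row and column indices 1, ..., (p-1)/2 are the shifted ordinals. *)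
Definition legendre_mx (C : numClosedFieldType) (p : nat) (x y z w : C) :
    'M[C]_((p.-1)./2) :=
  \matrix_(j0 < (p.-1)./2, k0 < (p.-1)./2)
    let j := j0.+1%:Z in let k := k0.+1%:Z in
    x + (legendre p (j + k))%:~R + (legendre p (j - k))%:~R
      + (legendre p j)%:~R * y + (legendre p k)%:~R * z
      + (legendre p (j * k))%:~R * w.

(* Main.v *)
Require Import Defs.
From mathcomp Require Import all_boot all_order all_algebra all_field.
From mathcomp Require Import zify ring lra.
From mathcomp Require Import finmap boolp classical_sets cardinality.

Set Implicit Arguments.
Unset Strict Implicit.
Unset Printing Implicit Defensive.

Import Order.TTheory GRing.Theory Num.Theory.
Local Open Scope ring_scope.

(** Write n = (p-1)/2 and chi for the Legendre symbol. The matrix of the theorem is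
    A + 1 (x 1 + z chi)^T + chi (y 1 + w chi)^T, where A has the entries
    chi(j+k) + chi(j-k) and 1 and chi stand for column vectors. Hence its determinant is
    det A times a 2 x 2 determinant formed from the inner products of 1 and chi with
    A^-1 1 and A^-1 chi ([det_add_rank2]). Always A 1 = - chi. If p = 1 mod 4 then also
    A chi = -1; if p = 3 mod 4 then A^T A = p I - 2 J with J the all-ones matrix, which
    yields A^-1 1 and, with the double sum d_p, the missing inner product. These facts are
    elementary sums over the prime field ([core_row_sum], [core_row_chi_sum],
    [core_col_mul], [core_col_sum_chi]).

    For det A let z be a primitive p-th root of unity and g the Gauss sum. As chi is
    its own Fourier transform up to g, grouping b with -b gives g A = X diag(chi) C with
    C = (z^(bk) + z^(-bk)) and X = C or X = S = (z^(jb) - z^(-jb)) according to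
    p mod 4 ([core_factor]). From C^2 = p I - 2 J one gets det C^2 = p^(n-1), which settles
    p = 1 mod 4. For p = 3 mod 4 the addition formulas at half angles turn C into S
    by unitriangular column operations and yield
    det S = (-1)^n det C prod_b (z^b - z^(-b)) ([det_sin_cos]). That product squares to -p,
    so it is g or -g; it is -chi(2) g, because the congruence of the two sides modulo the
    p-th cyclotomic polynomial, which is (X-1)^(p-1) modulo p, survives n applications of
    X d/dX ([half_prod_gauss]). Up to an explicit sign det A is now
    p^((p-3)/4) prod_j chi(j), and the sign of the product is determined by the sum
    of the chi(j) over j <= n.

    This sum is (2 - chi 2) h(-p) ([half_sum_class_number]), so that it is c_p and the sign
    is that of the theorem. It follows from Dirichlet's class number formula
    p h = - sum_a a chi(a) ([class_number_formula]), proved here as follows. The nonzero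
    ideals of Q(sqrt(-p)) are the e (a, b + omega) with a | b^2 + b + m, m = (p+1)/4
    ([ideal_classification]); counting them prime power by prime power shows that
    sum_{d | n} chi(d) of them have norm n ([rep_chi]; the primes are handled by Gauss
    periods in characteristic l, that is, by quadratic reciprocity). On the other hand, the
    nonzero vectors alpha of an ideal I of norm a correspond two-to-one to the ideals
    (conj alpha / a) I in the class of I. So, summed over representatives of the classes,
    the numbers of representations of n by their forms Q add up to
    2 sum_{d | n} chi(d), except that n = 0 is represented once by each form.

    The constant term is isolated by a weight F(n) = binomial(N - n, 5), N = M^2, and by
    subtracting four times the weight F(4n). The sum of F(Q) - 4 F(4Q) over a lattice is
    a sum of alternating sums, of order M^9 by third differences ([theta_estimate]), while
    the sum of chi(d) F(d m) with m weighted by 1 - 4 [4 | m] is, by two summations by parts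
    in each variable and up to M^9, F(1) times the product of the Abel sums of
    both sequences ([hyperbola_sum]). As F(0) has order M^10, this forces h to be the
    Abel sum of chi ([constant_term]). *)

(** * The Legendre symbol as a character of the prime field *)

Definition chi (p : nat) (x : 'F_p) : int :=
  if x == 0 then 0 else if [exists y, y ^+ 2 == x] then 1 else -1.

Definition halfp (p : nat) : nat := p.-1./2.

Section LegendreCharacter.

Variable p : nat.
Hypotheses (p_pr : prime p) (p_gt2 : (2 < p)%N).
Local Notation F := 'F_p.
Local Notation n := (halfp p).
Local Notation chi := (@chi p).

Lemma half_dblS : (n.*2.+1 = p)%N.
Proof.
have := even_prime p_pr; rewrite /halfp => -[p2|]; first by move: p_gt2; rewrite p2.
by move=> odd_p; rewrite -[RHS](odd_double_half p); lia.
Qed.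

Lemma halfp_gt0 : (0 < n)%N. Proof. by have := half_dblS; lia. Qed.

Lemma intFp_eq0 (a : int) : (a%:~R == 0 :> F) = (p %| a)%Z.
Proof. by rewrite -(dvdz_pcharf (pchar_Fp p_pr)). Qed.

Lemma natFp_eq0 (a : nat) : (a%:R == 0 :> F) = (p %| a)%N.
Proof. by rewrite -(dvdn_pcharf (pchar_Fp p_pr)). Qed.

Lemma two_neq0 : 2%:R != 0 :> F.
Proof. by rewrite natFp_eq0; apply/negP => /dvdn_leq; lia. Qed.

Lemma legendreE (a : int) : legendre p a = chi a%:~R.
Proof.
rewrite /legendre /chi intFp_eq0; case: ifP => // _.
congr (if _ then _ else _).
apply/existsP/existsP => -[x /eqP Hx].
- exists (nat_of_ord x)%:R; rewrite -subr_eq0 -natrX.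
  have -> : ((x ^ 2)%N%:R - a%:~R : F) = ((x%:Z ^+ 2 - a)%:~R).
    by rewrite rmorphB rmorphXn /= natrX.
  by rewrite intFp_eq0 -eqz_mod_dvd; apply/eqP.
- have Hlt : (x < p)%N by have := ltn_ord x; rewrite [X in (_ < X)%N]Fp_cast.
  exists (Ordinal Hlt); rewrite /= eqz_mod_dvd -intFp_eq0 rmorphB rmorphXn /=.
  have -> : (x%:Z%:~R : F) = x.
    by rewrite -[RHS]natr_Zp.
  by rewrite Hx subrr.
Qed.

Lemma int_small_eq0 (a : int) : (`|a| <= 2)%R -> (a%:~R == 0 :> F) = (a == 0).
Proof.
move=> Ha; rewrite intFp_eq0; apply/idP/eqP => [|->]; last exact: dvdz0.
rewrite dvdzE /= => pa; apply/eqP; rewrite -absz_eq0 -leqn0 leqNgt; apply/negP => a0.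
by have := dvdn_leq a0 pa; lia.
Qed.

Lemma natFp_inj (i j : nat) : (i < p)%N -> (j < p)%N -> i%:R = j%:R :> F -> i = j.
Proof.
move=> ip jp /(congr1 (@nat_of_ord _)); rewrite !val_Fp_nat //.
by rewrite !modn_small.
Qed.

Lemma sum_Fp_nat (V : zmodType) (f : F -> V) :
  \sum_x f x = \sum_(0 <= i < p) f i%:R.
Proof.
pose g i := f i%:R; transitivity (\sum_(0 <= i < p) g i) => //.
have <- : \sum_(0 <= i < (Zp_trunc (pdiv p)).+2) g i = \sum_(0 <= i < p) g i.
  by rewrite Fp_cast.
by rewrite big_mkord; apply: eq_bigr => x _; rewrite /g natr_Zp.
Qed.

(** The residues 1, ..., (p-1)/2 represent the pairs of opposite nonzero residues. *)
Lemma halfp_sum (V : zmodType) (f : F -> V) :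
  \sum_x f x = f 0 + \sum_(j < n) (f j.+1%:R + f (- j.+1%:R)).
Proof.
rewrite sum_Fp_nat; pose g (i : nat) := f i%:R.
transitivity (\sum_(0 <= i < n.*2.+1) g i); first by rewrite half_dblS.
rewrite big_nat_recl //; congr (_ + _).
rewrite -addnn (big_cat_nat (n := n)) ?leq_addr //= big_split /= !big_mkord; congr (_ + _).
rewrite -{1}[n]add0n big_addn addnK big_mkord (reindex_inj rev_ord_inj) /=.
apply: eq_bigr => i _; congr f; apply/eqP; rewrite -subr_eq0 opprK -natrD.
rewrite natFp_eq0; have := ltn_ord i; have := half_dblS; rewrite -addnn => Hp Hi.
by have -> : ((n - i.+1 + n).+1 + i.+1 = p)%N by lia.
Qed.

Lemma natFp_neq0 (j : nat) : (0 < j < p)%N -> j%:R != 0 :> F.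
Proof. by case/andP=> j0 jp; rewrite natFp_eq0 gtnNdvd. Qed.

Lemma halfp_neq0 (j : 'I_n) : j.+1%:R != 0 :> F.
Proof. by apply: natFp_neq0; have := ltn_ord j; have := half_dblS; lia. Qed.

Lemma chi_cases (x : F) : [\/ chi x = 0, chi x = 1 | chi x = -1].
Proof.
rewrite /chi; case: ifP => _; first by constructor 1.
by case: ifP => _; [constructor 2 | constructor 3].
Qed.

Lemma chi0 : chi 0 = 0. Proof. by rewrite /chi eqxx. Qed.

Lemma chi_eq0 x : (chi x == 0) = (x == 0).
Proof. by rewrite /chi; case: ifP => // _; case: ifP. Qed.

Lemma expFp_pred (x : F) : x != 0 -> x ^+ n.*2 = 1.
Proof.
move=> x0; apply: (mulfI x0).
by rewrite -exprS half_dblS mulr1 -[RHS]expf_card card_Fp.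
Qed.

(** Euler's criterion: the n nonzero squares exhaust the roots of X^n - 1. *)
Lemma chi_euler (x : F) : (chi x)%:~R = x ^+ n :> F.
Proof.
rewrite /chi; case: eqVneq => [->|x0].
  by rewrite expr0n; have := halfp_gt0; case: (halfp p).
have := expFp_pred x0; rewrite -muln2 exprM => /eqP; rewrite sqrf_eq1.
case: existsP => [[y /eqP yx] _|nsq].
  rewrite -yx -exprM mul2n expFp_pred //.
  by apply: contraNneq x0 => y0; rewrite -yx y0 expr0n.
case/orP => /eqP // xn1; exfalso.
pose rs := x :: [seq ((i.+1)%:R : F) ^+ 2 | i <- iota 0 n].
have := @max_unity_roots F n rs halfp_gt0; rewrite /= size_map size_iota ltnn => H.
suff: false by []. apply: H.
  rewrite unity_rootE xn1 eqxx /=; apply/allP => _ /mapP [i + ->].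
  rewrite mem_iota => /= Hi; rewrite unity_rootE -exprM mul2n.
  by rewrite expFp_pred ?eqxx // natFp_neq0 //; have := half_dblS; lia.
apply/andP; split.
  by apply/negP => /mapP [i _ xi]; apply: nsq; exists i.+1%:R; rewrite xi.
rewrite map_inj_in_uniq ?iota_uniq // => i j; rewrite !mem_iota /= => Hi Hj /eqP.
have := half_dblS => Hn.
rewrite eqf_sqr => /orP [/eqP /natFp_inj|]; first by move=> H'; apply: succn_inj; apply: H'; lia.
rewrite -subr_eq0 opprK -natrD natFp_eq0 gtnNdvd //; lia.
Qed.

(** As p > 2, the values of the character are determined by their residues; this carries
    identities from the field, where Euler's criterion applies, to the integers. *)
Lemma chi_eqFp (u v : int) : `|u| <= 1 -> `|v| <= 1 -> u%:~R = v%:~R :> F -> u = v.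
Proof.
move=> Hu Hv /eqP; rewrite -subr_eq0 -rmorphB /= int_small_eq0 ?subr_eq0 => [/eqP//|].
by lia.
Qed.

Lemma chi_le1 x : `|chi x| <= 1.
Proof. by case: (chi_cases x) => ->. Qed.

Lemma chiM x y : chi (x * y) = chi x * chi y.
Proof.
apply: chi_eqFp; rewrite ?chi_le1 //.
  by case: (chi_cases x) => ->; case: (chi_cases y) => ->.
by rewrite rmorphM /= !chi_euler exprMn.
Qed.

Lemma chi1 : chi 1 = 1.
Proof. by apply: chi_eqFp; rewrite ?chi_le1 // chi_euler expr1n. Qed.

Lemma chi_sqr x : x != 0 -> chi x * chi x = 1.
Proof. by rewrite -chi_eq0; case: (chi_cases x) => ->. Qed.

Lemma chiN1 : chi (-1) = (-1) ^+ n.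
Proof.
apply: chi_eqFp; rewrite ?chi_le1 //; first by rewrite normrX normrN1 expr1n.
by rewrite chi_euler rmorphXn /= rmorphN1.
Qed.

Lemma chiN x : chi (- x) = (-1) ^+ n * chi x.
Proof. by rewrite -[- x]mulN1r chiM chiN1. Qed.

(** Multiplication by a nonresidue permutes the field and changes the sign of the sum. *)
Lemma sum_chi : \sum_x chi x = 0.
Proof.
have [x x0 xN] : exists2 x : F, x != 0 & chi x = -1.
  suff /existsP [x /andP [x0 /eqP xN]] : [exists x : F, (x != 0) && (chi x == -1)].
    by exists x.
  apply: contraT; rewrite negb_exists => /forallP H; exfalso.
  pose rs := [seq ((i.+1)%:R : F) | i <- iota 0 n.*2].
  have := @max_unity_roots F n rs halfp_gt0; rewrite size_map size_iota => K.
  suff: (n.*2 <= n)%N by have := halfp_gt0; lia.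
  have Hn := half_dblS; apply: K.
    apply/allP => _ /mapP [i + ->]; rewrite mem_iota => /= Hi.
    rewrite unity_rootE -chi_euler.
    have i0 : i.+1%:R != 0 :> F by apply: natFp_neq0; lia.
    have := H i.+1%:R; rewrite i0 /= => chiN; have := chi_eq0 (i.+1%:R).
    by rewrite (negbTE i0); move: chiN; case: (chi_cases i.+1%:R) => ->.
  rewrite map_inj_in_uniq ?iota_uniq // => i j; rewrite !mem_iota /= => Hi Hj /natFp_inj.
  by move=> H'; apply: succn_inj; apply: H'; lia.
have : \sum_y chi y = - \sum_y chi y.
  rewrite {1}(reindex_inj (mulfI x0)) -sumrN; apply: eq_bigr => y _.
  by rewrite chiM xN mulN1r.
lia.
Qed.

(** For nonzero x and a, chi(x) chi(x + a) = chi(1 + a / x), and 1 + a / x takes every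
    value but 1 exactly once. *)
Lemma sum_chi_shift (a : F) :
  \sum_x chi x * chi (x + a) = if a == 0 then p%:Z - 1 else -1.
Proof.
have [->|a0] := eqVneq a 0.
  have -> : \sum_x chi x * chi (x + 0) = \sum_(x : F | x != 0) 1.
    rewrite [LHS](bigD1 0) //= chi0 mul0r add0r; apply: eq_bigr => x x0.
    by rewrite addr0 chi_sqr.
  rewrite sumr_const (eq_card (B := predC1 (0 : F))) // cardC1 card_Fp //.
  by rewrite natz; have := prime_gt0 p_pr; lia.
rewrite (bigD1 0) //= chi0 mul0r add0r.
transitivity (\sum_(x : F | x != 0) chi (1 + a * x^-1)).
  apply: eq_bigr => x x0.
  have -> : x + a = x * (1 + a * x^-1) by field.
  by rewrite chiM mulrA chi_sqr // mul1r.
have -> : \sum_(x : F | x != 0) chi (1 + a / x) = \sum_(x : F | x != 1) chi x.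
  rewrite [RHS](reindex_onto (fun x => 1 + a / x) (fun y => a / (y - 1))) /=.
    apply: eq_big => // x; rewrite [1 + _]addrC addrK -[X in _ = ~~ X && _]subr_eq0 addrK.
    have [->|x0] := eqVneq x 0; first by rewrite invr0 mulr0 eqxx.
    by rewrite mulf_neq0 ?invr_eq0 //=; apply/esym/eqP; field; rewrite a0 x0.
  move=> y; rewrite -subr_eq0 => y1; field; by rewrite a0 y1.
by have := sum_chi; rewrite (bigD1 1) //= chi1 => /eqP; rewrite addrC addr_eq0 => /eqP.
Qed.
End LegendreCharacter.

(** * Additive characters and Gauss sums *)

Lemma prim_root_prime (R : nzRingType) p (z : R) : prime p -> p.-primitive_root z ->
  z ^+ p = 1 /\ z != 1.
Proof.
move=> p_pr prim_z; split; first exact: prim_expr_order.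
by rewrite -[z]expr1 -(prim_order_dvd prim_z) gtnNdvd // prime_gt1.
Qed.

Section AdditiveCharacter.

Variables (p : nat) (K : fieldType) (z : K).
Hypotheses (p_pr : prime p) (p_gt2 : (2 < p)%N) (zp : z ^+ p = 1) (z1 : z != 1).
Local Notation F := 'F_p.
Local Notation chi := (@chi p).

(** The field K is arbitrary: sums of these characters are used over the algebraic
    numbers and in positive characteristic. *)
Definition ec (a : F) : K := z ^+ (nat_of_ord a).

Lemma ec_nat (i : nat) : ec i%:R = z ^+ i.
Proof.
rewrite /ec val_Fp_nat // {2}(divn_eq i p) addnC exprD mulnC exprM zp expr1n mulr1 //.
Qed.

Lemma ecD a b : ec (a + b) = ec a * ec b.
Proof. by rewrite -[a]natr_Zp -[b]natr_Zp -natrD !ec_nat exprD. Qed.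

Lemma ec0 : ec 0 = 1. Proof. by rewrite -[0]/(0%:R) ec_nat expr0. Qed.

Lemma ecM_nat a (i : nat) : ec (a * i%:R) = ec a ^+ i.
Proof. by rewrite -[a]natr_Zp -natrM !ec_nat exprM. Qed.

Lemma sum_ec : \sum_a ec a = 0.
Proof.
have : \sum_a ec a = z * \sum_a ec a.
  rewrite {1}(reindex_inj (addrI 1)) mulr_sumr; apply: eq_bigr => a _ /=.
  by rewrite ecD -[1]/(1%:R) ec_nat expr1.
move=> /eqP; rewrite -subr_eq0 -{1}[\sum_a _]mul1r -mulrBl mulf_eq0 subr_eq0 eq_sym (negbTE z1).
by move=> /eqP.
Qed.

Lemma sum_ecM b : \sum_a ec (a * b) = if b == 0 then p%:R else 0.
Proof.
have [->|b0] := eqVneq b 0.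
  under eq_bigr => a _ do rewrite mulr0 ec0.
  by rewrite sumr_const card_Fp.
by rewrite -[RHS]sum_ec [in RHS](reindex_inj (mulIf b0)).
Qed.

Definition gauss : K := \sum_a (chi a)%:~R * ec a.

(** Up to the factor [gauss], the character is its own Fourier transform. *)
Lemma gauss_twist a : \sum_b (chi b)%:~R * ec (a * b) = (chi a)%:~R * gauss.
Proof.
have [->|a0] := eqVneq a 0.
  under eq_bigr => b _ do rewrite mul0r ec0 mulr1.
  by rewrite -(rmorph_sum intr) /= sum_chi // chi0 mul0r.
rewrite /gauss [in RHS](reindex_inj (mulfI a0)) mulr_sumr; apply: eq_bigr => b _ /=.
by rewrite chiM // rmorphM /= !mulrA -rmorphM /= chi_sqr // mul1r.
Qed.

Lemma sum_chi_conv (t : F) :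
  \sum_a chi a * chi (t - a) = chi (-1) * (if t == 0 then p%:Z - 1 else -1).
Proof.
rewrite -oppr_eq0 -sum_chi_shift // mulr_sumr; apply: eq_bigr => a _.
have -> : t - a = -1 * (a - t) by ring.
by rewrite (chiM p_pr p_gt2 (-1)) mulrCA.
Qed.

Lemma mul_char_sums (f g : F -> int) :
  (\sum_a (f a)%:~R * ec a) * (\sum_b (g b)%:~R * ec b) =
  \sum_t (\sum_a f a * g (t - a))%:~R * ec t.
Proof.
rewrite mulr_suml.
under eq_bigr => a _.
  rewrite mulr_sumr (reindex_inj (addIr (- a))) /=.
  under eq_bigr => b _.
    rewrite mulrACA -ecD [a + (b - a)]addrC subrK -rmorphM /=.
    over.
  over.
rewrite exchange_big /=; apply: eq_bigr => t _.
by rewrite -mulr_suml -(rmorph_sum intr).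
Qed.

(** The convolution of chi with itself is chi(-1) (p delta_0 - 1), and the constant -1
    has transform 0. *)
Lemma gauss_sqr : gauss ^+ 2 = (chi (-1))%:~R * p%:R.
Proof.
rewrite expr2 /gauss mul_char_sums.
under eq_bigr => t _ do rewrite sum_chi_conv rmorphM /= -mulrA.
rewrite -mulr_sumr; congr (_ * _).
transitivity (\sum_t ((p%:R *+ (t == 0)) - 1) * ec t).
  apply: eq_bigr => t _; case: eqP => [->|_]; first by rewrite ec0 rmorphB /=.
  by rewrite sub0r rmorphN1.
under eq_bigr => t _ do rewrite mulrBl mul1r.
rewrite sumrB sum_ec subr0 (bigD1 0) //= ?eqxx ec0 mulr1 big1 ?addr0 // => t t0.
by rewrite (negbTE t0) mul0r.
Qed.

End AdditiveCharacter.

(** * Gauss periods and the roots of X^2 + X + m modulo a prime *)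

Section Periods.

Variables (p m : nat).
Hypotheses (p_pr : prime p) (pm : p.+1 = (4 * m)%N).
Local Notation F := 'F_p.
Local Notation chi := (@chi p).

Lemma p_gt2_of_4m : (2 < p)%N.
Proof. by have := prime_gt1 p_pr; lia. Qed.
Local Notation p_gt2 := p_gt2_of_4m.

Lemma half_of_4m : halfp p = (2 * m).-1.
Proof. by have := half_dblS p_pr p_gt2; rewrite -addnn; lia. Qed.

Lemma chiN1_of_4m : chi (-1) = -1.
Proof.
have m0 : (0 < m)%N by case: m pm.
rewrite (chiN1 p_pr p_gt2) half_of_4m -signr_odd.
by have -> : odd (2 * m).-1 = true by lia.
Qed.

Section InField.

Variables (K : fieldType) (z : K).
Hypotheses (zp : z ^+ p = 1) (z1 : z != 1).
Local Notation ec := (@ec p K z).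

Definition period (s : int) : K := \sum_(a | chi a == s) ec a.

Lemma period_sum : period 1 + period (-1) = -1.
Proof.
have := sum_ec p_pr zp z1; rewrite (bigD1 0) //= ec0 // => /eqP.
rewrite addrC addr_eq0 => /eqP <-.
rewrite (bigID (fun a => chi a == 1)) /=; congr (_ + _); apply: eq_bigl => a;
  rewrite -(chi_eq0 a); by case: (chi_cases a) => ->.
Qed.

(** For s = 1 or s = -1 this is twice the indicator of chi = s; it is a polynomial in chi,
    so that convolutions reduce to character sums. *)
Let ind (s : int) (a : F) : int := chi a * chi a + s * chi a.

Lemma sum_chi_sqr : \sum_a chi a * chi a = p%:Z - 1.
Proof.
have := sum_chi_shift p_pr p_gt2 (0 : F); rewrite eqxx => <-.
by apply: eq_bigr => a _; rewrite addr0.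
Qed.

Lemma chi_sqr_ind a : chi a * chi a = (a != 0)%:R.
Proof.
by have [->|a0] := eqVneq a 0; [rewrite chi0 | rewrite chi_sqr ?p_gt2].
Qed.

Lemma sum_chi_punctured (t : F) : \sum_a (chi a * chi a) * chi (t - a) = - chi t.
Proof.
have inj : injective (fun a : F => t - a) by move=> a b /addrI /oppr_inj.
have := sum_chi p_pr p_gt2; rewrite (reindex_inj inj) /=.
rewrite (bigD1 0) //= subr0 => /eqP; rewrite addr_eq0 => /eqP ->; rewrite opprK.
rewrite (bigD1 0) //= chi0 !mul0r add0r; apply: eq_bigr => a a0.
by rewrite chi_sqr_ind a0 mul1r.
Qed.

Lemma period_conv (t : F) :
  \sum_a ind 1 a * ind (-1) (t - a) = if t == 0 then 2 * (p%:Z - 1) else p%:Z - 3.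
Proof.
have -> : \sum_a ind 1 a * ind (-1) (t - a) =
  \sum_a (chi a * chi a) * (chi (t - a) * chi (t - a)) - \sum_a (chi a * chi a) * chi (t - a)
  + \sum_a chi a * (chi (t - a) * chi (t - a)) - \sum_a chi a * chi (t - a).
  by rewrite -!sumrB -big_split /= -sumrB; apply: eq_bigr => a _; rewrite /ind; ring.
have -> : \sum_a chi a * (chi (t - a) * chi (t - a)) = - chi t.
  have inj : injective (fun a : F => t - a) by move=> a b /addrI /oppr_inj.
  rewrite (reindex_inj inj) /= -sum_chi_punctured; apply: eq_bigr => a _.
  by rewrite (_ : t - (t - a) = a) 1?mulrC //; ring.
rewrite sum_chi_punctured sum_chi_conv ?p_gt2 // chiN1_of_4m.
have -> : \sum_a chi a * chi a * (chi (t - a) * chi (t - a)) = p%:Z - 1 - (t != 0)%:R.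
  rewrite (bigD1 t) //= subrr chi0 !mulr0 add0r.
  have := sum_chi_sqr; rewrite (bigD1 t) //= chi_sqr_ind => <-.
  rewrite addrAC subrr add0r; apply: eq_bigr => a at_.
  by rewrite (chi_sqr_ind (t - a)) subr_eq0 eq_sym at_ mulr1.
by case: eqP => _ /=; lia.
Qed.

Lemma period_prod : period 1 * period (-1) = m%:R.
Proof.
pose i1 (s : int) (a : F) : int := (chi a == s)%:R.
have perE s : period s = \sum_a (i1 s a)%:~R * ec a.
  rewrite /period big_mkcond /=; apply: eq_bigr => a _.
  by rewrite /i1; case: eqP => _; rewrite ?mul1r ?mul0r.
rewrite !perE mul_char_sums //.
have conv t : \sum_a i1 1 a * i1 (-1) (t - a) = m%:Z - 1 + m%:Z * (t == 0)%:R.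
  have := period_conv t.
  have -> : \sum_a ind 1 a * ind (-1) (t - a) = 4 * \sum_a i1 1 a * i1 (-1) (t - a).
    rewrite mulr_sumr; apply: eq_bigr => a _; rewrite /ind /i1.
    by case: (chi_cases a) => ->; case: (chi_cases (t - a)) => ->.
  by case: eqP => _ /=; lia.
under eq_bigr => t _ do rewrite conv rmorphD /= mulrDl.
rewrite big_split /= -mulr_sumr sum_ec // mulr0 add0r (bigD1 0) //= ec0 //.
rewrite big1 ?addr0 => [|t /negbTE ->]; last by rewrite mulr0 mul0r.
by rewrite ?eqxx !mulr1.
Qed.

(** In characteristic l the l-th power map is additive and maps z^a to z^(l a). *)
Lemma period_Frobenius l s : l \in [pchar K] -> ~~ (p %| l)%N ->
  period s ^+ l = period (s * chi l%:R).
Proof.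
move=> lK pl.
have l0 : l%:R != 0 :> F by rewrite natFp_eq0.
rewrite -(pFrobenius_autE lK) rmorph_sum /= /period.
rewrite [RHS](reindex_inj (mulIf l0)) /=; apply: eq_big => [a|a _].
  rewrite (chiM p_pr p_gt2); have l2 := chi_sqr l0.
  have l1 : chi l%:R != 0 by rewrite chi_eq0.
  by rewrite (inj_eq (mulIf l1)).
by rewrite (pFrobenius_autE lK) (ecM_nat p_pr zp).
Qed.

End InField.

(** The periods are the roots of X^2 + X + m in characteristic l, and the Frobenius map
    fixes or exchanges them according to chi l; this is the quadratic reciprocity law,
    in a form that includes l = 2. *)
Lemma root_count_prime (l : nat) : prime l -> l != p ->
  \sum_(b < l) (l %| b ^ 2 + b + m)%N%:R = 1 + chi l%:R.
Proof.
move=> l_pr lp.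
have pl : ~~ (p %| l)%N by rewrite dvdn_prime2 // eq_sym.
have lp' : ~~ (l %| p)%N by rewrite dvdn_prime2.
have p1 : (0 < p.-1)%N by have := p_gt2; lia.
(* p divides l^(p-1) - 1, so a field of l^(p-1) elements contains the p-th roots of unity *)
have [K lK cardK] := pPrimePowerField l_pr p1.
have pdiv_card : (p %| #|K|.-1)%N.
  rewrite cardK -subn1 -natFp_eq0 // natrB ?expn_gt0 ?prime_gt0 // natrX.
  have -> : p.-1 = (halfp p).*2 by have := half_dblS p_pr p_gt2; lia.
  rewrite expFp_pred ?subrr // ?p_gt2 //.
  by rewrite natFp_eq0.
pose q := (#|K|.-1 %/ p)%N.
have qp : (q * p = #|K|.-1)%N by rewrite divnK.
have card_gt1 : (1 < #|K|)%N by rewrite cardK -{1}(expn0 l) ltn_exp2l ?prime_gt1.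
have [x x0 xq] : exists2 x : K, x != 0 & x ^+ q != 1.
  suff /existsP [x /andP [x0 xN]] : [exists x : K, (x != 0) && (x ^+ q != 1)] by exists x.
  apply: contraT; rewrite negb_exists => /forallP H; exfalso.
  have q0 : (0 < q)%N by lia.
  have := @max_unity_roots K q (enum (predC1 (0 : K))) q0; rewrite -cardE cardC1 => HH.
  suff: (#|K|.-1 <= q)%N by have := prime_gt1 p_pr; nia.
  apply: HH; last exact: enum_uniq.
  apply/allP => y; rewrite mem_enum inE => y0; rewrite unity_rootE.
  by have := H y; rewrite y0 /= negbK.
pose z := x ^+ q.
have zp : z ^+ p = 1.
  rewrite -exprM qp; apply: (mulfI x0); rewrite -exprS prednK ?(ltnW card_gt1) //.
  by rewrite expf_card mulr1.
pose e1 := period z 1; pose e2 := period z (-1).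
have sum12 : e1 + e2 = -1 by apply: period_sum.
have prod12 : e1 * e2 = m%:R by apply: period_prod.
have ne12 : e1 != e2.
  apply/eqP => e12.
  have : (e1 - e2) ^+ 2 = - p%:R.
    have -> : (e1 - e2) ^+ 2 = (e1 + e2) ^+ 2 - 4 * (e1 * e2) by ring.
    rewrite sum12 prod12 sqrrN expr1n -natrM -pm -natr1; ring.
  rewrite e12 subrr expr0n /= => /eqP; rewrite eq_sym oppr_eq0 -(dvdn_pcharf lK).
  by rewrite (negbTE lp').
have factor (b : nat) : (b ^ 2 + b + m)%N%:R = (b%:R - e1) * (b%:R - e2) :> K.
  rewrite !natrD natrX -prod12.
  have -> : (b%:R - e1) * (b%:R - e2) = b%:R ^+ 2 - (e1 + e2) * b%:R + e1 * e2 by ring.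
  by rewrite sum12; ring.
have -> : \sum_(b < l) (l %| b ^ 2 + b + m)%N%:R =
    \sum_(b < l) ((b%:R == e1)%:R : int) + \sum_(b < l) ((b%:R == e2)%:R : int).
  rewrite -big_split /=; apply: eq_bigr => b _.
  rewrite (dvdn_pcharf lK) factor mulf_eq0 !subr_eq0.
  case: eqP => [->|_]; last by case: eqP.
  by rewrite (negbTE ne12).
have inj_nat (b c : 'I_l) : b%:R = c%:R :> K -> b = c.
  move=> /eqP; wlog bc : b c / (b <= c)%N.
    by move=> W; case: (leqP b c) => [/W //|/ltnW /W cb /eqP/esym/eqP/cb].
  rewrite eq_sym -subr_eq0 -natrB // -(dvdn_pcharf lK) => dv.
  apply/val_inj/eqP; rewrite eqn_leq bc /= -subn_eq0 eqn0Ngt; apply/negP => /dvdn_leq /(_ dv).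
  by have := ltn_ord c; lia.
have count_root (e : K) : e ^+ l = e -> \sum_(b < l) ((b%:R == e)%:R : int) = 1.
  move=> el.
  have [b /eqP be] : exists b : 'I_l, b%:R == e.
    apply/existsP; apply: contraT; rewrite negb_exists => /forallP H; exfalso.
    have l1 := prime_gt1 l_pr.
    have sz : size ('X^l - 'X : {poly K}) = l.+1.
      by rewrite size_polyDl size_polyXn // size_polyN size_polyX.
    have /max_poly_roots : 'X^l - 'X != 0 :> {poly K} by rewrite -size_poly_eq0 sz.
    move=> /(_ (e :: [seq (nat_of_ord b)%:R | b <- enum 'I_l])) /=.
    rewrite sz size_map size_enum_ord ltnn => HH; suff: false by []; apply: HH.
      rewrite rootE !hornerE el subrr eqxx /=; apply/allP => y /mapP [b _ ->].
      by rewrite rootE !hornerE -(pFrobenius_autE lK) pFrobenius_aut_nat subrr.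
    rewrite map_inj_in_uniq ?enum_uniq ?andbT => [|b c _ _]; last exact: inj_nat.
    by apply/negP => /mapP [b _ eb]; have := H b; rewrite eb eqxx.
  rewrite (bigD1 b) //= be eqxx big1 // => c cb; case: eqP => // ce.
  by move: cb; rewrite (inj_nat c b) ?eqxx // ce be.
have count_noroot (e : K) : e ^+ l != e -> \sum_(b < l) ((b%:R == e)%:R : int) = 0.
  move=> el; rewrite big1 // => b _; case: eqP => // be.
  by move: el; rewrite -be -(pFrobenius_autE lK) pFrobenius_aut_nat eqxx.
(* a period lies in the prime field, where b ranges, if and only if Frobenius fixes it *)
have F1 : e1 ^+ l = period z (1 * chi l%:R) by exact: (period_Frobenius zp _ lK pl).
have F2 : e2 ^+ l = period z (-1 * chi l%:R) by exact: (period_Frobenius zp _ lK pl).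
have l0 : l%:R != 0 :> F by rewrite natFp_eq0.
have := chi_sqr l0; case: (chi_cases (l%:R : F)) => Hl; rewrite Hl // in F1 F2 * => _.
  rewrite mulr1 in F1; rewrite mulr1 in F2.
  by rewrite !count_root.
rewrite mulrN1 in F1; rewrite mulrN1 opprK in F2.
by rewrite !count_noroot ?F1 ?F2 // -/e1 -/e2 // eq_sym.
Qed.

End Periods.

(** * Multiplicative functions *)

Definition multiplicative_nat (f : nat -> int) : Prop :=
  f 1%N = 1 /\ forall a b, (0 < a)%N -> (0 < b)%N -> coprime a b -> f (a * b)%N = f a * f b.

(** Dirichlet convolution. *)
Definition dconv (f g : nat -> int) (n : nat) : int :=
  \sum_(d <- divisors n) f d * g (n %/ d)%N.

(** A divisor x of a b is the product of gcd(x, a) and gcd(x, b). *)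
Lemma divisors_coprime_mul a b : (0 < a)%N -> (0 < b)%N -> coprime a b ->
  perm_eq (divisors (a * b)) [seq (d * e)%N | d <- divisors a, e <- divisors b].
Proof.
move=> a0 b0 cab.
have gcd_l d e : (d %| a)%N -> (e %| b)%N -> gcdn (d * e) a = d.
  move=> da eb; rewrite gcdnC Gauss_gcdl; first by apply/gcdn_idPr.
  exact: coprime_dvdr eb _.
have gcd_r d e : (d %| a)%N -> (e %| b)%N -> gcdn (d * e) b = e.
  move=> da eb; rewrite gcdnC Gauss_gcdr; first by apply/gcdn_idPr.
  by rewrite coprime_sym; apply: coprime_dvdl da _.
apply: uniq_perm; first exact: divisors_uniq.
  apply: allpairs_uniq; rewrite ?divisors_uniq // => -[d e] [d' e'] /=.
  move=> /allpairsP [[x y] [/= xa yb [-> ->]]] /allpairsP [[x' y'] [/= xa' yb' [-> ->]]] E.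
  move: xa xa' yb yb'; rewrite -!dvdn_divisors // => xa xa' yb yb'.
  have Ex : x = x' by rewrite -(gcd_l _ _ xa yb) E gcd_l.
  have Ey : y = y' by rewrite -(gcd_r _ _ xa yb) E gcd_r.
  by rewrite Ex Ey.
move=> x; rewrite -dvdn_divisors ?muln_gt0 ?a0 //; apply/idP/allpairsP.
  move=> xab; exists (gcdn x a, gcdn x b); rewrite /= -!dvdn_divisors // !dvdn_gcdr; split=> //.
  have cg : coprime (gcdn x a) (gcdn x b).
    by apply: coprime_dvdl (dvdn_gcdr _ _) _; apply: coprime_dvdr (dvdn_gcdr _ _) _.
  apply/eqP; rewrite eqn_dvd; apply/andP; split; last first.
    by rewrite Gauss_dvd // !dvdn_gcdl.
  rewrite muln_gcdl !muln_gcdr !dvdn_gcd dvdn_mulr // dvdn_mulr // dvdn_mull //.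
move=> [[d e] [/=]]; rewrite -!dvdn_divisors // => da eb ->.
exact: dvdn_mul.
Qed.

Lemma dconv_multiplicative f g : multiplicative_nat f -> multiplicative_nat g ->
  multiplicative_nat (dconv f g).
Proof.
move=> [f1 fM] [g1 gM]; split.
  by rewrite /dconv (_ : divisors 1 = [:: 1%N]) // big_seq1 f1 divn1 g1.
move=> a b a0 b0 cab; rewrite /dconv (perm_big _ (divisors_coprime_mul a0 b0 cab)) /=.
rewrite big_allpairs_dep big_distrlr /= big_seq [RHS]big_seq; apply: eq_bigr => d.
rewrite -dvdn_divisors // => da; rewrite big_seq [RHS]big_seq; apply: eq_bigr => e.
rewrite -dvdn_divisors // => eb.
have cde : coprime d e by apply: coprime_dvdl da _; apply: coprime_dvdr eb _.
have d0 := dvdn_gt0 a0 da; have e0 := dvdn_gt0 b0 eb.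
have -> : ((a * b) %/ (d * e))%N = ((a %/ d) * (b %/ e))%N.
  rewrite -{1}(divnK da) -{1}(divnK eb) mulnACA mulnK // muln_gt0 d0 //.
have ad0 : (0 < a %/ d)%N by rewrite divn_gt0 //; apply: dvdn_leq.
have be0 : (0 < b %/ e)%N by rewrite divn_gt0 //; apply: dvdn_leq.
have cq : coprime (a %/ d) (b %/ e).
  by apply: coprime_dvdl (dvdn_div da) _; apply: coprime_dvdr (dvdn_div eb) _.
by rewrite (fM _ _ d0 e0 cde) (gM _ _ ad0 be0 cq); ring.
Qed.

Lemma multiplicative_ext f g : multiplicative_nat f -> multiplicative_nat g ->
  (forall l k, prime l -> f (l ^ k)%N = g (l ^ k)%N) -> forall n, (0 < n)%N -> f n = g n.
Proof.
move=> [f1 fM] [g1 gM] fg n; have [N] := ubnP n; elim: N n => // N IH n nN n0.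
have [n1|n1] := leqP n 1.
  by have -> : n = 1%N by [lia]; rewrite f1 g1.
pose l := pdiv n; have l_pr : prime l by apply: pdiv_prime.
have [k lk kn] := pfactor_coprime l_pr n0.
have k0 : (0 < k)%N by case: k kn {lk} => // kn; move: n0; rewrite kn.
have v0 : (0 < logn l n)%N by rewrite logn_gt0 pi_pdiv.
have lv1 : (1 < l ^ logn l n)%N by rewrite -{1}(expn0 l) ltn_exp2l ?prime_gt1.
have ckl : coprime k (l ^ logn l n) by rewrite coprime_sym coprimeXl.
have lv0 : (0 < l ^ logn l n)%N by rewrite expn_gt0 prime_gt0.
have kN : (k < N)%N.
  by apply: leq_trans (_ : k < n)%N _; [rewrite {1}kn ltn_Pmulr | rewrite -ltnS].
by rewrite kn (fM _ _ k0 lv0 ckl) (gM _ _ k0 lv0 ckl) (fg _ _ l_pr) (IH k kN k0).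
Qed.

Lemma dconv_prime_power f g l k : prime l ->
  dconv f g (l ^ k)%N = \sum_(i < k.+1) f (l ^ i)%N * g (l ^ (k - i))%N.
Proof.
move=> l_pr; have l0 := prime_gt0 l_pr.
have P : perm_eq (divisors (l ^ k)) [seq (l ^ nat_of_ord i)%N | i <- enum 'I_k.+1].
  apply: uniq_perm; first exact: divisors_uniq.
    rewrite map_inj_uniq ?enum_uniq // => i j /eqP.
    by rewrite eqn_exp2l ?prime_gt1 // => /eqP /val_inj.
  move=> x; rewrite -dvdn_divisors ?expn_gt0 ?l0 //; apply/idP/mapP.
    case/(dvdn_pfactor _ _ l_pr) => i ik ->; exists (inord i); rewrite ?mem_enum //.
    by rewrite inordK.
  by case=> i _ ->; rewrite dvdn_exp2l // -ltnS.
rewrite /dconv (perm_big _ P) big_map big_enum /=; apply: eq_bigr => i _.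
by rewrite -expnB ?l0 // -ltnS.
Qed.

Definition is_square (n : nat) : bool := [exists e : 'I_n.+1, (e ^ 2 == n)%N].

Lemma is_squareP n : reflect (exists e, (e ^ 2)%N = n) (is_square n).
Proof.
apply: (iffP existsP) => [[e /eqP <-]|[e en]]; first by exists e.
have eln : (e < n.+1)%N by rewrite -en; nia.
by exists (Ordinal eln); apply/eqP.
Qed.

(** If e^2 = x y with x and y coprime then x = gcd(e, x)^2. *)
Lemma square_coprime_mul a b : (0 < a)%N -> (0 < b)%N -> coprime a b ->
  is_square (a * b) = is_square a && is_square b.
Proof.
move=> a0 b0 cab; apply/is_squareP/andP; last first.
  by case=> /is_squareP [e <-] /is_squareP [f <-]; exists (e * f)%N; rewrite expnMn.
case=> e eab.
have sq x y : (0 < x)%N -> (0 < y)%N -> coprime x y -> (e ^ 2 = x * y)%N -> is_square x.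
  move=> x0 y0 cxy exy; apply/is_squareP; exists (gcdn e x).
  have e0 : (0 < e)%N by case: e exy {eab} => //; rewrite exp0n //; nia.
  have gx : (gcdn e x ^ 2 %| x)%N.
    have : (gcdn e x ^ 2 %| x * y)%N by rewrite -exy dvdn_exp2r // dvdn_gcdl.
    rewrite Gauss_dvdl // coprimeXl //; exact: coprime_dvdl (dvdn_gcdr _ _) _.
  apply/eqP; rewrite eqn_dvd gx /=.
  rewrite -[X in (_ %| X)%N]mulnn muln_gcdl !muln_gcdr !dvdn_gcd [(e * e)%N]mulnn exy.
  by apply/andP; split; apply/andP; split; (exact: dvdn_mulr || exact: dvdn_mull).
by split; [apply: sq eab | apply: (sq b a) => //; [rewrite coprime_sym | rewrite mulnC]].
Qed.

Lemma square_multiplicative : multiplicative_nat (fun n => (is_square n)%:R).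
Proof.
split; first by have -> : is_square 1 by apply/is_squareP; exists 1%N.
by move=> a b a0 b0 cab; rewrite square_coprime_mul //; do 2! case: is_square.
Qed.

Lemma square_prime_power l k : prime l -> is_square (l ^ k) = ~~ odd k.
Proof.
move=> l_pr; apply/is_squareP/idP => [[e /(congr1 (logn l))]|ok].
  by rewrite lognX pfactorK // => <-; rewrite oddM.
by exists (l ^ k./2)%N; rewrite -expnM muln2 -{2}(odd_double_half k) (negbTE ok).
Qed.

Lemma sum_blocks (f : nat -> int) l q :
  \sum_(b < l * q) f b = \sum_(t < l) \sum_(x < q) f (x + t * q)%N.
Proof.
elim: l => [|l IH]; first by rewrite !big_ord0.
rewrite big_ord_recr /= -IH mulSn addnC big_split_ord /=; congr (_ + _).
by apply: eq_bigr => x _; rewrite addnC.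
Qed.

(** * The number of roots of X^2 + X + m modulo a *)

Section RootCount.

Variable m : nat.

Definition quad (b : nat) : nat := (b ^ 2 + b + m)%N.

Definition rho (a : nat) : int := \sum_(b < a) (a %| quad b)%N%:R.

Lemma quad_mod a b : (a %| quad (b %% a))%N = (a %| quad b)%N.
Proof.
rewrite /dvdn; congr (_ == _); rewrite /quad -[LHS]modnDml -[RHS]modnDml.
by congr ((_ + _) %% _)%N; rewrite -modnDm modnXm modn_mod modnDm.
Qed.

(** The Chinese remainder theorem. *)
Lemma rho_coprime a b : (0 < a)%N -> (0 < b)%N -> coprime a b -> rho (a * b) = rho a * rho b.
Proof.
move=> a0 b0 cab; rewrite /rho big_distrlr /=.
transitivity (\sum_(c < a * b) \sum_(x < a) \sum_(y < b)
   ((a %| quad x)%N && (b %| quad y)%N && (c %% a == x)%N && (c %% b == y)%N)%:R : int).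
  apply: eq_bigr => c _; have [xa yb] := (ltn_pmod c a0, ltn_pmod c b0).
  rewrite (bigD1 (Ordinal xa)) //= (bigD1 (Ordinal yb)) //= !eqxx !andbT.
  rewrite !quad_mod Gauss_dvd // big1 ?addr0 => [|y yn].
    rewrite big1 ?addr0 // => x xn; rewrite big1 // => y _.
    by rewrite -val_eqE /= eq_sym in xn; rewrite (negbTE xn) !andbF.
  by rewrite -val_eqE /= eq_sym in yn; rewrite (negbTE yn) !andbF.
rewrite exchange_big /=; apply: eq_bigr => x _; rewrite exchange_big /=; apply: eq_bigr => y _.
have cl : (chinese a b x y %% (a * b) < a * b)%N by rewrite ltn_pmod ?muln_gt0 ?a0.
rewrite (bigD1 (Ordinal cl)) //=.
have e1 : (chinese a b x y %% (a * b) %% a)%N = x.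
  by rewrite modn_dvdm ?dvdn_mulr // chinese_modl // modn_small.
have e2 : (chinese a b x y %% (a * b) %% b)%N = y.
  by rewrite modn_dvdm ?dvdn_mull // chinese_modr // modn_small.
rewrite e1 e2 !eqxx !andbT big1 ?addr0; first by do 2! case: (_ %| _)%N.
move=> c cn; case: (boolP (_ && _)) => // /andP [/andP [_ /eqP c1] /eqP c2].
move: cn; rewrite -val_eqE /= => /eqP []; rewrite -(modn_small (ltn_ord c)).
by apply/eqP; rewrite -c1 -c2 -chinese_mod.
Qed.

Lemma rho_multiplicative : multiplicative_nat rho.
Proof.
by split; [rewrite /rho big_ord_recr big_ord0 /= dvd1n | apply: rho_coprime].
Qed.

Variable p : nat.
Hypotheses (p_pr : prime p) (pm : p.+1 = (4 * m)%N).

Lemma quad_disc b : ((2 * b + 1) ^ 2 + p = 4 * quad b)%N.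
Proof. by rewrite /quad; move: pm; lia. Qed.

(** Hensel lifting: the derivative 2b + 1 is prime to l, so that a root modulo l^k has
    exactly one lift. *)
Lemma rho_lift l k : prime l -> l != p -> (0 < k)%N -> rho (l ^ k.+1) = rho (l ^ k).
Proof.
move=> l_pr lp k0; have l0 := prime_gt0 l_pr.
rewrite /rho; set q := (l ^ k)%N.
have q0 : (0 < q)%N by rewrite expn_gt0 l0.
have lq : (l ^ k.+1 = l * q)%N by rewrite expnS.
have lkq : (l %| q)%N by rewrite -{1}(expn1 l) dvdn_exp2l.
transitivity (\sum_(x < q) \sum_(t < l) (l * q %| quad (x + t * q))%N%:R : int).
  by rewrite exchange_big /= lq (sum_blocks (fun b => (l * q %| quad b)%N%:R)).
apply: eq_bigr => x _.
have expand t : quad (x + t * q) = (quad x + t * q * (2 * x + 1) + (t * q) ^ 2)%N.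
  by rewrite /quad; lia.
case: (boolP (q %| quad x)%N) => [/dvdnP [c xc]|nqx]; last first.
  rewrite big1 // => t _; case: (boolP (_ %| _)%N) => // H.
  have : (q %| quad (x + t * q))%N by apply: dvdn_trans H; rewrite dvdn_mull.
  rewrite expand dvdn_addl; last by rewrite expnMn -mulnn dvdn_mull // dvdn_mull.
  by rewrite dvdn_addl ?(negbTE nqx) // -mulnA mulnCA dvdn_mulr.
have red t : (l * q %| quad (x + t * q))%N = (l %| c + t * (2 * x + 1))%N.
  rewrite expand dvdn_addl; last first.
    by rewrite expnMn dvdn_mull // -mulnn dvdn_mul.
  by rewrite xc (_ : c * q + _ = (c + t * (2 * x + 1)) * q)%N ?dvdn_pmul2r //; lia.
have cop : coprime l (2 * x + 1).
  rewrite prime_coprime //; apply/negP => ld.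
  have : (l %| 4 * quad x)%N by rewrite xc dvdn_mull // dvdn_mull.
  rewrite -quad_disc dvdn_addr; first by rewrite dvdn_prime2 // (negbTE lp).
  by rewrite -mulnn dvdn_mull.
have cop' : (2 * x + 1)%:R != 0 :> 'F_l.
  by rewrite natFp_eq0 // -prime_coprime.
pose t0 : 'F_l := - c%:R / (2 * x + 1)%:R.
have t0l : (t0 < l)%N by have := ltn_ord t0; rewrite [X in (_ < X)%N]Fp_cast.
have div_t t : (l %| c + t * (2 * x + 1))%N = (t%:R == t0).
  rewrite -natFp_eq0 // natrD natrM addrC addr_eq0.
  by rewrite /t0 -[RHS](inj_eq (mulIf cop')) divfK.
clearbody t0; have t0E := natr_Zp t0.
rewrite (bigD1 (Ordinal t0l)) //= red div_t t0E eqxx big1 => [|t tt].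
  by rewrite addr0.
rewrite red div_t; case: eqP => // tE; move: tt; rewrite -val_eqE /=.
by rewrite -tE val_Fp_nat // modn_small // eqxx.
Qed.

Lemma rho_prime_power l k : prime l -> l != p -> rho (l ^ k.+1) = 1 + chi (l%:R : 'F_p).
Proof.
move=> l_pr lp; elim: k => [|k IH]; last by rewrite rho_lift.
by rewrite expn1; apply: root_count_prime.
Qed.

(** As 4 (b^2 + b + m) = (2 b + 1)^2 + p, the only root modulo p is (p-1)/2, and it is a
    double root. *)
Lemma rho_ramified : rho p = 1.
Proof.
have p2 := p_gt2_of_4m p_pr pm.
have hp : (p.-1./2 < p)%N by lia.
have dv b : (p %| quad b)%N = (p %| 2 * b + 1)%N.
  have -> : (p %| quad b)%N = (p %| 4 * quad b)%N.
    rewrite Euclid_dvdM // [(p %| 4)%N](_ : _ = false) //.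
    by rewrite (_ : 4 = 2 ^ 2)%N // Euclid_dvdX // andbT dvdn_prime2 //; lia.
  by rewrite -quad_disc dvdn_addl // Euclid_dvdX // andbT.
rewrite /rho (bigD1 (Ordinal hp)) //= dv.
have -> : (2 * p.-1./2 + 1 = p)%N by move: pm; lia.
rewrite dvdnn big1 ?addr0 // => b bn; rewrite dv; case: (boolP (_ %| _)%N) => // /dvdnP [k kE].
have bp := ltn_ord b; have k1 : (k = 1)%N by nia.
by move: bn; rewrite -val_eqE /=; rewrite k1 in kE; lia.
Qed.

(** A root modulo p^2 would make p^2 divide p. *)
Lemma rho_ramified_power k : rho (p ^ k.+2) = 0.
Proof.
have p2 := p_gt2_of_4m p_pr pm.
rewrite /rho big1 // => b _; case: (boolP (_ %| _)%N) => // H; exfalso.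
have Hp : (p ^ 2 %| 4 * quad b)%N.
  by apply: dvdn_mull; apply: dvdn_trans H; rewrite dvdn_exp2l.
have pb : (p %| 2 * b + 1)%N.
  have : (p %| (2 * b + 1) ^ 2 + p)%N.
    by rewrite quad_disc; apply: dvdn_trans Hp; rewrite -{1}(expn1 p) dvdn_exp2l.
  by rewrite dvdn_addl // Euclid_dvdX // andbT.
have : (p ^ 2 %| p)%N.
  by rewrite -(dvdn_addr _ (dvdn_exp2r 2 pb)) quad_disc.
move/dvdn_leq => /(_ (prime_gt0 p_pr)); rewrite -mulnn; nia.
Qed.

(** * Ideal counts *)

(** By the classification of the ideals as e (a, b + omega), with b a root of X^2 + X + m
    modulo a, this is the number of ideals of norm n = e^2 a. *)
Definition rep (n : nat) : int := dconv (fun d => (is_square d)%:R) rho n.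

Definition chi_nat (d : nat) : int := chi (d%:R : 'F_p).

Lemma chi_nat_multiplicative : multiplicative_nat chi_nat.
Proof.
have p2 := p_gt2_of_4m p_pr pm.
split=> [|a b _ _ _]; first by rewrite /chi_nat chi1.
by rewrite /chi_nat natrM chiM.
Qed.

Lemma one_multiplicative : multiplicative_nat (fun=> 1).
Proof. by split. Qed.

(** Both sides are multiplicative; on powers of l they satisfy the same two-step
    recursion. *)
Lemma rep_chi n : (0 < n)%N -> rep n = \sum_(d <- divisors n) chi_nat d.
Proof.
have p2 := p_gt2_of_4m p_pr pm.
have -> : \sum_(d <- divisors n) chi_nat d = dconv chi_nat (fun=> 1) n.
  by apply: eq_bigr => d _; rewrite mulr1.
move: n; apply: multiplicative_ext.
- exact: dconv_multiplicative square_multiplicative rho_multiplicative.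
- exact: dconv_multiplicative chi_nat_multiplicative one_multiplicative.
move=> l k l_pr; rewrite /rep !dconv_prime_power //.
have chiX i : chi_nat (l ^ i) = chi_nat l ^+ i.
  elim: i => [|i IH]; first by rewrite expn0 /chi_nat chi1.
  by rewrite expnS /chi_nat natrM chiM // -[chi (l ^ i)%:R]/(chi_nat (l ^ i)) IH exprS.
under eq_bigr => i _ do rewrite square_prime_power //.
under [RHS]eq_bigr => i _ do rewrite mulr1 chiX.
set x := chi_nat l.
have r0 : rho (l ^ 0) = 1 by rewrite /rho big_ord_recr big_ord0 /= dvd1n.
have r1 : rho (l ^ 1) = 1 + x.
  have [lp|lp] := eqVneq l p; last by rewrite rho_prime_power.
  by rewrite /x lp expn1 rho_ramified /chi_nat pchar_Fp_0 // chi0 addr0.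
have r2 j : rho (l ^ j.+2) = x ^+ j.+1 + x ^+ j.+2.
  have [lp|lp] := eqVneq l p.
    by rewrite /x lp rho_ramified_power /chi_nat pchar_Fp_0 // chi0 !exprS !mul0r.
  rewrite rho_prime_power //.
  have : x * x = 1 by apply: chi_sqr; rewrite natFp_eq0 // dvdn_prime2 // eq_sym.
  rewrite -/x; case: (chi_cases (l%:R : 'F_p)); rewrite /x /chi_nat => ->.
  - by rewrite mul0r.
  - by rewrite !expr1n.
  - by move=> _; rewrite subrr [(-1) ^+ j.+2]exprS mulN1r subrr.
elim/ltn_ind: k => -[|[|k]] IH.
- by rewrite !big_ord_recr !big_ord0 /= subnn r0 expr0.
- by rewrite !big_ord_recr !big_ord0 /= subn0 r1 expr0 expr1; ring.
rewrite big_ord_recl big_ord_recl /= subn0 mul1r mul0r add0r r2.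
under eq_bigr => i _ do rewrite /bump /= !add1n negbK !subSS.
rewrite IH ?leqnSn // [RHS]big_ord_recr [in RHS]big_ord_recr /=; ring.
Qed.

End RootCount.

(** * Smooth weights and their iterated differences *)

(** A smooth cut-off, of degree k. Binomial coefficients are chosen since their differences
    are again binomial coefficients, so that all estimates take place in the integers. *)
Definition wt (k : nat) (s : int) : int := if s is Posz t then 'C(t, k)%:Z else 0.

Lemma wt_diff k s : wt k.+1 s - wt k.+1 (s - 1) = wt k (s - 1).
Proof.
case: s => [[|t]|t] //.
have -> : (Posz t.+1 - 1 = Posz t) by lia.
by rewrite /wt binS PoszD addrAC subrr add0r.
Qed.

Lemma wt_ge0 k s : 0 <= wt k s. Proof. by case: s. Qed.

Lemma wt_le0 k s : s <= 0 -> wt k.+1 s = 0.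
Proof. by case: s => [[|t]|t]. Qed.

Lemma wt_le k s t : s <= t -> wt k s <= wt k t.
Proof.
case: s => [s|s]; last by rewrite wt_ge0.
case: t => [t|t] //=; rewrite !lez_nat; exact: leq_bin2l.
Qed.

Lemma bin_le_exp m k : ('C(m, k) <= m ^ k)%N.
Proof.
elim: k m => [|k IH] m; first by rewrite bin0.
case: m => [|m]; first by rewrite bin0n.
rewrite -(leq_pmul2l (ltn0Sn k)) -mul_bin_diag expnS mulnCA leq_mul //.
apply: leq_trans (IH m) _; apply: leq_trans (leq_pmull _ (ltn0Sn k)).
by case: k {IH} => // k; rewrite leq_exp2r.
Qed.

Lemma wt_le_exp k s (t : nat) : s <= t%:Z -> wt k s <= t%:Z ^+ k.
Proof.
move=> /(wt_le k) /le_trans; apply; rewrite /wt.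
have := bin_le_exp t k; rewrite -lez_nat => /le_trans; apply.
by rewrite -natz natrX natz.
Qed.

Definition diff (a : int) (f : int -> int) (s : int) : int := f s - f (s - a).

Definition diffs (l : seq int) (f : int -> int) : int -> int := foldr diff f l.

(** How far the negative steps among [l] can raise the argument. *)
Definition negsum (l : seq int) : int := \sum_(a <- l) Num.max 0 (- a).

Lemma diffs_shift l f t :
  diffs l (fun s => f s - f (s - 1)) t = diffs l f t - diffs l f (t - 1).
Proof.
elim: l t => [|a l IH] t //=; rewrite /diff !IH.
have -> : t - a - 1 = t - 1 - a by ring.
by ring.
Qed.

Lemma eq_diffs l f g : f =1 g -> diffs l f =1 diffs l g.
Proof. by move=> fg; elim: l => [|a l IH] t //=; rewrite /diff !IH. Qed.

Lemma diffs_comp l f t : diffs l (fun s => f (s - 1)) t = diffs l f (t - 1).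
Proof.
elim: l t => [|a l IH] t //=; rewrite /diff !IH.
by have -> : t - a - 1 = t - 1 - a by ring.
Qed.

(** A mean value inequality: walk from s - a to s by unit steps, all at points below S. *)
Lemma steps_bound (g : int -> int) (S K : int) s a :
  (forall t, t <= S -> `|g t - g (t - 1)| <= K) -> s <= S -> s - a <= S ->
  `|g s - g (s - a)| <= `|a| * K.
Proof.
move=> H.
have pos (k : nat) t : t <= S -> `|g t - g (t - k%:Z)| <= k%:Z * K.
  move=> tS; elim: k => [|k IH]; first by rewrite subr0 subrr normr0 mul0r.
  have -> : g t - g (t - k.+1%:Z) = (g t - g (t - k%:Z)) + (g (t - k%:Z) - g (t - k%:Z - 1)).
    have -> : t - k.+1%:Z = t - k%:Z - 1 by lia.
    ring.
  apply: le_trans (ler_normD _ _) _.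
  have := H (t - k%:Z); have -> : t - k%:Z <= S by lia.
  move=> /(_ isT); lia.
move=> sS saS; have [a0|a0] := lerP 0 a.
  by have := pos `|a|%N s sS; rewrite gez0_abs // (ger0_norm a0).
have := pos `|a|%N (s - a) saS; have -> : (`|a|%N%:Z = - a) by lia.
have -> : s - a - - a = s by ring.
by rewrite distrC; have -> : (`|a| = - a) by lia.
Qed.

(** Each difference costs a factor [|a|] and lowers the degree of the weight by one;
    negative steps only enlarge the argument. *)
Lemma diffs_bound l k s : (size l <= k)%N ->
  `|diffs l (wt k) s| <= (\prod_(a <- l) `|a|) * wt (k - size l) (s + negsum l).
Proof.
elim: l k s => [|a l IH] k s /=.
  by move=> _; rewrite /negsum !big_nil subn0 addr0 mul1r ger0_norm ?wt_ge0.
case: k => // k lk; rewrite subSS {1}/diff /negsum !big_cons -/(negsum l) -mulrA.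
apply: (@steps_bound _ (s + Num.max 0 (- a))); [|lia|lia] => t tS.
rewrite -diffs_shift (eq_diffs _ (g := fun s => wt k (s - 1))); last by move=> u; apply: wt_diff.
rewrite diffs_comp; apply: le_trans (IH _ _ _) _ => //.
apply: ler_wpM2l; first by apply: prodr_ge0 => *; apply: normr_ge0.
by apply: wt_le; lia.
Qed.

Lemma diffs_bound_nneg l k s : (size l <= k)%N -> all (fun a => 0 <= a) l ->
  `|diffs l (wt k) s| <= (\prod_(a <- l) a) * wt (k - size l) s.
Proof.
move=> lk l0; have := diffs_bound s lk.
have -> : negsum l = 0.
  by rewrite /negsum big_seq big1 // => a /(allP l0); lia.
rewrite addr0 big_seq (eq_bigr (fun a => a)) -?big_seq // => a /(allP l0) a0.
by rewrite ger0_norm.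
Qed.

(** * Summation by parts against periodic sequences *)

Definition psum (th : nat -> int) (i : nat) : int := \sum_(j < i.+1) th j.

Definition balanced (P : nat) (th : nat -> int) : Prop :=
  [/\ (0 < P)%N, forall i, th (i + P)%N = th i & \sum_(i < P) th i = 0].

Lemma summation_by_parts (th f : nat -> int) D : f D = 0 ->
  \sum_(i < D) th i * f i = \sum_(i < D) psum th i * (f i - f i.+1).
Proof.
move=> fD.
suff H k : \sum_(i < k) psum th i * (f i - f i.+1) =
           \sum_(i < k) th i * f i - (if k is k'.+1 then psum th k' else 0) * f k.
  by rewrite H fD mulr0 subr0.
elim: k => [|k IH]; first by rewrite !big_ord0 mul0r subr0.
rewrite !big_ord_recr /= IH; case: k {IH} => [|k].
  by rewrite /psum big_ord_recr !big_ord0 /=; ring.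
have -> : psum th k.+1 = psum th k + th k.+1 by rewrite {1}/psum big_ord_recr.
by ring.
Qed.

Lemma psum_periodic P th : balanced P th -> forall i, psum th (i + P)%N = psum th i.
Proof.
case=> P0 thP th0; elim=> [|i IH].
  rewrite /psum add0n big_ord_recr /= th0 add0r big_ord_recr big_ord0 /= add0r.
  by rewrite -[P in LHS]add0n thP.
rewrite /psum big_ord_recr /= -/(psum th (i + P)) IH.
by rewrite [RHS]big_ord_recr /= -(thP i.+1) addSn.
Qed.

Lemma periodic_mod P (f : nat -> int) :
  (forall i, f (i + P)%N = f i) -> forall i, f i = f (i %% P)%N.
Proof.
move=> fP i; rewrite {1}(divn_eq i P) addnC; elim: (i %/ P)%N => [|k IH].
  by rewrite mul0n addn0.
by rewrite mulSn addnCA addnC fP.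
Qed.

Lemma periodic_bounded P (f : nat -> int) : (0 < P)%N ->
  (forall i, f (i + P)%N = f i) -> exists K : nat, forall i, `|f i| <= K%:Z.
Proof.
move=> P0 fP; exists (\sum_(j < P) `|f j|)%N => i.
rewrite (periodic_mod fP) -abszE lez_nat (bigD1 (Ordinal (ltn_pmod i P0))) //=.
exact: leq_addr.
Qed.

(** The scaled mean value of the partial sums: the Abel sum of the sequence, times [P]. *)
Definition abel (P : nat) (th : nat -> int) : int := \sum_(i < P) psum th i.

Definition diff2 (f : nat -> int) (i : nat) : int := f i - 2 * f i.+1 + f i.+2.

(** Subtracting their mean makes the partial sums balanced again, so that one can sum by
    parts a second time. *)
Lemma summation_by_parts2 P th : balanced P th ->
  exists2 X : nat -> int, exists K : nat, forall i, `|X i| <= K%:Z &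
  forall (f : nat -> int) D, f D = 0 -> f D.+1 = 0 ->
    P%:Z * \sum_(i < D) th i * f i = abel P th * f 0%N + \sum_(i < D) X i * diff2 f i.
Proof.
move=> bal; have [P0 thP th0] := bal.
pose Y i := P%:Z * psum th i - abel P th.
have balY : balanced P Y.
  split=> // [i|]; first by rewrite /Y psum_periodic.
  by rewrite big_split /= -mulr_sumr sumr_const card_ord -/(abel P th) -mulr_natl natz; ring.
exists (psum Y); first by apply: periodic_bounded P0 _; apply: psum_periodic.
move=> f D fD fD1.
have -> : \sum_(i < D) psum Y i * diff2 f i = \sum_(i < D) Y i * (f i - f i.+1).
  rewrite (@summation_by_parts Y (fun i => f i - f i.+1)) ?fD ?fD1 ?subrr //.
  by apply: eq_bigr => i _; rewrite /diff2; ring.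
rewrite summation_by_parts // mulr_sumr.
rewrite [X in _ = _ + X](eq_bigr (fun i : 'I_D => P%:Z * psum th i * (f i - f i.+1) - abel P th * (f i - f i.+1)));
  last by move=> i _; rewrite /Y; ring.
rewrite [X in _ = _ + X]sumrB -[X in _ = _ + (_ - X)]mulr_sumr.
have -> : \sum_(i < D) (f i - f i.+1) = f 0%N.
  have -> : f 0%N = f 0%N - f D by rewrite fD subr0.
  rewrite -(big_mkord xpredT (fun i => f i - f i.+1)) -opprB -(telescope_sumr _ (leq0n D)).
  by rewrite -sumrN; apply: eq_bigr => i _; rewrite opprB.
rewrite [in RHS]addrC -addrA [X in _ + X]addrC subrr addr0.
by apply: eq_bigr => i _; rewrite mulrA.
Qed.

(** * The hyperbola sum *)

Lemma sum_norm_le (D : nat) (F : 'I_D -> int) (X : nat -> int) (K b : int) :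
  (forall i, `|X i| <= K) -> (forall i, `|F i| <= b) -> 0 <= b ->
  `|\sum_(i < D) X i * F i| <= D%:Z * (K * b).
Proof.
move=> HX HF b0; apply: le_trans (ler_norm_sum _ _ _) _.
have -> : D%:Z * (K * b) = \sum_(i < D) K * b by rewrite sumr_const card_ord -mulr_natl natz.
apply: ler_sum => i _; rewrite normrM; apply: ler_pM => //; exact: normr_ge0.
Qed.

(** The shifts by m, d and 1 commute; this lemma and the tactic after it sort them,
    so that equal values of a function at shifted points become syntactically equal. *)
Lemma swap_sub (a b x : int) : x - a - b = x - b - a. Proof. by ring. Qed.

Ltac sort_steps d m :=
  rewrite ?(swap_sub 1 d) ?(swap_sub 1 m) ?(swap_sub m d).

(** In terms of the shifts A (by m) and B (by d), with x the unit shift and u = 1 - x, the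
    left-hand side is the value of
    (1-B)^2 - 2 A (1 - x B)^2 + A^2 (1 - x^2 B)^2, rearranged so that every term
    contains enough differences. *)
Lemma hyperbola_diff (g : int -> int) (N d m : int) (s := N - d * m) :
  let G (i j : int) := g (N - (d + i) * (m + j)) in
  (G 0 0 - 2 * G 0 1 + G 0 2) - 2 * (G 1 0 - 2 * G 1 1 + G 1 2) + (G 2 0 - 2 * G 2 1 + G 2 2)
  = diffs [:: d; d; m; m] g s
    - 4 * diffs [:: d; 1; m] g (s - d - m)
    - 2 * diffs [:: d; 1; 1] g (s - d - m - m)
    - 2 * diffs [:: 1; 1] g (s - d - d - m)
    + diffs [:: 1; 1] g (s - d - d - m - m)
    + 2 * diffs [:: 1; 1] g (s - d - d - m - m - 1)
    + diffs [:: 1; 1] g (s - d - d - m - m - 1 - 1).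
Proof.
rewrite /diffs /= /diff.
have -> : N - (d + 0) * (m + 0) = s by rewrite /s; ring.
have -> : N - (d + 0) * (m + 1) = s - d by rewrite /s; ring.
have -> : N - (d + 0) * (m + 2) = s - d - d by rewrite /s; ring.
have -> : N - (d + 1) * (m + 0) = s - m by rewrite /s; ring.
have -> : N - (d + 1) * (m + 1) = s - d - m - 1 by rewrite /s; ring.
have -> : N - (d + 1) * (m + 2) = s - d - d - m - 1 - 1 by rewrite /s; ring.
have -> : N - (d + 2) * (m + 0) = s - m - m by rewrite /s; ring.
have -> : N - (d + 2) * (m + 1) = s - d - m - m - 1 - 1 by rewrite /s; ring.
have -> : N - (d + 2) * (m + 2) = s - d - d - m - m - 1 - 1 - 1 - 1 by rewrite /s; ring.
do 10! [sort_steps d m].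
ring.
Qed.

(** All arguments are at most N - d m, so everything vanishes for d m > N. Otherwise the steps
    d and m of the differences are paid for by d m <= N: a term with step product at most N^j
    contains the weight of degree 3 - j in arguments below N. *)
Lemma hyperbola_diff_bound (N d m : nat) : (0 < d)%N -> (0 < m)%N ->
  let G (i j : int) := wt 5 (N%:Z - (d%:Z + i) * (m%:Z + j)) in
  `|(G 0 0 - 2 * G 0 1 + G 0 2) - 2 * (G 1 0 - 2 * G 1 1 + G 1 2)
    + (G 2 0 - 2 * G 2 1 + G 2 2)| <= if (d * m <= N)%N then 16 * N%:Z ^+ 3 else 0.
Proof.
move=> d0 m0 /=; rewrite hyperbola_diff.
set s := N%:Z - _.
pose K := if (d * m <= N)%N then N%:Z ^+ 3 else 0.
have bnd l t : (size l <= 4)%N -> all (fun a => 0 <= a) l ->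
    (\prod_(a <- l) a) * wt (5 - size l) s <= K -> t <= s -> `|diffs l (wt 5) t| <= K.
  move=> l4 l0 lK ts; apply: le_trans lK.
  apply: le_trans (diffs_bound_nneg _ _ l0) _; first exact: leqW.
  apply: ler_wpM2l; last exact: wt_le.
  by rewrite big_seq; apply: prodr_ge0 => a /(allP l0).
have [K4 K3 K3' K2] : [/\ d%:Z * (d%:Z * (m%:Z * m%:Z)) * wt 1 s <= K,
    d%:Z * m%:Z * wt 2 s <= K, d%:Z * wt 2 s <= K & wt 3 s <= K].
  rewrite /K; case: ifP => [dmN|/negbT]; last first.
    rewrite -ltnNge => Ndm; have s0 : s <= 0 by rewrite /s -PoszM; lia.
    by rewrite !(wt_le0 _ s0) !mulr0.
  have sN : s <= N%:Z by rewrite /s -PoszM; lia.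
  have dm : d%:Z * m%:Z <= N%:Z by rewrite -PoszM.
  have dN : d%:Z <= N%:Z by apply: le_trans dm; rewrite ler_peMr; lia.
  have dm0 : 0 <= d%:Z * m%:Z by rewrite -PoszM.
  have W1 := wt_le_exp 1 sN; have W2 := wt_le_exp 2 sN; have W3 := wt_le_exp 3 sN.
  have N3 : N%:Z ^+ 3 = N%:Z * N%:Z ^+ 2 by ring.
  split=> //; try by rewrite N3 !ler_pM ?wt_ge0.
  have -> : d%:Z * (d%:Z * (m%:Z * m%:Z)) = (d%:Z * m%:Z) * (d%:Z * m%:Z) by ring.
  have -> : N%:Z ^+ 3 = N%:Z * N%:Z * N%:Z by ring.
  by rewrite !ler_pM ?mulr_ge0 ?wt_ge0.
have N4 := bnd [:: d%:Z; d%:Z; m%:Z; m%:Z] s isT isT _ (lexx s).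
have N3 := bnd [:: d%:Z; 1; m%:Z] (s - d%:Z - m%:Z) isT isT _ ltac:(lia).
have N3' := bnd [:: d%:Z; 1; 1] (s - d%:Z - m%:Z - m%:Z) isT isT _ ltac:(lia).
have N2 t := bnd [:: 1; 1] t isT isT.
move: N4 N3 N3' N2; rewrite !big_cons !big_nil !mulr1 !mul1r.
move=> /(_ K4) N4 /(_ K3) N3 /(_ K3') N3' N2.
have N2a := N2 (s - d%:Z - d%:Z - m%:Z) K2 ltac:(lia).
have N2b := N2 (s - d%:Z - d%:Z - m%:Z - m%:Z) K2 ltac:(lia).
have N2c := N2 (s - d%:Z - d%:Z - m%:Z - m%:Z - 1) K2 ltac:(lia).
have N2d := N2 (s - d%:Z - d%:Z - m%:Z - m%:Z - 1 - 1) K2 ltac:(lia).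
have -> : (if (d * m <= N)%N then 16 * N%:Z ^+ 3 else 0) = 16 * K.
  by rewrite /K; case: ifP => // _; rewrite mulr0.
move: N4 N3 N3' N2a N2b N2c N2d; clear; clearbody K.
do !move: (diffs _ _ _) => ?; lia.
Qed.

Lemma sum_ind_lt (N M : nat) : \sum_(i < N) (i < M)%:R <= M%:Z.
Proof.
suff : \sum_(i < N) ((i < M)%:R : int) = (minn N M)%:Z by move=> ->; lia.
elim: N => [|N IH]; first by rewrite big_ord0 min0n.
rewrite big_ord_recr /= IH; case: ltnP => h; rewrite ?addr0; lia.
Qed.

(** Of two factors with product at most M^2 one is at most M. *)
Lemma count_hyperbola (M : nat) :
  \sum_(i < M ^ 2) \sum_(j < M ^ 2) (i.+1 * j.+1 <= M ^ 2)%N%:R <= 2 * M%:Z ^+ 3.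
Proof.
have le2 (i j : 'I_(M ^ 2)) : ((i.+1 * j.+1 <= M ^ 2)%N%:R : int) <= (i < M)%:R + (j < M)%:R.
  case: (ltnP i M) => iM; first by case: (_ <= _)%N; case: (_ < _)%N.
  case: (ltnP j M) => jM; first by case: (_ <= _)%N.
  by have -> : (i.+1 * j.+1 <= M ^ 2)%N = false by nia.
apply: le_trans (_ : \sum_(i < M ^ 2) \sum_(j < M ^ 2) ((i < M)%:R + (j < M)%:R) <= _).
  by apply: ler_sum => i _; apply: ler_sum => j _.
have E : \sum_(i < M ^ 2) \sum_(j < M ^ 2) ((i < M)%:R + (j < M)%:R) =
    2 * (M ^ 2)%N%:R * \sum_(i < M ^ 2) ((i < M)%:R : int).
  under eq_bigr => i _ do rewrite big_split /= sumr_const card_ord -[_ *+ (M ^ 2)]mulr_natl.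
  by rewrite big_split /= -mulr_sumr sumr_const card_ord -[_ *+ (M ^ 2)]mulr_natl; ring.
rewrite E.
have := sum_ind_lt (M ^ 2) M; set S := \sum_(i < _) _ => SM.
have -> : 2 * M%:Z ^+ 3 = 2 * (M ^ 2)%N%:R * M%:Z by rewrite natrX natz; ring.
by rewrite ler_wpM2l ?mulr_ge0 ?ler0n.
Qed.

Lemma diff2_wt_bound (N i : nat) :
  `|diff2 (fun i => wt 5 (N%:Z - i.+1%:Z)) i| <= N%:Z ^+ 3.
Proof.
have -> : diff2 (fun i => wt 5 (N%:Z - i.+1%:Z)) i = diffs [:: 1; 1] (wt 5) (N%:Z - i.+1%:Z).
  rewrite /diff2 /= /diff.
  have -> : N%:Z - i.+2%:Z = N%:Z - i.+1%:Z - 1 by lia.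
  have -> : N%:Z - i.+3%:Z = N%:Z - i.+1%:Z - 1 - 1 by lia.
  by ring.
apply: le_trans (diffs_bound_nneg _ _ _) _ => //.
by rewrite !big_cons big_nil !mul1r; apply: wt_le_exp; lia.
Qed.

(** Two summations by parts in each variable leave the product of the Abel sums as the main
    term. In the remainder at most 2 M^3 terms do not vanish and each is of size M^6, which
    gives M^9; the main term has size M^10. *)
Lemma hyperbola_sum (P R : nat) (th et : nat -> int) :
  balanced P th -> balanced R et ->
  exists C : nat, forall M : nat, (0 < M)%N ->
  `|P%:Z * R%:Z * (\sum_(i < M ^ 2) \sum_(j < M ^ 2)
       th i * et j * wt 5 ((M ^ 2)%N%:Z - i.+1%:Z * j.+1%:Z))
    - abel P th * abel R et * wt 5 ((M ^ 2)%N%:Z - 1)| <= C%:Z * M%:Z ^+ 9.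
Proof.
move=> /summation_by_parts2 [X [K HX] sumX] /summation_by_parts2 [Y [L HY] sumY].
exists (`|abel R et| * K + `|abel P th| * L + K * L * 32)%N => M M0.
set N := (M ^ 2)%N.
pose f (i j : nat) := wt 5 (N%:Z - i.+1%:Z * j.+1%:Z).
have f0l i j : (N <= i)%N -> f i j = 0 by move=> Ni; apply: wt_le0; nia.
have f0r i j : (N <= j)%N -> f i j = 0 by move=> Ni; apply: wt_le0; nia.
pose DD (i j : nat) := diff2 (fun i => diff2 (f i) j) i.
have EX : P%:Z * R%:Z * (\sum_(i < N) \sum_(j < N) th i * et j * f i j) -
  abel P th * abel R et * f 0%N 0%N =
    abel R et * \sum_(i < N) X i * diff2 (f^~ 0%N) i
    + abel P th * \sum_(j < N) Y j * diff2 (f 0%N) j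
    + \sum_(i < N) X i * (\sum_(j < N) Y j * DD i j).
  have -> : P%:Z * R%:Z * (\sum_(i < N) \sum_(j < N) th i * et j * f i j) =
    P%:Z * \sum_(i < N) th i * (abel R et * f i 0%N + \sum_(j < N) Y j * diff2 (f i) j).
    rewrite -mulrA mulr_sumr; congr (_ * _); apply: eq_bigr => i _.
    rewrite -sumY ?f0r // mulrCA; congr (_ * _); rewrite mulr_sumr.
    by apply: eq_bigr => j _; rewrite mulrA.
  rewrite (sumX (fun i => abel R et * f i 0%N + \sum_(j < N) Y j * diff2 (f i) j)); first last.
  - rewrite f0l // mulr0 add0r big1 // => j _.
    by have -> : diff2 (f N.+1) j = 0; [rewrite /diff2 !f0l ?leqnn //; lia | rewrite mulr0].
  - rewrite f0l // mulr0 add0r big1 // => j _.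
    by have -> : diff2 (f N) j = 0; [rewrite /diff2 !f0l ?leqnn //; lia | rewrite mulr0].
  have -> : \sum_(i < N) X i * diff2 (fun i => abel R et * f i 0%N + \sum_(j < N) Y j * diff2 (f i) j) i
     = abel R et * \sum_(i < N) X i * diff2 (f^~ 0%N) i + \sum_(i < N) X i * (\sum_(j < N) Y j * DD i j).
    rewrite mulr_sumr -big_split /=; apply: eq_bigr => i _.
    have -> : \sum_(j < N) Y j * DD i j = \sum_(j < N) Y j * diff2 (f i) j -
        2 * (\sum_(j < N) Y j * diff2 (f i.+1) j) + \sum_(j < N) Y j * diff2 (f i.+2) j.
      rewrite mulr_sumr -sumrB -big_split /=; apply: eq_bigr => j _.
      by rewrite /DD {1}/diff2; ring.
    by rewrite [diff2 (f^~ 0%N) i]/diff2 [diff2 (fun i => _ + _) i]/diff2; ring.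
  by ring.
have -> : wt 5 (N%:Z - 1) = f 0%N 0%N by rewrite /f mulr1.
have N3 : (N%:Z ^+ 3 = M%:Z ^+ 6) by rewrite /N -[(M^2)%N%:Z]natz natrX natz; ring.
have NM : N%:Z = M%:Z ^+ 2 by rewrite /N -[(M^2)%N%:Z]natz natrX natz.
have M1 : 1 <= M%:Z by lia.
have M89 : M%:Z ^+ 8 <= M%:Z ^+ 9 by rewrite exprS ler_peMl // exprn_ge0.
rewrite EX; apply: le_trans (ler_normD _ _) _.
apply: le_trans (lerD (ler_normD _ _) (lexx _)) _.
rewrite !normrM !PoszD !PoszM !mulrDl.
have bX : `|\sum_(i < N) X i * diff2 (f^~ 0%N) i| <= K%:Z * M%:Z ^+ 9.
  apply: le_trans (sum_norm_le (b := N%:Z ^+ 3) HX _ _) _ => //; last first.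
    rewrite N3 NM; have -> : M%:Z ^+ 2 * (K%:Z * M%:Z ^+ 6) = K%:Z * M%:Z ^+ 8 by ring.
    by rewrite ler_wpM2l.
  move=> i; have := diff2_wt_bound N i; congr (`| _ | <= _).
  by rewrite /diff2 /f !mulr1.
have bY : `|\sum_(i < N) Y i * diff2 (f 0%N) i| <= L%:Z * M%:Z ^+ 9.
  apply: le_trans (sum_norm_le (b := N%:Z ^+ 3) HY _ _) _ => //; last first.
    rewrite N3 NM; have -> : M%:Z ^+ 2 * (L%:Z * M%:Z ^+ 6) = L%:Z * M%:Z ^+ 8 by ring.
    by rewrite ler_wpM2l.
  move=> i; have := diff2_wt_bound N i; congr (`| _ | <= _).
  by rewrite /diff2 /f !mul1r.
have bXY : `|\sum_(i < N) X i * (\sum_(j < N) Y j * DD i j)| <= K%:Z * L%:Z * 32 * M%:Z ^+ 9.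
  have term (i j : 'I_N) : `|X i * (Y j * DD i j)| <=
      (K%:Z * L%:Z * (16 * N%:Z ^+ 3)) * (i.+1 * j.+1 <= N)%N%:R.
    have hD : `|DD i j| <= 16 * N%:Z ^+ 3 * (i.+1 * j.+1 <= N)%N%:R.
      have := @hyperbola_diff_bound N i.+1 j.+1 isT isT.
      have -> : (if (i.+1 * j.+1 <= N)%N then 16 * N%:Z ^+ 3 else 0) =
        16 * N%:Z ^+ 3 * (i.+1 * j.+1 <= N)%N%:R by case: ifP; rewrite ?mulr1 ?mulr0.
      congr (`| _ | <= _); rewrite /= !addr0 /DD /diff2 /f.
      have e k : k.+2%:Z = k.+1%:Z + 1 /\ k.+3%:Z = k.+1%:Z + 2 by lia.
      by rewrite (e i).1 (e i).2 (e j).1 (e j).2; ring.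
    rewrite !normrM.
    apply: le_trans (ler_pM _ _ (HX i) (ler_pM _ _ (HY j) hD)) _;
      rewrite ?normr_ge0 ?mulr_ge0 ?normr_ge0 //.
    by rewrite !mulrA.
  apply: le_trans (ler_norm_sum _ _ _) _.
  apply: le_trans (_ : \sum_(i < N) \sum_(j < N)
     (K%:Z * L%:Z * (16 * N%:Z ^+ 3)) * (i.+1 * j.+1 <= N)%N%:R <= _).
    apply: ler_sum => i _; rewrite mulr_sumr; apply: le_trans (ler_norm_sum _ _ _) _.
    by apply: ler_sum => j _.
  under eq_bigr => i _ do rewrite -mulr_sumr.
  rewrite -mulr_sumr; apply: le_trans (ler_wpM2l _ (count_hyperbola M)) _.
    by rewrite !mulr_ge0.
  by rewrite N3 le_eqVlt; apply/orP; left; apply/eqP; ring.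
apply: lerD; [apply: lerD|].
- by rewrite -abszE -mulrA ler_wpM2l.
- by rewrite -abszE -mulrA ler_wpM2l.
- exact: bXY.
Qed.

(** * Lattice sums of positive definite forms *)

Definition qform (a b c u v : int) : int := a * u ^+ 2 + b * u * v + c * v ^+ 2.

(** Summation by parts against the signs: the gain is one difference of g. *)
Lemma alternating_step (g : nat -> int) D : g 0%N = 0 -> g D = 0 ->
  2 * \sum_(i < D) (-1) ^+ i * g i = \sum_(i < D) (-1) ^+ i * (g i - g i.+1).
Proof.
move=> g0 gD.
suff H k : \sum_(i < k) (-1) ^+ i * (g i - g i.+1) =
    2 * (\sum_(i < k) (-1) ^+ i * g i) + (-1) ^+ k * g k - g 0%N.
  by rewrite H g0 gD mulr0 subr0 addr0.
elim: k => [|k IH]; first by rewrite !big_ord0 /=; ring.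
by rewrite !big_ord_recr /= IH exprS; ring.
Qed.

Lemma alternating_sum3 (f : nat -> int) D :
  (forall i, (i < 3)%N -> f i = 0) -> (forall i, (i < 3)%N -> f (D + i)%N = 0) ->
  8 * \sum_(i < D) (-1) ^+ i * f i =
  \sum_(i < D) (-1) ^+ i * (f i - 3 * f i.+1 + 3 * f i.+2 - f i.+3).
Proof.
move=> f0 fD.
have fD0 := fD 0%N isT; have fD1 := fD 1%N isT; have fD2 := fD 2%N isT.
move: fD0 fD1 fD2; rewrite addn0 addn1 addn2 => fD0 fD1 fD2.
have E8 (x : int) : 8 * x = 2 * (2 * (2 * x)) by ring.
rewrite E8 (alternating_step (g := f)) ?fD0 ?f0 //.
rewrite (alternating_step (g := fun i => f i - f i.+1)) ?fD0 ?fD1 ?f0 //.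
rewrite (alternating_step (g := fun i => f i - f i.+1 - (f i.+1 - f i.+2))) ?fD0 ?fD1 ?fD2 ?f0 //.
by apply: eq_bigr => i _; congr (_ * _); ring.
Qed.

(** With A the shift by al and B the shift by be this is the identity
    1 - 3A + 3A^2 B - A^3 B^3 = (1-A)^3 - 3A^2 (1-A)(1-B) - A^3 (1-B)^2 (2+B). *)
Lemma third_diff (g : int -> int) (s al be : int) :
  g s - 3 * g (s - al) + 3 * g (s - (2 * al + be)) - g (s - (3 * al + 3 * be)) =
  diffs [:: al; al; al] g s - 3 * diffs [:: al; be] g (s - al - al)
  - 2 * diffs [:: be; be] g (s - al - al - al) - diffs [:: be; be] g (s - al - al - al - be).
Proof.
have -> : s - (2 * al + be) = s - al - al - be by ring.
have -> : s - (3 * al + 3 * be) = s - al - al - al - be - be - be by ring.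
by rewrite /diffs /= /diff; do 6! rewrite ?(swap_sub be al); ring.
Qed.

Section PositiveForm.

Variables (a c : nat) (b : int).
Hypotheses (a_gt0 : (0 < a)%N) (c_gt0 : (0 < c)%N) (posdef : b ^+ 2 < 4 * a%:Z * c%:Z).
Local Notation Q := (qform a%:Z b c%:Z).

(** Complete the square: 4 c Q = (2 c v + b u)^2 + (4 a c - b^2) u^2. *)
Lemma qform_lower u v : u ^+ 2 <= 4 * c%:Z * Q u v.
Proof.
have : 0 <= (2 * c%:Z * v + b * u) ^+ 2 by apply: sqr_ge0.
have : 0 <= (4 * a%:Z * c%:Z - b ^+ 2 - 1) * u ^+ 2 by rewrite mulr_ge0 ?sqr_ge0 //; lia.
rewrite /qform; nia.
Qed.

Lemma qform_ge0 u v : 0 <= Q u v.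
Proof. by have := qform_lower u v; have := sqr_ge0 u; nia. Qed.

Lemma qform_large (M : nat) (u v : int) : 2 * c%:Z * M%:Z <= `|u| -> M%:Z ^+ 2 <= Q u v.
Proof.
move=> cu; have := qform_lower u v.
have : (2 * c%:Z * M%:Z) ^+ 2 <= u ^+ 2 by rewrite -[u ^+ 2]real_normK ?num_real // lerXn2r ?nnegrE ?mulr_ge0.
by rewrite !exprMn; nia.
Qed.

(* The box of half-side 2 kappa M contains the ellipse Q < M^2 with room for three steps
   of u. The form grows by [al u v] from u to u + 1, which is at most [A M] in the box,
   so that near the box the weight has arguments up to [E M^2]. *)
Let kappa := (a + c + 1)%N.
Let al (u v : int) : int := a%:Z * (2 * u + 1) + b * v.
Let A : int := a%:Z * (4 * kappa%:Z + 1) + `|b| * (2 * kappa%:Z).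
Let E : nat := absz (1 + 3 * A).

Lemma A_ge0 : 0 <= A.
Proof. by rewrite /A addr_ge0 ?mulr_ge0. Qed.

Lemma step_bound (M : nat) (u v : int) : (0 < M)%N ->
  `|u| <= 2 * kappa%:Z * M%:Z -> `|v| <= 2 * kappa%:Z * M%:Z -> `|al u v| <= A * M%:Z.
Proof.
move=> M0 uM vM; rewrite /al; apply: le_trans (ler_normD _ _) _; rewrite !normrM.
have -> : `|a%:Z| = a%:Z by lia.
rewrite /A [_ * M%:Z]mulrDl lerD // -mulrA; last by rewrite ler_wpM2l.
rewrite ler_wpM2l //; apply: le_trans (ler_normD _ _) _.
by rewrite normrM [_ * M%:Z]mulrDl; lia.
Qed.

(** Three steps of u change Q by amounts of size M and have second differences 2 a, and the
    weight has degree 5 in arguments of size M^2: each of the four terms of [third_diff] has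
    size at most M^7. *)
Lemma third_diff_bound (M : nat) (u v : int) : (0 < M)%N ->
  `|u| <= 2 * kappa%:Z * M%:Z -> `|v| <= 2 * kappa%:Z * M%:Z ->
  let F u := wt 5 (M%:Z ^+ 2 - Q u v) in
  `|F u - 3 * F (u + 1) + 3 * F (u + 2) - F (u + 3)| <=
   (A ^+ 3 * E%:Z ^+ 2 + 6 * A * a%:Z * E%:Z ^+ 3 + 12 * a%:Z ^+ 2 * E%:Z ^+ 3) * M%:Z ^+ 7.
Proof.
move=> M0 uM vM /=; have alM := step_bound M0 uM vM.
set s := M%:Z ^+ 2 - Q u v.
have -> : M%:Z ^+ 2 - Q (u + 1) v = s - al u v by rewrite /s /al /qform; ring.
have -> : M%:Z ^+ 2 - Q (u + 2) v = s - (2 * al u v + 2 * a%:Z) by rewrite /s /al /qform; ring.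
have -> : M%:Z ^+ 2 - Q (u + 3) v = s - (3 * al u v + 3 * (2 * a%:Z)) by rewrite /s /al /qform; ring.
rewrite third_diff; set x := al u v in alM *.
have A0 := A_ge0.
have EA : E%:Z = 1 + 3 * A by rewrite /E; lia.
have sM : s <= M%:Z ^+ 2 by rewrite /s; have := qform_ge0 u v; lia.
have M1 : 1 <= M%:Z by lia.
pose T := (E * M ^ 2)%N.
have TE : T%:Z = E%:Z * M%:Z ^+ 2 by rewrite /T PoszM -[(M^2)%N%:Z]natz natrX natz.
have big t : t <= M%:Z ^+ 2 + 3 * (A * M%:Z) -> t <= T%:Z.
  move/le_trans; apply; rewrite TE EA [(1 + _) * _]mulrDl mul1r -mulrA lerD2l ler_wpM2l //.
  by rewrite ler_wpM2l // expr2 ler_peMl.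
have term l t : (0 < size l)%N -> (size l <= 3)%N -> t + negsum l <= M%:Z ^+ 2 + 3 * (A * M%:Z) ->
  `|diffs l (wt 5) t| <= (\prod_(y <- l) `|y|) * T%:Z ^+ (5 - size l).
  move=> _ l3 tb; apply: le_trans (diffs_bound _ _) _; first by lia.
  rewrite ler_wpM2l ?wt_le_exp ?big //.
  by apply: prodr_ge0 => *; apply: normr_ge0.
have a2 : `|2 * a%:Z| = 2 * a%:Z by rewrite ger0_norm // mulr_ge0.
have am : Num.max 0 (- (2 * a%:Z)) = 0 by clear; lia.
have xm : Num.max 0 (- x) <= A * M%:Z by move: alM; clear; lia.
have ax : - x <= A * M%:Z by move: alM; clear; lia.
have ap : 0 <= 2 * a%:Z by clear; lia.
have AM0 : 0 <= A * M%:Z by rewrite mulr_ge0.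
have [c1 c2 c3 c4] : [/\ s + negsum [:: x; x; x] <= M%:Z ^+ 2 + 3 * (A * M%:Z),
    s - x - x + negsum [:: x; 2 * a%:Z] <= M%:Z ^+ 2 + 3 * (A * M%:Z),
    s - x - x - x + negsum [:: 2 * a%:Z; 2 * a%:Z] <= M%:Z ^+ 2 + 3 * (A * M%:Z)
  & s - x - x - x - 2 * a%:Z + negsum [:: 2 * a%:Z; 2 * a%:Z] <= M%:Z ^+ 2 + 3 * (A * M%:Z)].
  rewrite /negsum !big_cons !big_nil am; move: xm ax ap AM0 sM; clearbody x s; clear.
  move: (Num.max 0 (- x)) (A * M%:Z) (M%:Z ^+ 2) (2 * a%:Z) => *; split; lia.
have t1 := term [:: x; x; x] s isT isT.
have t2 := term [:: x; 2 * a%:Z] (s - x - x) isT isT.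
have t3 := term [:: 2 * a%:Z; 2 * a%:Z] (s - x - x - x) isT isT.
have t4 := term [:: 2 * a%:Z; 2 * a%:Z] (s - x - x - x - 2 * a%:Z) isT isT.
move: (t1 c1) (t2 c2) (t3 c3) (t4 c4); rewrite !big_cons !big_nil ![size _]/= a2.
rewrite (_ : (5 - 3)%N = 2%N) // (_ : (5 - 2)%N = 3%N) //.
move=> {}t1 {}t2 {}t3 {}t4.
have x3 : `|x| * (`|x| * (`|x| * 1)) <= (A * M%:Z) * ((A * M%:Z) * (A * M%:Z)).
  by rewrite mulr1 !ler_pM ?mulr_ge0.
have {}t1 : `|diffs [:: x; x; x] (wt 5) s| <= A ^+ 3 * E%:Z ^+ 2 * M%:Z ^+ 7.
  apply: le_trans t1 _; apply: le_trans (ler_wpM2r _ x3) _; first by rewrite exprn_ge0.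
  by rewrite TE le_eqVlt; apply/orP; left; apply/eqP; ring.
have {}t2 : `|diffs [:: x; 2 * a%:Z] (wt 5) (s - x - x)| <= 2 * A * a%:Z * E%:Z ^+ 3 * M%:Z ^+ 7.
  apply: le_trans t2 _; rewrite mulr1.
  have := ler_wpM2r (_ : 0 <= 2 * a%:Z * T%:Z ^+ 3) alM.
  rewrite mulr_ge0 ?exprn_ge0 // mulrA => /(_ isT) /le_trans; apply.
  by rewrite TE le_eqVlt; apply/orP; left; apply/eqP; ring.
have M67 : 2 * a%:Z * (2 * a%:Z * 1) * T%:Z ^+ 3 <= 4 * a%:Z ^+ 2 * E%:Z ^+ 3 * M%:Z ^+ 7.
  have -> : 2 * a%:Z * (2 * a%:Z * 1) * T%:Z ^+ 3 = 4 * a%:Z ^+ 2 * E%:Z ^+ 3 * M%:Z ^+ 6.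
    by rewrite TE; ring.
  by rewrite ler_wpM2l ?mulr_ge0 ?exprn_ge0 // [M%:Z ^+ 7]exprS ler_peMl // exprn_ge0.
have {}t3 := le_trans t3 M67; have {}t4 := le_trans t4 M67.
have -> : (A ^+ 3 * E%:Z ^+ 2 + 6 * A * a%:Z * E%:Z ^+ 3 + 12 * a%:Z ^+ 2 * E%:Z ^+ 3) * M%:Z ^+ 7 =
    A ^+ 3 * E%:Z ^+ 2 * M%:Z ^+ 7 + 3 * (2 * A * a%:Z * E%:Z ^+ 3 * M%:Z ^+ 7)
    + 3 * (4 * a%:Z ^+ 2 * E%:Z ^+ 3 * M%:Z ^+ 7) by ring.
move: t1 t2 t3 t4; clear; do 3! move: (_ * _ ^+ 7) => ?; do !move: (diffs _ _ _) => ?; lia.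
Qed.

(** Three summations by parts in u; then the box contributes of the order of M^2 terms of
    size M^7. The signs [sg] in the other variable are arbitrary. *)
Lemma alternating_lattice : exists C : nat, forall M : nat, (0 < M)%N ->
  let L := (2 * kappa * M)%N in
  forall sg : nat -> int, (forall j, `|sg j| <= 1) ->
  `|\sum_(j < 2 * L) sg j * \sum_(i < 2 * L) (-1) ^+ i *
      wt 5 (M%:Z ^+ 2 - Q (i%:Z - L%:Z) (j%:Z - L%:Z))| <= C%:Z * M%:Z ^+ 9.
Proof.
pose C7 := A ^+ 3 * E%:Z ^+ 2 + 6 * A * a%:Z * E%:Z ^+ 3 + 12 * a%:Z ^+ 2 * E%:Z ^+ 3.
exists (absz (16 * kappa%:Z ^+ 2 * C7)) => M M0 L sg sg1.
have A0 := A_ge0.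
have C70 : 0 <= C7 by rewrite /C7 !addr_ge0 ?mulr_ge0 ?exprn_ge0.
have LM : (2 * c * M + 2 <= L)%N.
  by rewrite /L /kappa; move: (M) M0 a_gt0; clear => m m0 a0; nia.
have Lk : L%:Z = 2 * kappa%:Z * M%:Z by rewrite /L !PoszM.
have inner (j : 'I_(2 * L)) : `|\sum_(i < 2 * L) (-1) ^+ i *
      wt 5 (M%:Z ^+ 2 - Q (i%:Z - L%:Z) (j%:Z - L%:Z))| <= (2 * L)%N%:Z * (1 * (C7 * M%:Z ^+ 7)).
  pose f (i : nat) := wt 5 (M%:Z ^+ 2 - Q (i%:Z - L%:Z) (j%:Z - L%:Z)).
  have vanish (i : nat) : (i < 3)%N || (2 * L <= i)%N -> f i = 0.
    move=> Hi; apply: wt_le0; rewrite subr_le0; apply: qform_large.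
    by move: (nat_of_ord j) LM Hi; clearbody L; clear; lia.
  apply: le_trans (_ : 8 * `|\sum_(i < 2 * L) (-1) ^+ i * f i| <= _).
    by rewrite ler_peMl.
  have -> : 8 * `|\sum_(i < 2 * L) (-1) ^+ i * f i| = `|8 * \sum_(i < 2 * L) (-1) ^+ i * f i|.
    by rewrite normrM.
  rewrite alternating_sum3 => [|i i3|i i3]; [|by rewrite vanish // i3|by rewrite vanish // leq_addr orbT].
  apply: (@sum_norm_le _ (fun i : 'I_(2 * L) => f i - 3 * f i.+1 + 3 * f i.+2 - f i.+3) (fun i => (-1) ^+ i)).
  - by move=> i; rewrite normrX normrN1 expr1n.
  - move=> i; have := @third_diff_bound M (i%:Z - L%:Z) (j%:Z - L%:Z) M0 _ _.
    rewrite -Lk; have [iL jL] := (ltn_ord i, ltn_ord j).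
    have [h1 h2] : `|i%:Z - L%:Z| <= L%:Z /\ `|j%:Z - L%:Z| <= L%:Z.
      by move: (nat_of_ord i) (nat_of_ord j) iL jL; clearbody L; clear => *; lia.
    move=> /(_ h1 h2).
    have e k : (i + k)%N%:Z - L%:Z = i%:Z - L%:Z + k%:Z by rewrite PoszD addrAC.
    by rewrite -!e addn1 addn2 addn3.
  - by rewrite mulr_ge0 ?exprn_ge0.
apply: le_trans (@sum_norm_le _ (fun j : 'I_(2 * L) => \sum_(i < 2 * L) (-1) ^+ i *
      wt 5 (M%:Z ^+ 2 - Q (i%:Z - L%:Z) (j%:Z - L%:Z))) sg _ _ sg1 inner _) _.
  by rewrite !mulr_ge0 ?exprn_ge0.
rewrite gez0_abs ?mulr_ge0 ?exprn_ge0 // PoszM Lk le_eqVlt; apply/orP; left; apply/eqP.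
ring.
Qed.

End PositiveForm.

Definition box (K : nat) (f : int -> int -> int) : int :=
  \sum_(i < 2 * K) \sum_(j < 2 * K) f (i%:Z - K%:Z) (j%:Z - K%:Z).

Lemma sum_even (n : nat) (g : nat -> int) :
  \sum_(i < 2 * n) (1 + (-1) ^+ i) * g i = 2 * \sum_(i < n) g (2 * i)%N.
Proof.
elim: n => [|n IH]; first by rewrite muln0 !big_ord0.
rewrite (_ : 2 * n.+1 = (2 * n).+2)%N; last by lia.
rewrite !big_ord_recr /= IH exprS exprM sqrrN !expr1n.
ring.
Qed.

Lemma box_even K f :
  4 * box K (fun u v => f (2 * u) (2 * v)) =
  \sum_(i < 2 * (2 * K)) \sum_(j < 2 * (2 * K))
    (1 + (-1) ^+ i) * (1 + (-1) ^+ j) * f (i%:Z - (2 * K)%N%:Z) (j%:Z - (2 * K)%N%:Z).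
Proof.
under [RHS]eq_bigr => i _.
  under eq_bigr => j _ do rewrite -mulrA.
  rewrite -mulr_sumr (sum_even _ (fun j => f (i%:Z - (2 * K)%N%:Z) (j%:Z - (2 * K)%N%:Z))).
  over.
rewrite (sum_even _ (fun i => 2 * \sum_(j < 2 * K) f (i%:Z - (2 * K)%N%:Z) ((2 * j)%N%:Z - (2 * K)%N%:Z))).
rewrite -mulr_sumr mulrA; congr (_ * _).
apply: eq_bigr => i _; apply: eq_bigr => j _.
by congr (f _ _); rewrite !PoszM; ring.
Qed.

(** The lattice Z^2 and its four cosets modulo 2 Z^2 carry the same weight up to a
    smaller order; expanding the indicator of 2 Z^2 in signs reduces this to alternating
    sums. *)
Lemma theta_estimate (a c : nat) (b : int) : (0 < a)%N -> (0 < c)%N ->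
  b ^+ 2 < 4 * a%:Z * c%:Z ->
  exists C : nat, forall M : nat, (0 < M)%N ->
  let K := ((a + c + 1) * M)%N in
  `|box (2 * K) (fun u v => wt 5 (M%:Z ^+ 2 - qform a%:Z b c%:Z u v))
    - 4 * box K (fun u v => wt 5 (M%:Z ^+ 2 - 4 * qform a%:Z b c%:Z u v))| <= C%:Z * M%:Z ^+ 9.
Proof.
move=> a0 c0 pd.
have [C1 H1] := alternating_lattice a0 c0 pd.
have [C2 H2] := alternating_lattice c0 a0 (ltac:(by rewrite -mulrA [c%:Z * _]mulrC mulrA) : b ^+ 2 < 4 * c%:Z * a%:Z).
exists (C1 + C1 + C2)%N => M M0; set K := ((a + c + 1) * M)%N; cbv zeta.
pose f u v := wt 5 (M%:Z ^+ 2 - qform a%:Z b c%:Z u v).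
have -> : box K (fun u v => wt 5 (M%:Z ^+ 2 - 4 * qform a%:Z b c%:Z u v)) =
   box K (fun u v => f (2 * u) (2 * v)).
  apply: eq_bigr => i _; apply: eq_bigr => j _; congr (wt 5 (_ - _)).
  by rewrite /qform; ring.
rewrite box_even.
pose L := (2 * (a + c + 1) * M)%N.
have KL : (2 * K = L)%N by rewrite /K /L mulnA.
rewrite {1}/box KL.
pose G (i j : nat) := f (i%:Z - L%:Z) (j%:Z - L%:Z).
have -> : \sum_(i < 2 * L) \sum_(j < 2 * L) f (i%:Z - L%:Z) (j%:Z - L%:Z) -
   \sum_(i < 2 * L) \sum_(j < 2 * L)
     (1 + (-1) ^+ i) * (1 + (-1) ^+ j) * f (i%:Z - L%:Z) (j%:Z - L%:Z) =
   - ((\sum_(j < 2 * L) 1 * \sum_(i < 2 * L) (-1) ^+ i * G i j)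
     + (\sum_(j < 2 * L) (-1) ^+ j * \sum_(i < 2 * L) (-1) ^+ i * G i j)
     + \sum_(i < 2 * L) 1 * \sum_(j < 2 * L) (-1) ^+ j * G i j).
  have sw h : \sum_(j < 2 * L) h j * \sum_(i < 2 * L) (-1) ^+ i * G i j =
     \sum_(i < 2 * L) \sum_(j < 2 * L) h j * ((-1) ^+ i * G i j).
    by rewrite exchange_big /=; apply: eq_bigr => j _; rewrite mulr_sumr.
  rewrite (sw (fun j => 1)) (sw (fun j => (-1) ^+ j)) -!big_split -sumrB -sumrN /=.
  apply: eq_bigr => i _; rewrite mulr_sumr -!big_split -sumrB -sumrN /=.
  by apply: eq_bigr => j _; rewrite /G; ring.
rewrite normrN !PoszD !mulrDl; apply: le_trans (ler_normD _ _) _; apply: lerD.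
  apply: le_trans (ler_normD _ _) _; apply: lerD.
  - by apply: (H1 M M0 (fun=> 1)).
  - by apply: (H1 M M0 (fun j => (-1) ^+ j)) => j; rewrite normrX normrN1 expr1n.
have := H2 M M0 (fun=> 1) (fun=> lexx _).
rewrite [(c + a)%N]addnC -/L; congr (`| _ | <= _).
apply: eq_bigr => i _; congr (_ * _); apply: eq_bigr => j _; congr (_ * wt 5 (_ - _)).
by rewrite /qform; ring.
Qed.

(** * From representation numbers to the Abel sum *)

Lemma sum_multiples (N d : nat) (G : nat -> int) : (0 < d)%N ->
  (forall n, (N < n)%N -> G n = 0) ->
  \sum_(n < N | (d %| n.+1)%N) G n.+1 = \sum_(j < N) G (d * j.+1)%N.
Proof.
move=> d0 GN.
transitivity (\sum_(j < N) \sum_(n < N) (n.+1 == d * j.+1)%N%:R * G n.+1).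
  rewrite exchange_big /= [LHS]big_mkcond /=; apply: eq_bigr => n _.
  rewrite -mulr_suml; case: ifP => [/dvdnP [k nk]|ndn]; last first.
    rewrite big1 ?mul0r // => j _; case: eqP => // nj; move: ndn.
    by rewrite nj dvdn_mulr.
  case: k nk => [|k] nk; first by rewrite mul0n in nk.
  have kN : (k < N)%N by have := ltn_ord n; nia.
  rewrite (bigD1 (Ordinal kN)) //= big1 => [|j jk]; first by rewrite nk mulnC eqxx addr0 mul1r.
  rewrite nk mulnC eqn_pmul2l // eqSS; case: eqP => // kj.
  by move: jk; rewrite -val_eqE /= kj eqxx.
apply: eq_bigr => j _; case: (leqP (d * j.+1)%N N) => [dN|Nd].
  have nN : ((d * j.+1).-1 < N)%N by nia.
  rewrite (bigD1 (Ordinal nN)) //= prednK ?muln_gt0 ?d0 // eqxx mul1r.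
  rewrite big1 ?addr0 // => n nn; case: eqP => [E|_]; last by rewrite mul0r.
  by move: nn; rewrite -val_eqE /= -E eqxx.
rewrite GN // big1 // => n _; case: eqP => [E|_]; last by rewrite mul0r.
by have := ltn_ord n; rewrite E; lia.
Qed.

(** The numbers 1 - 4 [4 | m], the coefficients of (1 - 4^(1-s)) zeta(s): the factor cancels
    the pole of zeta, that is, the sequence is balanced. Indices are shifted, m = j + 1. *)
Definition quarter_sign (j : nat) : int := if (4 %| j.+1)%N then -3 else 1.

Lemma balanced_quarter_sign : balanced 4 quarter_sign.
Proof.
split=> // [i|]; last by rewrite !big_ord_recr big_ord0.
by rewrite /quarter_sign -addSn dvdn_addl.
Qed.

Lemma abel_quarter_sign : abel 4 quarter_sign = 6.
Proof. by rewrite /abel /psum !big_ord_recr !big_ord0. Qed.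

Lemma wt5_lower (M : nat) : (3 <= M)%N -> M%:Z ^+ 10 <= 3840 * wt 5 (M%:Z ^+ 2).
Proof.
move=> M3; have -> : M%:Z ^+ 2 = (M ^ 2)%N%:Z by rewrite -[RHS]natz natrX natz.
rewrite /wt; set n := (M ^ 2)%N.
have n8 : (9 <= n)%N by rewrite /n; nia.
have -> : M%:Z ^+ 10 = (n ^ 5)%N%:Z by rewrite -expnM -[RHS]natz natrX natz.
rewrite -PoszM lez_nat.
have : (3840 * 'C(n, 5) = 32 * n ^_ 5)%N by rewrite -bin_ffact; rewrite (_ : 5`! = 120)%N //; lia.
move=> ->; rewrite !ffactnS ffactn0 muln1.
have [k nk] : exists k, n = k.+4 by exists (n - 4)%N; lia.
rewrite nk /=; have k5 : (5 <= k)%N by lia.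
clear -k5.
have -> : (k.+4 ^ 5 = k.+4 * (k.+4 * (k.+4 * (k.+4 * k.+4))))%N by lia.
apply: leq_trans (_ : k.+4 * ((2 * k.+3) * ((2 * k.+2) * ((2 * k.+1) * (2 * k)))) <= _)%N; last by nia.
by do !(apply: leq_mul; first by lia); lia.
Qed.

(** Apply the hypothesis to the weight F and to n |-> F(4 n), and subtract four times the
    second from the first. Up to M^9 the lattice sums cancel by [theta_estimate]; the
    zero vectors leave -3 (size forms) F(0), and by [hyperbola_sum] the divisor sums leave
    2 (abel p th / p) (6 / 4) F(1), where 6 / 4 comes from the signs [quarter_sign]. As F(0)
    and F(1) agree up to M^8 and have order M^10, the two constants are equal. *)
Lemma constant_term (p : nat) (th : nat -> int) (forms : seq (nat * int * nat)) (r : nat -> int) :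
  balanced p th ->
  (forall f, f \in forms ->
     [/\ (0 < f.1.1)%N, (0 < f.2)%N & f.1.2 ^+ 2 < 4 * f.1.1%:Z * f.2%:Z]) ->
  (forall n, r n.+1 = \sum_(i < n.+1 | (i.+1 %| n.+1)%N) th i) ->
  (forall (M k : nat) (F : int -> int), (0 < M)%N -> (0 < k)%N ->
     (forall n, (M ^ 2)%N%:Z <= n -> F n = 0) ->
     \sum_(f <- forms) box (k * ((f.1.1 + f.2 + 1) * M))
                           (fun u v => F (qform f.1.1%:Z f.1.2 f.2%:Z u v))
     = (size forms)%:Z * F 0 + 2 * \sum_(n < M ^ 2) r n.+1 * F n.+1%:Z) ->
  p%:Z * (size forms)%:Z = abel p th.
Proof.
move=> bal pos Hr Hrep.
have [C1 H1] := hyperbola_sum bal balanced_quarter_sign.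
have [C2 H2] : exists C : nat, forall M : nat, (0 < M)%N ->
   `|\sum_(f <- forms) (box (2 * ((f.1.1 + f.2 + 1) * M))
        (fun u v => wt 5 (M%:Z ^+ 2 - qform f.1.1%:Z f.1.2 f.2%:Z u v))
    - 4 * box (1 * ((f.1.1 + f.2 + 1) * M))
        (fun u v => wt 5 (M%:Z ^+ 2 - 4 * qform f.1.1%:Z f.1.2 f.2%:Z u v)))| <= C%:Z * M%:Z ^+ 9.
  elim: forms pos {Hrep} => [|f l IH] pos.
    by exists 0%N => M _; rewrite big_nil normr0 mul0r.
  have [|C HC] := IH; first by move=> g gl; apply: pos; rewrite in_cons gl orbT.
  have [a0 c0 pd] := pos f (mem_head _ _).
  have [C' HC'] := theta_estimate a0 c0 pd.
  exists (C' + C)%N => M M0; rewrite big_cons [(C' + C)%N%:Z]PoszD [_ * M%:Z ^+ 9]mulrDl.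
  apply: le_trans (ler_normD _ _) _; apply: lerD; last exact: HC.
  by have := HC' M M0; cbv zeta; rewrite mul1n.
set h := size forms in Hrep *; set S := abel p th in H1 *.
have key M : (0 < M)%N ->
   `|12 * (S - p%:Z * h%:Z) * wt 5 (M%:Z ^+ 2)| <= (4 * p%:Z * C2%:Z + 2 * C1%:Z + 12 * `|S|) * M%:Z ^+ 9.
  move=> M0; have M2 : M%:Z ^+ 2 = (M ^ 2)%N%:Z by rewrite -[RHS]natz natrX natz.
  set N := (M ^ 2)%N in M2.
  pose F (n : int) := wt 5 (N%:Z - n).
  have FN n : N%:Z <= n -> F n = 0 by move=> Nn; apply: wt_le0; rewrite subr_le0.
  have FN4 n : N%:Z <= n -> F (4 * n) = 0 by move=> Nn; apply: FN; lia.
  have := H2 M M0; rewrite M2.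
  rewrite big_split /= sumrN -mulr_sumr (Hrep M 2%N F M0 isT FN).
  rewrite (Hrep M 1%N (fun n => F (4 * n)) M0 isT FN4) mulr0 -/N.
  have -> : h%:Z * F 0 + 2 * (\sum_(n < N) r n.+1 * F n.+1%:Z) -
      4 * (h%:Z * F 0 + 2 * (\sum_(n < N) r n.+1 * F (4 * n.+1%:Z)))
    = 2 * (\sum_(i < N) \sum_(j < N) th i * quarter_sign j * F (i.+1%:Z * j.+1%:Z)) - 3 * h%:Z * F 0.
    have conv (G : nat -> int) : (forall n, (N < n)%N -> G n = 0) ->
      \sum_(n < N) r n.+1 * G n.+1 = \sum_(i < N) th i * \sum_(j < N) G (i.+1 * j.+1)%N.
      move=> GN; transitivity (\sum_(n < N) \sum_(i < N | (i.+1 %| n.+1)%N) th i * G n.+1).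
        apply: eq_bigr => n _; rewrite Hr mulr_suml.
        rewrite (big_ord_widen_cond N (fun i => (i.+1 %| n.+1)%N) (fun i => th i * G n.+1)) //.
        apply: eq_bigl => i; case: (boolP (_ %| _)%N) => //= /dvdn_leq; exact.
      rewrite (exchange_big_dep xpredT) //=; apply: eq_bigr => i _.
      by rewrite -sum_multiples // mulr_sumr.
    rewrite (conv (fun n => F n%:Z)) => [|n Nn]; last by apply: FN; lia.
    rewrite (conv (fun n => F (4 * n%:Z))) => [|n Nn]; last by apply: FN; lia.
    have -> : \sum_(i < N) \sum_(j < N) th i * quarter_sign j * F (i.+1%:Z * j.+1%:Z) =
       \sum_(i < N) th i * (\sum_(j < N) F (i.+1 * j.+1)%N%:Z)
       - 4 * \sum_(i < N) th i * (\sum_(j < N) F (4 * (i.+1 * j.+1)%N%:Z)).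
      rewrite [X in _ - X]mulr_sumr -sumrB; apply: eq_bigr => i _.
      pose G (n : nat) := F (i.+1%:Z * n%:Z).
      have := sum_multiples (N := N) (d := 4) (G := G) isT.
      move=> /(_ ltac:(move=> n Nn; apply: FN; nia)) E4.
      have -> : \sum_(j < N) F (4 * (i.+1 * j.+1)%N%:Z) = \sum_(n < N | (4 %| n.+1)%N) G n.+1.
        by rewrite E4; apply: eq_bigr => j _; rewrite /G; congr F; rewrite !PoszM; ring.
      rewrite [X in _ - 4 * (_ * X)]big_mkcond /= mulrCA -mulrBr [4 * _]mulr_sumr -sumrB mulr_sumr.
      apply: eq_bigr => j _; rewrite -mulrA; congr (_ * _); rewrite /quarter_sign /G PoszM.
      by case: ifP => _; ring.
    ring.
  have := H1 M M0; rewrite abel_quarter_sign -/N -/S.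
  have -> : \sum_(i < N) \sum_(j < N) th i * quarter_sign j * wt 5 (N%:Z - i.+1%:Z * j.+1%:Z) =
    \sum_(i < N) \sum_(j < N) th i * quarter_sign j * F (i.+1%:Z * j.+1%:Z) by [].
  move: (\sum_(i < N) _) => T.
  have F1 : `|F 0 - wt 5 (N%:Z - 1)| <= M%:Z ^+ 9.
    rewrite /F subr0 wt_diff ger0_norm ?wt_ge0 //.
    apply: le_trans (@wt_le_exp 4 _ N _) _; first by lia.
    have -> : N%:Z ^+ 4 = M%:Z ^+ 8 by rewrite -M2 -exprM.
    by rewrite [M%:Z ^+ 9]exprS ler_peMl ?exprn_ge0 //; lia.
  have <- : F 0 = 'C(N, 5)%:Z by rewrite /F subr0.
  move: (wt 5 (N%:Z - 1)) (F 0) F1 => f1 f0.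
  move: (M%:Z ^+ 9) => m9 F1 HT HF.
  have HF' : `|4 * p%:Z * (2 * T - 3 * h%:Z * f0)| <= 4 * p%:Z * (C2%:Z * m9).
    by rewrite normrM ger0_norm ?mulr_ge0 // ler_wpM2l // mulr_ge0.
  have F1' : `|12 * S * (f0 - f1)| <= 12 * `|S| * m9.
    by rewrite normrM normrM ger0_norm // ler_wpM2l ?mulr_ge0.
  have -> : 12 * (S - p%:Z * h%:Z) * f0 = 4 * p%:Z * (2 * T - 3 * h%:Z * f0)
     - 2 * (p%:Z * 4%:Z * T - S * 6 * f1) + 12 * S * (f0 - f1) by ring.
  have -> : (4 * p%:Z * C2%:Z + 2 * C1%:Z + 12 * `|S|) * m9 = 4 * p%:Z * (C2%:Z * m9)
     + 2 * (C1%:Z * m9) + 12 * `|S| * m9 by ring.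
  move: HT HF' F1'; clear => *; lia.
apply/eqP; apply: contraT => ne; exfalso.
set C := 4 * p%:Z * C2%:Z + _ + _ in key.
have C0 : 0 <= C by rewrite /C !addr_ge0 ?mulr_ge0.
pose M := (3840 * `|C| + 3)%N.
have M3 : (3 <= M)%N by rewrite /M; lia.
have := key M ltac:(lia); have := wt5_lower M3.
have D1 : 1 <= `|12 * (S - p%:Z * h%:Z)| by move: ne; clear; move: (p%:Z * h%:Z) => x; lia.
rewrite normrM (ger0_norm (wt_ge0 5 _)).
have MC : 3840 * C < M%:Z by rewrite /M; clear -C0; lia.
have M9 : 0 < M%:Z ^+ 9 by rewrite exprn_gt0 //; clear -M3; lia.
rewrite [M%:Z ^+ 10]exprS.
have := wt_ge0 5 (M%:Z ^+ 2).
move=> w0 lo hi.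
have aux (w m9 D m K : int) : 0 < m9 -> 1 <= D -> 3840 * K < m -> 0 <= w ->
    m * m9 <= 3840 * w -> D * w <= K * m9 -> False.
  clear => m90 D1 mK w0 lo hi.
  have h1 : w <= D * w by rewrite ler_peMl.
  have h2 : 3840 * K * m9 < m * m9 by rewrite ltr_pM2r.
  move: h1 h2 lo hi; rewrite -mulrA; move: (K * m9) (D * w) (m * m9).
  by clear => *; lia.
exact: aux M9 D1 MC w0 lo hi.
Qed.

(** * The ring of integers of the imaginary quadratic field *)

Section QuadraticIntegers.

Variables (p m : nat).
Hypotheses (p_pr : prime p) (pm : p.+1 = (4 * m)%N).

Definition root_disc : algC := sqrtC (- p%:Z)%:~R.
Local Notation w := root_disc.
Definition omega : algC := (1 + w) / 2%:R.
Local Notation om := omega.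

Definition elt (x y : int) : algC := x%:~R + y%:~R * om.

Lemma root_disc_sqr : w ^+ 2 = - p%:R.
Proof. by rewrite sqrtCK rmorphN. Qed.

Lemma root_disc_neq0 : w != 0.
Proof.
rewrite -sqrf_eq0 root_disc_sqr oppr_eq0 pnatr_eq0.
by rewrite -lt0n prime_gt0.
Qed.

Lemma conj_root_disc : w^* = - w.
Proof.
have : (w^* - w) * (w^* + w) = 0.
  have -> : (w^* - w) * (w^* + w) = w^* ^+ 2 - w ^+ 2 by ring.
  by rewrite -rmorphXn /= root_disc_sqr rmorphN /= rmorph_nat subrr.
move=> /eqP; rewrite mulf_eq0 subr_eq0 addr_eq0 => /orP [/eqP/CrealP wR|/eqP //].
have := real_exprn_even_ge0 (n := 2) wR isT; rewrite root_disc_sqr oppr_ge0 lern0.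
by have := prime_gt0 p_pr; case: p.
Qed.

Lemma omega_sqr : om ^+ 2 = om - m%:R.
Proof.
have p4 : p%:R = 4%:R * m%:R - 1 :> algC by rewrite -natrM -pm -natr1 addrK.
have w2 := root_disc_sqr; rewrite p4 in w2.
have -> : om ^+ 2 = (1 + 2 * w + w ^+ 2) / 4%:R by rewrite /omega; field.
by rewrite w2 /omega; field.
Qed.

Lemma conj_omega : om^* = 1 - om.
Proof.
by rewrite /omega rmorphM rmorphD rmorph1 /= conj_root_disc fmorphV /= rmorph_nat; field.
Qed.

Lemma conj_int (x : int) : (x%:~R : algC)^* = x%:~R.
Proof. by rewrite rmorph_int. Qed.

Lemma conj_elt x y : (elt x y)^* = elt (x + y) (- y).
Proof.
rewrite /elt [LHS]rmorphD /= [(_ * om)^*]rmorphM /= !conj_int conj_omega [(x + y)%:~R]rmorphD rmorphN /=.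
by ring.
Qed.

Lemma elt_inj x y x' y' : elt x y = elt x' y' -> x = x' /\ y = y'.
Proof.
move=> E; have E' : elt x y - (elt x y)^* = elt x' y' - (elt x' y')^* by rewrite E.
rewrite !conj_elt /elt in E'.
have omw : 2 * om - 1 = w by rewrite /omega; field.
have yw : (y - y')%:~R * w = 0.
  move/eqP: E'; rewrite -subr_eq0 => /eqP <-.
  by rewrite -omw rmorphB !rmorphD !rmorphN /=; ring.
move/eqP: yw; rewrite mulf_eq0 (negbTE root_disc_neq0) orbF intr_eq0 subr_eq0 => /eqP yy.
by move: E; rewrite /elt yy => /addIr /intr_inj ->.
Qed.

Lemma eltD x y x' y' : elt x y + elt x' y' = elt (x + x') (y + y').
Proof. by rewrite /elt !rmorphD /=; ring. Qed.

Lemma eltN x y : - elt x y = elt (- x) (- y).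
Proof. by rewrite /elt !rmorphN /=; ring. Qed.

Lemma eltM x y x' y' :
  elt x y * elt x' y' = elt (x * x' - m%:Z * y * y') (x * y' + y * x' + y * y').
Proof.
have := omega_sqr; rewrite /elt !rmorphD !rmorphN !rmorphM /= => E.
have -> : m%:Z%:~R = om - om ^+ 2 by rewrite E opprB addrC subrK.
by ring.
Qed.

Lemma elt_int x : elt x 0 = x%:~R. Proof. by rewrite /elt mul0r addr0. Qed.

Definition nrm (x y : int) : int := x ^+ 2 + x * y + m%:Z * y ^+ 2.

Lemma elt_norm x y : elt x y * (elt x y)^* = (nrm x y)%:~R.
Proof.
rewrite conj_elt eltM -elt_int /nrm; congr elt; ring.
Qed.

Lemma nrm_disc x y : 4 * nrm x y = (2 * x + y) ^+ 2 + p%:Z * y ^+ 2.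
Proof.
have -> : p%:Z = 4 * m%:Z - 1 by lia.
by rewrite /nrm; ring.
Qed.

(** For p > 3 the units are 1 and -1; for p = 3 there would be six of them. *)
Lemma nrm_eq1 x y : (3 < p)%N -> nrm x y = 1 -> y = 0 /\ (x = 1 \/ x = -1).
Proof.
move=> p3 N1; have := nrm_disc x y; rewrite N1 => E.
have p5 : 5 <= p%:Z by case: p p3 pm p_pr => [|[|[|[|[|q]]]]] // *; lia.
have y0 : y = 0 by nia.
move: E; rewrite y0 expr0n /= mulr0 !addr0 => E; split=> //.
have : (x - 1) * (x + 1) = 0 by nia.
by move/eqP; rewrite mulf_eq0 subr_eq0 addr_eq0 => /orP [] /eqP ->; [left|right].
Qed.

Lemma nrm_eq0 x y : nrm x y = 0 -> x = 0 /\ y = 0.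
Proof. by move=> N0; have := nrm_disc x y; rewrite N0; have := prime_gt0 p_pr; nia. Qed.

Lemma omega_Aint : om \in Aint.
Proof.
have szq : (size (- 'X + m%:R%:P : {poly algC})%R < 3)%N.
  rewrite (leq_ltn_trans (size_polyD _ _)) // gtn_max size_polyN size_polyX /=.
  by rewrite (leq_ltn_trans (size_polyC_leq1 _)).
apply: (@root_monic_Aint ('X^2 + (- 'X + m%:R%:P))).
- by rewrite rootE hornerD hornerD hornerN hornerXn hornerX hornerC omega_sqr; apply/eqP; ring.
- by rewrite monicE lead_coefDl ?size_polyXn // lead_coefXn.
- apply/polyOverP => i; rewrite !coefD coefN coefXn coefX coefC.
  by apply: rpredD; [exact: rpred_nat | apply: rpredD; [rewrite rpredN rpred_nat | case: ifP => _; rewrite ?rpred0 ?rpred_nat]].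
Qed.

Local Notation K := (quadratic_field (- p%:Z)).

(** Trace 2 a and norm a^2 + p b^2 of an algebraic integer a + b sqrt(-p) are integers. Then
    p (2 b)^2 is an integer, and so is 2 b, since p is square-free; finally 2 a and 2 b have
    the same parity, since p = 3 mod 4. *)
Lemma ring_of_integersE z : ring_of_integers K z <-> exists x y, z = elt x y.
Proof.
split; last first.
  case=> x [y ->]; split; last first.
    by apply: rpredD; [exact: Aint_int | apply: rpredM; [exact: Aint_int | exact: omega_Aint]].
  exists (x%:~R + y%:~R / 2%:R), (y%:~R / 2%:R).
  rewrite rmorphD !fmorph_div /= !ratr_int ratr_nat /elt /omega -/root_disc.
  by field.
case=> -[a [b zE]] zA; rewrite -/root_disc in zE.
have conjz : z^* = ratr a - ratr b * w.
  rewrite zE [LHS]rmorphD /= [(_ * w)^*]rmorphM /= conj_root_disc.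
  by rewrite !(conj_Crat (Crat_rat _)) mulrN.
have zA' : z^* \in Aint by rewrite (Aint_aut Num.conj).
have rat_int (c : rat) : (ratr c : algC) \in Aint -> exists k : int, c = k%:~R.
  move=> cA; have /intrP [k ck] := Cint_rat_Aint (Crat_rat c) cA.
  by exists k; apply: (fmorph_inj (@ratr algC)); rewrite /= ck ratr_int.
have [A HA] : exists A : int, 2 * a = A%:~R.
  apply: rat_int; have -> : ratr (2 * a) = z + z^* :> algC.
    by rewrite conjz zE rmorphM /= ratr_nat; ring.
  exact: rpredD.
have [N HN] : exists N : int, a ^+ 2 + p%:R * b ^+ 2 = N%:~R.
  apply: rat_int; have -> : ratr (a ^+ 2 + p%:R * b ^+ 2) = z * z^* :> algC.
    rewrite conjz zE rmorphD rmorphM !rmorphXn /= ratr_nat.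
    have -> : p%:R = - w ^+ 2 by rewrite root_disc_sqr opprK.
    by ring.
  exact: rpredM.
have bwA : ratr (2 * b) * w \in Aint.
  have -> : ratr (2 * b) * w = z - z^* by rewrite conjz zE rmorphM /= ratr_nat; ring.
  exact: rpredB.
have wA : w \in Aint.
  have -> : w = 2 * om - 1 by rewrite /omega; field.
  by apply: rpredB (Aint1); apply: rpredM omega_Aint; apply: (Aint_int 2).
have [k Hk] : exists k : int, (2 * b) ^+ 2 * p%:R = k%:~R.
  apply: rat_int; have -> : ratr ((2 * b) ^+ 2 * p%:R) = - (ratr (2 * b) * w) ^+ 2 :> algC.
    by rewrite [(ratr _ * w) ^+ 2]exprMn root_disc_sqr rmorphM rmorphXn /= ratr_nat; ring.
  by rewrite rpredN rpredX.
have [s Hs] : exists s : int, 2 * b * p%:R = s%:~R.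
  apply: rat_int; have -> : ratr (2 * b * p%:R) = - (ratr (2 * b) * w * w) :> algC.
    by rewrite -[ratr _ * w * w]mulrA -expr2 root_disc_sqr rmorphM /= ratr_nat; ring.
  by rewrite rpredN rpredM.
have p0 : p%:R != 0 :> rat by rewrite pnatr_eq0 -lt0n prime_gt0.
have [B HB] : exists B : int, 2 * b = B%:~R.
  have s2 : s ^+ 2 = k * p%:Z.
    by apply: (@intr_inj rat); rewrite rmorphXn rmorphM /= -Hs -Hk; ring.
  have : (p %| `|s| ^ 2)%N by rewrite -abszX s2 abszM dvdn_mull.
  rewrite Euclid_dvdX // andbT => /dvdnP [t ts].
  exists (sgz s * t%:Z); apply: (mulIf p0); rewrite Hs.
  have sE : s = sgz s * t%:Z * p%:Z by rewrite {1}[s]intEsg ts PoszM mulrA.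
  by rewrite {1}sE rmorphM.
have E4 : A ^+ 2 + p%:Z * B ^+ 2 = 4 * N.
  by apply: (@intr_inj rat); rewrite rmorphD rmorphXn /= [(p%:Z * _)%:~R]rmorphM rmorphXn [(4 * _)%:~R]rmorphM /= -HA -HB -HN; ring.
have [t Ht] : exists t : int, A = B + 2 * t.
  have E5 : (A - B) * (A + B) = 4 * (N - m%:Z * B ^+ 2).
    have pmz : p%:Z = 4 * m%:Z - 1 by lia.
    move: E4; rewrite pmz => E4.
    have -> : (A - B) * (A + B) = A ^+ 2 + (4 * m%:Z - 1) * B ^+ 2 - 4 * (m%:Z * B ^+ 2) by ring.
    by rewrite E4; ring.
  have : (2 %| (A - B))%Z || (2 %| (A + B))%Z.
    have : (2 %| ((A - B) * (A + B)))%Z.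
      by rewrite E5; apply/dvdzP; exists (2 * (N - m%:Z * B ^+ 2)); ring.
    by rewrite !dvdzE abszM Euclid_dvdM.
  case/orP => /dvdzP [q Hq]; [exists q | exists (q - B)]; lia.
exists t, B; rewrite zE.
have -> : ratr a = A%:~R / 2%:R :> algC.
  by rewrite -ratr_int -HA rmorphM /= ratr_nat mulrC mulKf // pnatr_eq0.
have -> : ratr b = B%:~R / 2%:R :> algC.
  by rewrite -ratr_int -HB rmorphM /= ratr_nat mulrC mulKf // pnatr_eq0.
by rewrite Ht /elt /omega rmorphD rmorphM /=; field.
Qed.

End QuadraticIntegers.

(** * Ideals as lattices *)

Section Lattices.

Variables (p m : nat).
Hypotheses (p_pr : prime p) (pm : p.+1 = (4 * m)%N).
Local Notation elt := (elt p).
Local Notation nrm := (nrm m).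

(** The triple (e, a, b) stands for the ideal e (a, b + omega); reducing b modulo a makes it
    unique. *)
Definition valid (e a b : nat) : bool := [&& (0 < e)%N, (0 < a)%N, (b < a)%N & (a %| quad m b)%N].

Definition idl (e a b : nat) : set algC :=
  fun z => exists u v : int, z = elt (e%:Z * (a%:Z * u + b%:Z * v)) (e%:Z * v).

Definition cofac (a b : nat) : nat := quad m b %/ a.

(** The quotient of the norm form on the lattice (a, b + omega) by a; its discriminant is
    -p. *)
Definition ideal_form (a b : nat) (u v : int) : int :=
  qform a%:Z (2 * b + 1)%N%:Z (cofac a b)%:Z u v.

Lemma cofacE e a b : valid e a b -> a%:Z * (cofac a b)%:Z = b%:Z ^+ 2 + b%:Z + m%:Z.
Proof.
case/and4P => _ _ _ /divnK H; rewrite -PoszM /cofac mulnC H /quad !PoszD.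
by rewrite -[(b ^ 2)%N%:Z]natz natrX natz.
Qed.

Lemma nrm_lattice e a b u v : valid e a b ->
  nrm (e%:Z * (a%:Z * u + b%:Z * v)) (e%:Z * v) = e%:Z ^+ 2 * a%:Z * ideal_form a b u v.
Proof.
move=> /cofacE ac; rewrite /ideal_form /qform /nrm PoszD PoszM.
have -> : m%:Z = a%:Z * (cofac a b)%:Z - b%:Z ^+ 2 - b%:Z by rewrite ac; ring.
by ring.
Qed.

Lemma idl0 e a b : idl e a b 0.
Proof. by exists 0, 0; rewrite -[LHS]/(0%:~R) -(elt_int p); congr elt; ring. Qed.

Lemma idlD e a b y z : idl e a b y -> idl e a b z -> idl e a b (y + z).
Proof.
move=> [u [v ->]] [u' [v' ->]]; exists (u + u'), (v + v').
by rewrite eltD; congr elt; ring.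
Qed.

Lemma idlM e a b x y z : valid e a b -> idl e a b z -> idl e a b (elt x y * z).
Proof.
move=> V [u [v ->]]; have ac := cofacE V; rewrite (eltM pm).
exists (x * u - y * b%:Z * u - y * (cofac a b)%:Z * v), (x * v + y * a%:Z * u + y * b%:Z * v + y * v).
congr elt; last by ring.
have -> : m%:Z = a%:Z * (cofac a b)%:Z - b%:Z ^+ 2 - b%:Z by rewrite ac; ring.
by ring.
Qed.

Lemma idlN e a b z : valid e a b -> idl e a b z -> idl e a b (- z).
Proof.
move=> V /(idlM (-1) 0 V); rewrite elt_int; by rewrite rmorphN1 mulN1r.
Qed.

Lemma idl_elt e a b z : idl e a b z -> exists x y, z = elt x y.
Proof. by move=> [u [v ->]]; eexists; eexists. Qed.

Lemma idl_gen e a b : idl e a b (e * a)%N%:R.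
Proof. by exists 1, 0; rewrite -[LHS]/((e * a)%N%:Z%:~R) -(elt_int p); congr elt; rewrite ?PoszM; ring. Qed.

Lemma idl_gen2 e a b : idl e a b (elt (e * b)%N%:Z e%:Z).
Proof. by exists 0, 1; congr elt; rewrite ?PoszM; ring. Qed.

Lemma subgroup_int (Y : int -> Prop) : Y 0 -> (forall x y, Y x -> Y y -> Y (x - y)) ->
  (exists2 y, Y y & y != 0) -> exists2 d : nat, (0 < d)%N & forall y, Y y <-> (d%:Z %| y)%Z.
Proof.
move=> Y0 YB [y0 Yy0 y00].
have YN y : Y y -> Y (- y) by move=> Yy; rewrite -sub0r; apply: YB.
have ex : exists n : nat, (0 < n)%N && `[< Y n%:Z >].
  exists `|y0|%N; rewrite absz_gt0 y00; apply/asboolP.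
  by case: (lerP 0 y0) => h; [rewrite gez0_abs // | rewrite ltz0_abs //; exact: YN].
case: (ex_minnP ex) => d /andP [d0 /asboolP Yd] dmin; exists d => // y.
have Ymul (q : int) : Y (q * d%:Z).
  have nat_mul (k : nat) : Y (k%:Z * d%:Z).
    elim: k => [|k IH]; first by rewrite mul0r.
    rewrite (_ : k.+1%:Z * d%:Z = k%:Z * d%:Z - - d%:Z); last by lia.
    exact: YB (YN _ Yd).
  by case: (lerP 0 q) => h; [rewrite -(gez0_abs h) | rewrite -[q]opprK -(ltz0_abs h) mulNr; apply: YN].
split; last by move=> /dvdzP [q ->].
move=> Yy.
have Yr : Y (y %% d)%Z by rewrite /modz; apply: YB.
have r0 : 0 <= (y %% d)%Z by apply: modz_ge0; lia.
have rd : (y %% d)%Z < d%:Z by apply: ltz_pmod; lia.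
apply/dvdz_mod0P/eqP; apply: contraT => rn0.
have := dmin `|(y %% d)%Z|%N; rewrite absz_gt0 rn0 /= gez0_abs // => H.
have : (d <= `|(y %% d)%Z|)%N by apply: H; apply/asboolP.
lia.
Qed.

(** An ideal is determined by its second coordinates, the multiples of [e], its rational
    integers, the multiples of [e * a], and one element with second coordinate [e]. *)
Lemma ideal_classification (J : set algC) :
  (forall z, J z -> exists x y, z = elt x y) -> J 0 ->
  (forall y z, J y -> J z -> J (y + z)) ->
  (forall x y z, J z -> J (elt x y * z)) ->
  (exists2 z, J z & z != 0) ->
  exists e a b : nat, valid e a b /\ (forall z, J z <-> idl e a b z).
Proof.
move=> Jelt J0 JD JM [z0 Jz0 z00].
have JB y z : J y -> J z -> J (y - z).
  move=> Jy Jz; apply: JD => //; have := JM (-1) 0 z Jz.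
  by rewrite elt_int rmorphN1 mulN1r.
have JZ (k : int) z : J z -> J (k%:~R * z) by rewrite -(elt_int p); apply: JM.
have [x0 [y0 z0E]] := Jelt _ Jz0.
have nz0 : nrm x0 y0 != 0.
  apply/eqP => /(nrm_eq0 p_pr pm) [x00 y00]; move: z00.
  by rewrite z0E x00 y00 elt_int eqxx.
have JX0 : J (nrm x0 y0)%:~R.
  by rewrite -(elt_norm p_pr pm) mulrC (conj_elt p_pr) -z0E; apply: JM.
have JY0 : J (elt 0 (nrm x0 y0)).
  have := JM 0 1 _ JX0; rewrite -(elt_int p) (eltM pm); congr J; congr elt; ring.
have [e e0 He] : exists2 e : nat, (0 < e)%N & forall y, (exists x, J (elt x y)) <-> (e%:Z %| y)%Z.
  apply: subgroup_int.
  - by exists 0; rewrite elt_int.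
  - move=> y y' [x Jx] [x' Jx']; exists (x - x').
    by have := JB _ _ Jx Jx'; rewrite eltN eltD.
  - by exists (nrm x0 y0) => //; exists 0.
have [f f0 Hf] : exists2 f : nat, (0 < f)%N & forall x, J (elt x 0) <-> (f%:Z %| x)%Z.
  apply: subgroup_int.
  - by rewrite elt_int.
  - by move=> x x' Jx Jx'; have := JB _ _ Jx Jx'; rewrite eltN eltD oppr0 addr0.
  - by exists (nrm x0 y0) => //; rewrite elt_int.
have ef : (e%:Z %| f%:Z)%Z.
  apply/He; exists 0; have /Hf Jf : (f%:Z %| f%:Z)%Z by exact: dvdzz.
  have := JM 0 1 _ Jf; rewrite (eltM pm); congr J; congr elt; ring.
have /dvdzP [a' fa'] := ef.
have [a fa] : exists a : nat, f = (a * e)%N by exists `|a'|%N; nia.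
have a0 : (0 < a)%N by case: a fa f0 => // ->.
have [B JB1] : exists B, J (elt B e%:Z) by apply/He/dvdzz.
have /dvdzP [b0 Bb0] : (e%:Z %| B)%Z.
  have : (e%:Z %| (B + e%:Z))%Z.
    apply/He; exists (- (m%:Z * e%:Z)).
    have := JM 0 1 _ JB1; rewrite (eltM pm); congr J; congr elt; ring.
  by rewrite rpredDr ?dvdzz.
pose b := `|(b0 %% a)%Z|%N.
have bE : b%:Z = (b0 %% a)%Z by rewrite gez0_abs // modz_ge0; lia.
have ba : (b < a)%N by rewrite -ltz_nat bE ltz_pmod.
have Jb : J (elt (e%:Z * b%:Z) e%:Z).
  have /Hf Jc : (f%:Z %| (b0 %/ a)%Z * f%:Z)%Z by apply: dvdz_mull; apply: dvdzz.
  have := JB _ _ JB1 Jc; rewrite eltN eltD oppr0 addr0; congr J; congr elt.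
  by rewrite bE /modz Bb0 fa PoszM; ring.
have aq : (a %| quad m b)%N.
  have : (f%:Z %| (e * quad m b)%N%:Z)%Z.
    apply/Hf; have := JM (b%:Z + 1) (-1) _ Jb; rewrite (eltM pm); congr J; congr elt; last by ring.
    by rewrite PoszM /quad !PoszD -[(b ^ 2)%N%:Z]natz natrX natz; ring.
  by rewrite dvdzE /= fa mulnC dvdn_pmul2l.
exists e, a, b; split; first by rewrite /valid e0 a0 ba aq.
move=> z; split.
  move=> Jz; have [x [y zE]] := Jelt _ Jz.
  have /dvdzP [v yv] : (e%:Z %| y)%Z by apply/He; exists x; rewrite -zE.
  have : J (elt (x - v * (e%:Z * b%:Z)) 0).
    have := JB _ _ Jz (JZ v _ Jb); rewrite zE -(elt_int p) (eltM pm) eltN eltD.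
    by congr J; congr elt; rewrite ?yv; ring.
  move/Hf/dvdzP => [u xu]; exists u, v; rewrite zE; congr elt; last by rewrite yv mulrC.
  have -> : x = u * f + v * (e%:Z * b%:Z) by rewrite -xu subrK.
  by rewrite fa PoszM; ring.
case=> u [v ->].
have /Hf Ju : (f%:Z %| u * f%:Z)%Z by apply: dvdz_mull; apply: dvdzz.
have := JD _ _ Ju (JZ v _ Jb); rewrite -(elt_int p v) (eltM pm) eltD; congr J; congr elt.
  by rewrite fa PoszM; ring.
ring.
Qed.

(** The numbers e and e a are the least positive second coordinate and the least positive
    rational integer in the lattice. *)
Lemma idl_inj e a b e' a' b' : valid e a b -> valid e' a' b' ->
  (forall z, idl e a b z <-> idl e' a' b' z) -> [/\ e = e', a = a' & b = b'].
Proof.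
have half e1 a1 b1 e2 a2 b2 : valid e1 a1 b1 -> valid e2 a2 b2 ->
    (forall z, idl e1 a1 b1 z -> idl e2 a2 b2 z) -> (e2 %| e1)%N /\ (e2 * a2 %| e1 * a1)%N.
  move=> V1 V2 H; split.
    have [u [v]] := H _ (idl_gen2 e1 a1 b1) => /(elt_inj p_pr) [_ ev].
    by apply/dvdnP; exists `|v|%N; nia.
  have [u [v]] := H _ (idl_gen e1 a1 b1); rewrite -[_%:R]/((e1 * a1)%N%:Z%:~R) -(elt_int p) => /(elt_inj p_pr) [E ev].
  have /and4P [e20 _ _ _] := V2.
  have v0 : v = 0.
    by move/esym/eqP: ev; rewrite mulf_eq0 => /orP [/eqP|/eqP //]; lia.
  move: E; rewrite v0 mulr0 addr0 => E; apply/dvdnP; exists `|u|%N.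
  have : (e1 * a1)%N%:Z = (e2 * a2)%N%:Z * u by rewrite E PoszM; ring.
  by move=> /(congr1 absz); rewrite abszM !absz_nat => ->; rewrite [RHS]mulnC.
move=> V V' H.
have [ee1 ff1] := half _ _ _ _ _ _ V V' (fun z => (H z).1).
have [ee2 ff2] := half _ _ _ _ _ _ V' V (fun z => (H z).2).
have ee : e = e' by apply/eqP; rewrite eqn_dvd ee1 ee2.
subst e'; have /and4P [e0 a0 ba _] := V; have /and4P [_ a0' ba' _] := V'.
have aa : a = a' by apply/eqP; rewrite eqn_dvd -(dvdn_pmul2l e0) ff2 -(dvdn_pmul2l e0) ff1.
subst a'; split=> //.
have [u [v]] := (H _).1 (idl_gen2 e a b) => /(elt_inj p_pr) [E ev].
have v1 : v = 1 by nia.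
move: E; rewrite v1 mulr1 PoszM => E.
have : b%:Z = a%:Z * u + b'%:Z by nia.
have [u0|u0] := eqVneq u 0; first by lia.
nia.
Qed.

End Lattices.

Local Open Scope classical_set_scope.
Local Open Scope ring_scope.

(** * Norms of equivalent ideals *)

Section IdealClasses.

Variables (p m : nat).
Hypotheses (p_pr : prime p) (pm : p.+1 = (4 * m)%N).
Local Notation elt := (elt p).
Local Notation nrm := (nrm m).
Local Notation valid := (valid m).
Local Notation idl := (idl p).
Local Notation cofac := (cofac m).
Local Notation ideal_form := (ideal_form m).

Lemma form_disc e a b : valid e a b ->
  (2 * b + 1)%N%:Z ^+ 2 - 4 * a%:Z * (cofac a b)%:Z = - p%:Z.
Proof.
move=> /cofacE ac; rewrite -mulrA ac PoszD PoszM.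
have -> : p%:Z = 4 * m%:Z - 1 by lia.
by ring.
Qed.

(** The discriminant is square-free, hence the form of an ideal is primitive. *)
Lemma form_primitive e a b : valid e a b -> exists k1 k2 k3 : int,
  k1 * a%:Z + k2 * (cofac a b)%:Z + k3 * (2 * b + 1)%N%:Z = 1.
Proof.
move=> V; have D := form_disc V.
set c := cofac a b in D *; set B := (2 * b + 1)%N in D *.
pose g := gcdn (gcdn a c) B.
have [ga gc gB] : [/\ (g %| a)%N, (g %| c)%N & (g %| B)%N].
  split; [|apply: dvdn_trans (dvdn_gcdl _ _) (dvdn_gcdr _ _) | exact: dvdn_gcdr].
  exact: dvdn_trans (dvdn_gcdl _ _) (dvdn_gcdl _ _).
have E : (4 * (a * c) = B ^ 2 + p)%N by move: D; lia.
have g2 : (g ^ 2 %| p)%N.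
  rewrite -(dvdn_addr _ (dvdn_exp2r 2 gB)) -E dvdn_mull // -mulnn.
  exact: dvdn_mul.
have g1 : g = 1%N.
  have : (g %| p)%N by apply: dvdn_trans g2; rewrite -{1}(expn1 g) dvdn_exp2l.
  move/(primeP p_pr).2 => /orP [/eqP //|/eqP gp].
  move: g2; rewrite gp => /dvdn_leq => /(_ (prime_gt0 p_pr)).
  move=> H; exfalso; move: H; rewrite leqNgt -{1}(expn1 p) ltn_exp2l ?prime_gt1 //.
have [u [v uv]] := Bezoutz a%:Z c%:Z.
have [s [t st]] := Bezoutz (gcdz a%:Z c%:Z) B%:Z.
exists (s * u), (s * v), t; rewrite -!mulrA -mulrDr uv st.
by rewrite /gcdz /= -/g g1.
Qed.

Lemma lattice_norm e a b u v : valid e a b ->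
  let x := elt (e%:Z * (a%:Z * u + b%:Z * v)) (e%:Z * v) in
  x * x^* = (e ^ 2 * a)%N%:R * (ideal_form a b u v)%:~R.
Proof.
move=> V /=; rewrite (elt_norm p_pr pm) (nrm_lattice _ _ V).
rewrite -[(e ^ 2 * a)%N%:R]/((e ^ 2 * a)%N%:Z%:~R) PoszM.
by rewrite -[(e ^ 2)%N%:Z]natz natrX natz !rmorphM.
Qed.

Lemma idl_norm e a b z : valid e a b -> idl e a b z ->
  exists q : int, z * z^* = (e ^ 2 * a)%N%:R * q%:~R.
Proof.
by move=> V [u [v ->]]; exists (ideal_form a b u v); apply: lattice_norm.
Qed.

(** The values of a primitive form at (1,0), (0,1) and (1,1) have greatest common divisor 1,
    so that a divisibility for the norms of all elements descends to the norm of the ideal. *)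
Lemma norm_transfer (al be : algC) e a b e' a' b' : valid e a b -> valid e' a' b' ->
  (forall x, idl e a b x -> exists2 y, idl e' a' b' y & al * x = be * y) ->
  exists q : int, al * al^* * (e ^ 2 * a)%N%:R = be * be^* * (e' ^ 2 * a')%N%:R * q%:~R.
Proof.
move=> V V' H.
have norm_of u v : exists q : int, al * al^* * ((e ^ 2 * a)%N%:R * (ideal_form a b u v)%:~R)
    = be * be^* * (e' ^ 2 * a')%N%:R * q%:~R.
  pose x := elt (e%:Z * (a%:Z * u + b%:Z * v)) (e%:Z * v).
  have xI : idl e a b x by exists u, v.
  have [y yI xy] := H x xI; have [q yq] := idl_norm V' yI.
  exists q; rewrite -[RHS]mulrA -yq -(lattice_norm u v V) -/x.
  have := congr1 (fun z => z * z^*) xy; rewrite /= !rmorphM /= => E.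
  by rewrite [LHS]mulrACA E mulrACA.
have [k1 [k2 [k3 K]]] := form_primitive V.
have [q1 H1] := norm_of 1 0; have [q2 H2] := norm_of 0 1; have [q3 H3] := norm_of 1 1.
exists ((k1 - k3) * q1 + (k2 - k3) * q2 + k3 * q3).
have -> : (e ^ 2 * a)%N%:R = (k1 - k3)%:~R * ((e ^ 2 * a)%N%:R * (ideal_form a b 1 0)%:~R)
   + (k2 - k3)%:~R * ((e ^ 2 * a)%N%:R * (ideal_form a b 0 1)%:~R)
   + k3%:~R * ((e ^ 2 * a)%N%:R * (ideal_form a b 1 1)%:~R) :> algC.
  have -> : ideal_form a b 1 0 = a%:Z by rewrite /ideal_form /qform; ring.
  have -> : ideal_form a b 0 1 = (cofac a b)%:Z by rewrite /ideal_form /qform; ring.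
  have -> : ideal_form a b 1 1 = a%:Z + (2 * b + 1)%N%:Z + (cofac a b)%:Z.
    by rewrite /ideal_form /qform; ring.
  have := congr1 (fun z : int => z%:~R : algC) K; rewrite /= !rmorphD !rmorphM /= => K'.
  by rewrite -[LHS]mulr1 -[X in _ * X = _]K' rmorphN /=; ring.
transitivity ((k1 - k3)%:~R * (al * al^* * ((e ^ 2 * a)%N%:R * (ideal_form a b 1 0)%:~R))
   + (k2 - k3)%:~R * (al * al^* * ((e ^ 2 * a)%N%:R * (ideal_form a b 0 1)%:~R))
   + k3%:~R * (al * al^* * ((e ^ 2 * a)%N%:R * (ideal_form a b 1 1)%:~R))); first by ring.
rewrite H1 H2 H3 !rmorphD !rmorphM /= !rmorphD !rmorphN /=.
by ring.
Qed.

Lemma norm_equal (al be : algC) e a b e' a' b' : valid e a b -> valid e' a' b' ->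
  al != 0 -> be != 0 ->
  [set al * x | x in idl e a b] = [set be * y | y in idl e' a' b'] ->
  al * al^* * (e ^ 2 * a)%N%:R = be * be^* * (e' ^ 2 * a')%N%:R.
Proof.
move=> V V' al0 be0 E.
have pos (c : algC) f d g : valid f d g -> c != 0 -> 0 < c * c^* * (f ^ 2 * d)%N%:R.
  case/and4P => f0 d0 _ _ c0; rewrite mulr_gt0 ?ltr0n ?muln_gt0 ?expn_gt0 ?f0 //.
  by rewrite -normCK exprn_gt0 // normr_gt0.
have P1 := pos _ _ _ _ V al0; have P2 := pos _ _ _ _ V' be0.
have [q Hq] : exists q : int, al * al^* * (e ^ 2 * a)%N%:R = be * be^* * (e' ^ 2 * a')%N%:R * q%:~R.
  apply: (norm_transfer V V') => x xI.
  have : [set al * x | x in idl e a b] (al * x) by exists x.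
  by rewrite E => -[y yI yx]; exists y.
have [r Hr] : exists q : int, be * be^* * (e' ^ 2 * a')%N%:R = al * al^* * (e ^ 2 * a)%N%:R * q%:~R.
  apply: (norm_transfer V' V) => x xI.
  have : [set be * x | x in idl e' a' b'] (be * x) by exists x.
  by rewrite -E => -[y yI yx]; exists y.
move: (al * al^* * _) (be * be^* * _) P1 P2 Hq Hr => X Y X0 Y0 XY YX.
have q0 : 0 < q by rewrite -(ltr0z algC) -(pmulr_rgt0 _ Y0) -XY.
have r0 : 0 < r by rewrite -(ltr0z algC) -(pmulr_rgt0 _ X0) -YX.
have : (r * q)%:~R = 1 :> algC.
  by apply: (mulfI (lt0r_neq0 X0)); rewrite rmorphM mulrA -YX -XY mulr1.
move=> /eqP; rewrite -[1]/(1%:~R) eqr_int => /eqP rq.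
have q1 : q = 1 by nia.
by rewrite XY q1 mulr1.
Qed.

(** * Elements of an ideal versus ideals in its class *)

Definition vec (a b : nat) (u v : int) : algC := elt (a%:Z * u + b%:Z * v) v.

Lemma vec_idl a b u v : idl 1 a b (vec a b u v).
Proof. by exists u, v; rewrite /vec !mul1r. Qed.

Lemma idl1P a b z : idl 1 a b z <-> exists u v, z = vec a b u v.
Proof. by split=> [[u [v ->]]|[u [v ->]]]; exists u, v; rewrite /vec !mul1r. Qed.

Lemma vec_norm a b u v : valid 1 a b ->
  vec a b u v * (vec a b u v)^* = a%:R * (ideal_form a b u v)%:~R.
Proof.
move=> V; have := nrm_lattice u v V; rewrite (_ : 1%N%:Z ^+ 2 = 1) // !mul1r => E.
by rewrite (elt_norm p_pr pm) E rmorphM.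
Qed.

Lemma vecN a b u v : vec a b (- u) (- v) = - vec a b u v.
Proof. by rewrite /vec eltN; congr elt; ring. Qed.

Lemma vec_eq0 a b u v : (0 < a)%N -> vec a b u v = 0 -> u = 0 /\ v = 0.
Proof.
move=> a0; rewrite -[0]/(0%:~R) -(elt_int p) => /(elt_inj p_pr) [E v0].
by split=> //; move: E; rewrite v0; nia.
Qed.

Lemma vec_inj a b u v u' v' : (0 < a)%N -> vec a b u v = vec a b u' v' -> u = u' /\ v = v'.
Proof.
move=> a0 /(elt_inj p_pr) [E vv]; split=> //; move: E; rewrite vv => /addIr E.
by apply: (mulfI _ E); lia.
Qed.

Lemma idl_conj_mul a b x y : valid 1 a b -> idl 1 a b x -> idl 1 a b y ->
  exists s t, x^* * y = a%:R * elt s t.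
Proof.
move=> V /idl1P [u [v ->]] /idl1P [u' [v' ->]].
have ac := cofacE V.
exists (a%:Z * u * u' + u * v' * b%:Z + u' * v * (b%:Z + 1) + v * v' * (cofac a b)%:Z), (u * v' - u' * v).
rewrite -[a%:R]/(a%:Z%:~R) -(elt_int p) /vec (conj_elt p_pr) !(eltM pm).
have -> : m%:Z = a%:Z * (cofac a b)%:Z - b%:Z ^+ 2 - b%:Z by rewrite ac; ring.
by congr elt; ring.
Qed.

(** The product of an ideal with its conjugate is generated by its norm. *)
Lemma conj_span a b : valid 1 a b -> exists k1 k2 k3 : int,
  let x := vec a b 1 0 in let y := vec a b 0 1 in
  a%:R = k1%:~R * (x^* * x) + k2%:~R * (y^* * y) + k3%:~R * (x^* * y + y^* * x).
Proof.
move=> V; have [k1 [k2 [k3 K]]] := form_primitive V; have ac := cofacE V.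
exists k1, k2, k3 => /=.
rewrite -[a%:R]/(a%:Z%:~R) -!(elt_int p) /vec !(conj_elt p_pr) !(eltM pm) !eltD !(eltM pm) !eltD.
have -> : m%:Z = a%:Z * (cofac a b)%:Z - b%:Z ^+ 2 - b%:Z by rewrite ac; ring.
congr elt; last by ring.
transitivity (a%:Z * (k1 * a%:Z + k2 * (cofac a b)%:Z + k3 * (2 * b + 1)%N%:Z)).
  by rewrite K mulr1.
by rewrite PoszD PoszM; ring.
Qed.

Lemma idl_nonzero e a b : valid e a b -> exists2 z, idl e a b z & z != 0.
Proof.
case/and4P => e0 a0 _ _; exists (e * a)%N%:R; first exact: idl_gen.
by rewrite pnatr_eq0 -lt0n muln_gt0 e0.
Qed.

(** By [conj_span], a gamma lies in conj(I) (gamma I), which is contained in the ideal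
    conj(I) if gamma I consists of integers. *)
Lemma conj_mem a b (ga : algC) : valid 1 a b ->
  (forall x, idl 1 a b x -> exists s t, ga * x = elt s t) ->
  exists u v, a%:R * ga = (vec a b u v)^*.
Proof.
move=> V H; have [k1 [k2 [k3 /= E]]] := conj_span V.
set x := vec a b 1 0 in E; set y := vec a b 0 1 in E.
have [s [t xE]] := H x (vec_idl _ _ _ _); have [s' [t' yE]] := H y (vec_idl _ _ _ _).
have xI : idl 1 a b x by apply: vec_idl.
have yI : idl 1 a b y by apply: vec_idl.
have /idl1P [u [v uv]] : idl 1 a b (elt k1 0 * (elt (s + t) (- t) * x) + elt k2 0 * (elt (s' + t') (- t') * y)
   + (elt k3 0 * (elt (s' + t') (- t') * x) + elt k3 0 * (elt (s + t) (- t) * y))).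
  have M s0 t0 z : idl 1 a b z -> idl 1 a b (elt s0 t0 * z) by apply: (idlM pm).
  by apply: idlD; apply: idlD; apply: (M); apply: (M).
have cj (z : algC) k s0 t0 : (elt k 0 * (elt (s0 + t0) (- t0) * z))^* = k%:~R * (elt s0 t0 * z^*).
  by rewrite rmorphM /= [(_ * z)^*]rmorphM /= !(conj_elt p_pr) addrK opprK oppr0 addr0 elt_int.
exists u, v; rewrite -uv [RHS]rmorphD /= [X in _ = X + _]rmorphD /= [X in _ = _ + X]rmorphD /= !cj -xE -yE.
by rewrite {1}E; ring.
Qed.

(** The order is maximal: I conj(I) = (a), hence the multipliers of I are integers. *)
Lemma multiplier_integral a b (ga : algC) : valid 1 a b ->
  (forall x, idl 1 a b x -> idl 1 a b (ga * x)) -> exists s t, ga = elt s t.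
Proof.
move=> V H; have [k1 [k2 [k3 /= E]]] := conj_span V.
set x := vec a b 1 0 in E; set y := vec a b 0 1 in E.
have xI : idl 1 a b x by apply: vec_idl.
have yI : idl 1 a b y by apply: vec_idl.
have [s1 [t1 E1]] := idl_conj_mul V xI (H _ xI).
have [s2 [t2 E2]] := idl_conj_mul V yI (H _ yI).
have [s3 [t3 E3]] := idl_conj_mul V xI (H _ yI).
have [s4 [t4 E4]] := idl_conj_mul V yI (H _ xI).
have a0 : a%:R != 0 :> algC by case/and4P: V => _ a0 _ _; rewrite pnatr_eq0 -lt0n.
have : ga = elt k1 0 * elt s1 t1 + elt k2 0 * elt s2 t2 + elt k3 0 * (elt s3 t3 + elt s4 t4).
  apply: (mulfI a0); rewrite !(elt_int p).
  transitivity (k1%:~R * (a%:R * elt s1 t1) + k2%:~R * (a%:R * elt s2 t2)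
     + k3%:~R * (a%:R * elt s3 t3 + a%:R * elt s4 t4)); last by ring.
  by rewrite -E1 -E2 -E3 -E4 {1}E; ring.
by rewrite !(eltD, eltM pm) => ->; eexists; eexists.
Qed.

(** For alpha = a u + (b + omega) v in I = (a, b + omega), the ideal J = (e', a', b') is
    (conj alpha / a) I. *)
Definition link (a b e' a' b' : nat) (u v : int) : Prop :=
  [set (vec a b u v)^* * x | x in idl 1 a b] = [set a%:R * y | y in idl e' a' b'].

Lemma link_neq0 a b e' a' b' u v : valid 1 a b -> valid e' a' b' ->
  link a b e' a' b' u v -> vec a b u v != 0.
Proof.
move=> /and4P [_ a0 _ _] V' L; apply/eqP => z0.
have [y yI y0] := idl_nonzero V'.
have : [set a%:R * y | y in idl e' a' b'] (a%:R * y) by exists y.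
rewrite -L z0 conjC0 => -[x _]; rewrite mul0r => /esym/eqP.
by rewrite mulf_eq0 (negbTE y0) pnatr_eq0 orbF eqn0Ngt a0.
Qed.

Lemma link_norm a b e' a' b' u v : valid 1 a b -> valid e' a' b' ->
  link a b e' a' b' u v -> (e' ^ 2 * a')%N%:Z = ideal_form a b u v.
Proof.
move=> V V' L; have al0 := link_neq0 V V' L.
have a0 : a%:R != 0 :> algC by case/and4P: V => _ a0 _ _; rewrite pnatr_eq0 -lt0n.
have al0' : (vec a b u v)^* != 0 by rewrite conjC_eq0.
have := norm_equal V V' al0' a0 L; rewrite conjCK mulrC conjC_nat.
rewrite [_^* * _]mulrC vec_norm // exp1n mul1n => E.
have E2 : a%:R * a%:R * (ideal_form a b u v)%:~R = a%:R * a%:R * (e' ^ 2 * a')%N%:R :> algC.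
  by rewrite -E; ring.
have aa : a%:R * a%:R != 0 :> algC by rewrite mulf_neq0.
by have := mulfI aa E2 => /eqP; rewrite -[(_ * _)%:R]/((e' ^ 2 * a')%N%:Z%:~R) eqr_int => /eqP.
Qed.

(** Multiplication by [conj alpha / a] maps the ideal onto an ideal of norm
    [N(alpha) / a] in the same class. *)
Lemma link_exists a b u v : valid 1 a b -> (u, v) <> (0, 0) ->
  exists e' a' b', valid e' a' b' /\ link a b e' a' b' u v.
Proof.
move=> V uv0; set al := vec a b u v.
have a0 : a%:R != 0 :> algC by case/and4P: V => _ a0 _ _; rewrite pnatr_eq0 -lt0n.
have al0 : al != 0.
  apply/eqP => /vec_eq0 [|u0 v0]; first by case/and4P: V.
  by apply: uv0; rewrite u0 v0.
pose J : set algC := fun z => exists2 x, idl 1 a b x & a%:R * z = al^* * x.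
have [||y z|x y z||e' [a' [b' [V' HJ]]]] := @ideal_classification p m p_pr pm J.
- move=> z [x xI zE]; have [s [t E]] := idl_conj_mul V (vec_idl a b u v) xI.
  by exists s, t; apply: (mulfI a0); rewrite zE E.
- by exists 0; [exact: idl0 | rewrite !mulr0].
- move=> [x xI zE] [x' xI' zE']; exists (x + x'); first exact: idlD.
  by rewrite !mulrDr zE zE'.
- move=> [x' xI' zE]; exists (elt x y * x'); first exact: (idlM pm).
  by rewrite mulrCA zE mulrCA.
- exists (al^*); last by rewrite conjC_eq0.
  by exists a%:R; [have := idl_gen p 1 a b; rewrite mul1n | rewrite mulrC].
exists e', a', b'; split=> //; apply/predeqP => z; split.
  move=> [x xI <-]; have /HJ yI : J (al^* * x / a%:R) by exists x; rewrite // mulrC divfK.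
  by exists (al^* * x / a%:R) => //; rewrite mulrC divfK.
by move=> [y /HJ [x xI yE] <-]; exists x.
Qed.

Lemma link_opp a b e' a' b' u v : valid 1 a b ->
  link a b e' a' b' u v -> link a b e' a' b' (- u) (- v).
Proof.
rewrite /link => V <-; rewrite vecN rmorphN /=; apply/predeqP => z; split => -[x xI <-].
  by exists (- x); [exact: (idlN pm) | rewrite mulrN mulNr].
by exists (- x); [exact: (idlN pm) | rewrite mulrNN].
Qed.

Hypothesis p_gt3 : (3 < p)%N.

(** Two elements leading to the same ideal differ by a unit. *)
Lemma link_unique a b e' a' b' u v u' v' : valid 1 a b -> valid e' a' b' ->
  link a b e' a' b' u v -> link a b e' a' b' u' v' ->
  (u', v') = (u, v) \/ (u', v') = (- u, - v).
Proof.
move=> V V' L L'; have al0 := link_neq0 V V' L; have al0' := link_neq0 V V' L'.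
have ag : (0 < a)%N by case/and4P: V.
have a0 : a%:R != 0 :> algC by rewrite pnatr_eq0 -lt0n.
have N := link_norm V V' L; have N' := link_norm V V' L'.
set al := vec a b u v in al0; set al' := vec a b u' v' in al0'.
have c0 : al^* != 0 by rewrite conjC_eq0.
pose ep := al'^* / al^*.
have [x|s [t ep_st]] := @multiplier_integral a b ep V.
  move=> xI; have : [set al'^* * x | x in idl 1 a b] (al'^* * x) by exists x.
  rewrite L' -L => -[y yI yx]; suff -> : ep * x = y by [].
  by apply: (mulfI c0); rewrite yx /ep mulrA [al^* * _]mulrC divfK.
have ep1 : nrm s t = 1.
  apply: (@intr_inj algC); rewrite -(elt_norm p_pr pm) -ep_st /ep.
  have E : al' * al'^* = al * al^* by rewrite !vec_norm // -N -N'.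
  have -> : (al'^* / al^*)^* = al' / al by rewrite rmorphM fmorphV /= !conjCK.
  have -> : al'^* / al^* * (al' / al) = (al' * al'^*) / (al * al^*) by field; rewrite c0.
  by rewrite E divff // mulf_neq0.
have [t0 s1] := nrm_eq1 p_pr pm p_gt3 ep1.
have E : al'^* = ep * al^* by rewrite /ep divfK.
have E' : al' = ep^* * al by rewrite -[al']conjCK E rmorphM /= conjCK.
move: E'; rewrite ep_st t0 elt_int rmorph_int; case: s1 => ->; rewrite /al /al'.
  by rewrite mul1r => /(vec_inj ag) [-> ->]; left.
by rewrite rmorphN1 mulN1r -vecN => /(vec_inj ag) [-> ->]; right.
Qed.

Local Notation K := (quadratic_field (- p%:Z)).

Lemma elt_ring s t : ring_of_integers K (elt s t).
Proof. by apply/(ring_of_integersE p_pr pm); exists s, t. Qed.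

Lemma link_equiv a b e' a' b' u v : valid 1 a b -> valid e' a' b' ->
  link a b e' a' b' u v -> ideal_equiv K (idl 1 a b) (idl e' a' b').
Proof.
move=> V V' L; have al0 := link_neq0 V V' L.
exists (vec a b u v)^*, a%:R; split=> //.
- by rewrite /vec (conj_elt p_pr); apply: elt_ring.
- by rewrite -[a%:R]/(a%:Z%:~R) -(elt_int p); apply: elt_ring.
- by rewrite conjC_eq0.
- by case/and4P: V => _ a0 _ _; rewrite pnatr_eq0 -lt0n.
Qed.

Lemma equiv_link a b e' a' b' : valid 1 a b -> valid e' a' b' ->
  ideal_equiv K (idl 1 a b) (idl e' a' b') -> exists u v, link a b e' a' b' u v.
Proof.
move=> V V' [be [de [_ _ be0 de0 E]]].
have [x xI|u [v uv]] := @conj_mem a b (be / de) V.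
  have : [set be * x | x in idl 1 a b] (be * x) by exists x.
  rewrite E => -[y yI yx]; have [s [t yE]] := idl_elt yI; exists s, t.
  by rewrite -yE mulrAC -yx mulrAC divff // mul1r.
exists u, v; rewrite /link -uv; apply/predeqP => z; split.
  move=> [x xI <-]; have : [set be * x | x in idl 1 a b] (be * x) by exists x.
  rewrite E => -[y yI yx]; exists y => //.
  by rewrite -mulrA; congr (_ * _); rewrite mulrAC -yx mulrAC divff // mul1r.
move=> [y yI <-]; have : [set de * x | x in idl e' a' b'] (de * y) by exists y.
rewrite -E => -[x xI xy]; exists x => //.
by rewrite -mulrA; congr (_ * _); rewrite mulrAC xy mulrAC divff // mul1r.
Qed.

End IdealClasses.

(** * Representatives of the ideal classes *)

Section ClassCount.

Variables (p m : nat).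
Hypotheses (p_pr : prime p) (pm : p.+1 = (4 * m)%N).
Local Notation elt := (elt p).
Local Notation valid := (valid m).
Local Notation idl := (idl p).
Local Notation cofac := (cofac m).
Local Notation ideal_form := (ideal_form m).
Local Notation K := (quadratic_field (- p%:Z)).
Local Notation ringP := (ring_of_integersE p_pr pm).

Lemma idl_nonzero_ideal e a b : valid e a b -> nonzero_ideal K (idl e a b).
Proof.
move=> V; split.
- by move=> z /idl_elt H; apply/ringP.
- exact: idl0.
- by move=> x y; apply: idlD.
- by move=> r x /ringP [s [t ->]]; apply: (idlM pm).
- by have [z] := idl_nonzero p V; exists z.
Qed.

Lemma nonzero_ideal_idl I : nonzero_ideal K I ->
  exists e a b, valid e a b /\ I = idl e a b.
Proof.
case=> IO I0 ID IM [z Iz z0].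
have [||y w|x y w||e [a [b [V H]]]] := @ideal_classification p m p_pr pm I.
- by move=> w /IO /ringP.
- exact: I0.
- exact: ID.
- by move=> Iw; apply: IM Iw; apply: (elt_ring p_pr pm).
- by exists z.
by exists e, a, b; split=> //; apply/predeqP.
Qed.

Lemma ideal_equiv_refl I : ideal_equiv K I I.
Proof.
have r1 : ring_of_integers K 1 by rewrite -[1]/(1%:~R) -(elt_int p); apply: (elt_ring p_pr pm).
by exists 1, 1; split=> //; exact: oner_neq0.
Qed.

Lemma ideal_equiv_sym I J : ideal_equiv K I J -> ideal_equiv K J I.
Proof. by case=> a [b [Ra Rb a0 b0 E]]; exists b, a; split. Qed.

Lemma ideal_equiv_trans I J L : ideal_equiv K I J -> ideal_equiv K J L -> ideal_equiv K I L.
Proof.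
case=> a [b [Ra Rb a0 b0 E]] [c [d [Rc Rd c0 d0 E']]].
have RM x y : ring_of_integers K x -> ring_of_integers K y -> ring_of_integers K (x * y).
  move=> /ringP [s [t ->]] /ringP [s' [t' ->]]; rewrite (eltM pm); exact: (elt_ring p_pr pm).
exists (a * c), (b * d); split; rewrite ?mulf_neq0 //; [exact: RM | exact: RM | ].
apply/predeqP => z; split.
  case=> x Ix <-; have : [set b * x | x in J] (a * x) by rewrite -E; exists x.
  case=> y Jy yx; have : [set d * x | x in L] (c * y) by rewrite -E'; exists y.
  case=> l Ll ly; exists l => //.
  have -> : b * d * l = b * (d * l) by ring.
  have -> : a * c * x = a * x * c by ring.
  by rewrite ly -yx; ring.
case=> l Ll <-; have : [set c * x | x in J] (d * l) by rewrite E'; exists l.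
case=> y Jy yl; have : [set a * x | x in I] (b * y) by rewrite E; exists y.
case=> x Ix xy; exists x => //.
have -> : a * c * x = a * x * c by ring.
have -> : b * d * l = b * (d * l) by ring.
by rewrite xy -yl; ring.
Qed.

Lemma ideal_class_eq I J : nonzero_ideal K J ->
  ideal_class K I = ideal_class K J <-> ideal_equiv K I J.
Proof.
move=> NJ; split.
  move=> E; have : ideal_class K J J by split=> //; apply: ideal_equiv_refl.
  by rewrite -E => -[].
move=> IJ; apply/predeqP => L; split=> -[NL H]; split=> //.
  exact: ideal_equiv_trans (ideal_equiv_sym IJ) H.
exact: ideal_equiv_trans IJ H.
Qed.

Lemma equiv_scale e a b : valid e a b -> ideal_equiv K (idl e a b) (idl 1 a b).
Proof.
move=> /and4P [e0 a0 _ _]; exists 1, e%:R; split.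
- by rewrite -[1]/(1%:~R) -(elt_int p); apply: (elt_ring p_pr pm).
- by rewrite -[e%:R]/(e%:Z%:~R) -(elt_int p); apply: (elt_ring p_pr pm).
- exact: oner_neq0.
- by rewrite pnatr_eq0 -lt0n.
have scale u v : e%:R * vec p a b u v = elt (e%:Z * (a%:Z * u + b%:Z * v)) (e%:Z * v).
  rewrite -[e%:R]/(e%:Z%:~R) -(elt_int p) /vec (eltM pm); congr elt; ring.
apply/predeqP => z; split.
  case=> x [u [v ->]] <-; exists (vec p a b u v); first exact: vec_idl.
  by rewrite scale mul1r.
case=> x /idl1P [u [v ->]] <-; rewrite scale.
by eexists; last exact: mul1r; exists u, v.
Qed.

Lemma valid1 e a b : valid e a b -> valid 1 a b.
Proof. by case/and4P => _ a0 ba ab; rewrite /valid a0 ba ab. Qed.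

(** Every class contains an ideal of norm at most p: otherwise a shortest translate of
    [b + omega] leads to an ideal of smaller norm. *)
Lemma reduction a b : valid 1 a b ->
  exists a' b', [/\ valid 1 a' b', (a' <= p)%N & ideal_equiv K (idl 1 a b) (idl 1 a' b')].
Proof.
elim/ltn_ind: a b => a IH b V; have [ap|pa] := leqP a p.
  by exists a, b; split=> //; apply: ideal_equiv_refl.
have /and4P [_ a0 ba _] := V.
pose u : int := if (2 * b + 1 <= a)%N then 0 else -1.
have [e' [a' [b' [V' L]]]] : exists e' a' b', valid e' a' b' /\ link p a b e' a' b' u 1.
  by apply: (link_exists p_pr pm V) => -[].
have N := link_norm p_pr pm V V' L.
have E1 := link_equiv p_pr pm V V' L; have E2 := equiv_scale V'.
have /and4P [e0' a0' _ _] := V'.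
have aa : (a' < a)%N.
  have D := form_disc p_pr pm V.
  have : 4 * a%:Z * ideal_form a b u 1 = (2 * a%:Z * u + (2 * b + 1)%N%:Z) ^+ 2 + p%:Z.
    rewrite -[p%:Z]opprK -D /ideal_form /qform; ring.
  have : (2 * a%:Z * u + (2 * b + 1)%N%:Z) ^+ 2 <= a%:Z ^+ 2.
    have : `|2 * a%:Z * u + (2 * b + 1)%N%:Z| <= a%:Z by rewrite /u; case: ifP => h; lia.
    by rewrite -[X in _ -> X <= _]real_normK ?num_real // => h; rewrite lerXn2r ?nnegrE.
  rewrite -N; move: (_ ^+ 2) => X XA H.
  have : a'%:Z <= (e' ^ 2 * a')%N%:Z by rewrite lez_nat leq_pmull // expn_gt0 e0'.
  move: (e' ^ 2 * a')%N H XA => Y H XA aY.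
  have : 4 * a%:Z * Y%:Z < a%:Z * (a%:Z + 1) by nia.
  by nia.
have [a2 [b2 [V2 ap2 E3]]] := IH a' aa b' (valid1 V').
exists a2, b2; split=> //; apply: ideal_equiv_trans E3.
exact: ideal_equiv_trans E1 E2.
Qed.

Definition pair_class (s : nat * nat) : set (set algC) := ideal_class K (idl 1 s.1 s.2).

Definition reduced_pairs : seq (nat * nat) :=
  [seq s <- [seq (a, b) | a <- iota 0 p.+1, b <- iota 0 p.+1] | valid 1 s.1 s.2].

Lemma reduced_pairsP a b : valid 1 a b -> (a <= p)%N -> (a, b) \in reduced_pairs.
Proof.
move=> V ap; rewrite mem_filter; apply/andP; split=> //; apply/allpairsP; exists (a, b).
by rewrite !mem_iota /= !add0n !ltnS; have /and4P [_ _ ba _] := V; split=> //; lia.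
Qed.

Definition classes : seq (set (set algC)) := undup [seq pair_class s | s <- reduced_pairs].

Definition pick_pair (c : set (set algC)) : nat * nat :=
  nth (0%N, 0%N) reduced_pairs (index c [seq pair_class s | s <- reduced_pairs]).

Lemma pick_pairP c : c \in classes -> pick_pair c \in reduced_pairs /\ pair_class (pick_pair c) = c.
Proof.
rewrite mem_undup => cR; have := cR; rewrite -index_mem size_map => lt; split.
  exact: mem_nth.
by rewrite -(nth_map _ (pair_class (0%N, 0%N)) pair_class) // nth_index.
Qed.

Definition representatives : seq (nat * nat) := [seq pick_pair c | c <- classes].

Lemma representatives_valid s : s \in representatives -> valid 1 s.1 s.2.
Proof. by case/mapP => c /pick_pairP [+ _] ->; rewrite mem_filter => /andP []. Qed.

Lemma representatives_classes : [seq pair_class s | s <- representatives] = classes.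
Proof.
rewrite -map_comp -[RHS]map_id; apply/eq_in_map => c /pick_pairP [_ /= E]; exact: E.
Qed.

Lemma class_in_classes e a b : valid e a b -> ideal_class K (idl e a b) \in classes.
Proof.
move=> V; have [a' [b' [V' ap E]]] := reduction (valid1 V).
rewrite mem_undup; apply/mapP; exists (a', b'); first exact: reduced_pairsP.
apply/ideal_class_eq; first exact: idl_nonzero_ideal.
exact: ideal_equiv_trans (equiv_scale V) E.
Qed.

Lemma class_number_size : h (- p%:Z) = size representatives.
Proof.
rewrite /h /class_number size_map.
have -> : [set ideal_class K I | I in nonzero_ideal K] = [set` [fset c in classes]%fset].
  apply/predeqP => c /=; split.
    by move=> [I /nonzero_ideal_idl [e [a [b [V ->]]]] <-]; rewrite inE class_in_classes.
  rewrite inE /= => cC; have [/[dup] sR] := pick_pairP cC; rewrite mem_filter => /andP [V _] E.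
  by exists (idl 1 (pick_pair c).1 (pick_pair c).2); [exact: idl_nonzero_ideal | exact: E].
by rewrite set_fsetK card_fseq undup_id // undup_uniq.
Qed.

Lemma sum_representatives e a b : valid e a b ->
  \sum_(s <- representatives) (`[< pair_class s = ideal_class K (idl e a b) >]%:R : int) = 1.
Proof.
move=> V; have cC := class_in_classes V; set c := ideal_class _ _ in cC *.
have -> : \sum_(s <- representatives) (`[< pair_class s = c >]%:R : int) =
    \sum_(d <- [seq pair_class s | s <- representatives]) ((d == c)%:R : int).
  rewrite [RHS]big_map; apply: eq_bigr => s _;
  by rewrite (_ : `[< pair_class s = c >] = (pair_class s == c)) //; apply/asboolP/eqP.
rewrite representatives_classes (bigD1_seq c) ?undup_uniq //= eqxx big1 ?addr0 // => d dc.
by rewrite (negbTE dc).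
Qed.

End ClassCount.

(** * Dirichlet's class number formula *)

Lemma sum_box_point (L : nat) (u v : int) : `|u| < L%:Z -> `|v| < L%:Z ->
  \sum_(i < 2 * L) \sum_(j < 2 * L)
     (((i%:Z - L%:Z == u) && (j%:Z - L%:Z == v))%:R : int) = 1.
Proof.
move=> uL vL.
have [i0 [iL iE]] : exists i0 : nat, (i0 < 2 * L)%N /\ i0%:Z - L%:Z = u.
  by exists (absz (u + L%:Z)); lia.
have [j0 [jL jE]] : exists j0 : nat, (j0 < 2 * L)%N /\ j0%:Z - L%:Z = v.
  by exists (absz (v + L%:Z)); lia.
rewrite (bigD1 (Ordinal iL)) //= (bigD1 (Ordinal jL)) //= iE jE !eqxx /=.
rewrite big1 => [|j jn]; last first.
  by case: eqP => // jv; move: jn; rewrite -val_eqE /=; lia.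
rewrite big1 ?addr0 // => i ine; rewrite big1 // => j _.
by case: eqP => // iu; move: ine; rewrite -val_eqE /=; lia.
Qed.

(** The ideals of norm n + 1, listed as triples (e, a, b) with e^2 a = n + 1. *)
Lemma sum_over_triples (m N : nat) (F : int -> int) :
  (forall n, N%:Z <= n -> F n = 0) ->
  \sum_(e < N) \sum_(a < N) \sum_(b < N | valid m e a b) F (e ^ 2 * a)%N%:Z =
  \sum_(n < N) rep m n.+1 * F n.+1%:Z.
Proof.
move=> FN.
transitivity (\sum_(e < N) \sum_(a < N) \sum_(n < N) (e ^ 2 * a == n.+1)%N%:R * rho m a * F n.+1%:Z).
  apply: eq_bigr => e _; apply: eq_bigr => a _.
  have [ea0|ea0] := posnP (e ^ 2 * a)%N.
    rewrite big1 => [|b /and4P [e0 a0 _ _]]; last by move/eqP: ea0; rewrite muln_eq0 expn_eq0; lia.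
    by rewrite big1 // => n _; rewrite ea0 mul0r mul0r.
  have [e0 a0] : (0 < e)%N /\ (0 < a)%N.
    by move: ea0; rewrite muln_gt0 expn_gt0 orbF => /andP [].
  have -> : \sum_(b < N | valid m e a b) F (e ^ 2 * a)%N%:Z = rho m a * F (e ^ 2 * a)%N%:Z.
    rewrite /rho mulr_suml (big_ord_widen N (fun b => (a %| quad m b)%N%:R * F (e ^ 2 * a)%N%:Z)); last exact: ltnW.
    rewrite big_mkcond [RHS]big_mkcond /=; apply: eq_bigr => b _.
    rewrite /valid e0 a0 /=; case: (b < a)%N => //=.
    by case: (_ %| _)%N; rewrite ?mul1r ?mul0r.
  have [eaN|Nea] := leqP (e ^ 2 * a)%N N.
    have lt : ((e ^ 2 * a).-1 < N)%N by rewrite prednK.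
    rewrite (bigD1 (Ordinal lt)) //= prednK // eqxx mul1r big1 ?addr0 // => n nn.
    case: eqP => [E|]; last by rewrite !mul0r.
    by move: nn; rewrite -val_eqE /= E /= eqxx.
  rewrite FN ?mulr0; last by lia.
  rewrite big1 // => n _; case: eqP => [E|]; last by rewrite !mul0r.
  by have := ltn_ord n; lia.
under eq_bigr => e _ do rewrite exchange_big /=.
rewrite exchange_big /=; apply: eq_bigr => n _.
have [nN|Nn] := ltnP n.+1 N; last first.
  rewrite FN ?mulr0; last by lia.
  by rewrite big1 // => e _; rewrite big1 // => a _; rewrite mulr0.
under eq_bigr => e _ do rewrite -mulr_suml.
rewrite -mulr_suml; congr (_ * _).
rewrite /rep /dconv.
transitivity (\sum_(d <- divisors n.+1) \sum_(e < N) (e ^ 2 == d)%N%:R * rho m (n.+1 %/ d)); last first.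
  rewrite big_seq [RHS]big_seq; apply: eq_bigr => d; rewrite -dvdn_divisors // => dn.
  rewrite -mulr_suml; congr (_ * _); have dN : (d < N)%N by apply: leq_ltn_trans nN; apply: dvdn_leq.
  case: is_squareP => [[e ed]|nsq]; last first.
    by rewrite big1 // => e _; case: eqP => // ed; case: nsq; exists e.
  have d0 := dvdn_gt0 (ltn0Sn n) dn.
  have eN : (e < N)%N by apply: leq_ltn_trans dN; rewrite -ed -mulnn; case: e {ed} => // e; rewrite leq_pmulr.
  rewrite (bigD1 (Ordinal eN)) //= ed eqxx big1 ?addr0 // => f fe; case: eqP => // fd.
  by move: fe; rewrite -val_eqE /= -(eqn_exp2r _ _ (ltn0Sn 1)) fd ed eqxx.
rewrite [RHS]exchange_big /=; apply: eq_bigr => e _.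
case: (boolP (e ^ 2 %| n.+1)%N) => [en|nen]; last first.
  rewrite big1 => [|a _]; last first.
    by case: eqP => [E|]; rewrite ?mul0r //; move: nen; rewrite -E dvdn_mulr.
  rewrite big_seq big1 // => d; rewrite -dvdn_divisors // => dn.
  by case: eqP => [E|]; rewrite ?mul0r //; move: nen; rewrite E dn.
have e20 := dvdn_gt0 (ltn0Sn n) en.
rewrite (bigD1_seq (e ^ 2)%N) ?divisors_uniq -?dvdn_divisors //= eqxx mul1r.
rewrite [X in _ = _ + X]big1 ?addr0 => [|d de]; last by rewrite eq_sym (negbTE de) mul0r.
have aN : (n.+1 %/ e ^ 2 < N)%N by apply: leq_ltn_trans nN; apply: leq_div.
rewrite (bigD1 (Ordinal aN)) //= mulnC divnK // eqxx mul1r big1 ?addr0 // => a an.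
case: eqP => [E|]; rewrite ?mul0r //; move: an.
by rewrite -val_eqE /= -E mulKn // eqxx.
Qed.

Section ClassNumberFormula.

Variables (p m : nat).
Hypotheses (p_pr : prime p) (pm : p.+1 = (4 * m)%N) (p_gt3 : (3 < p)%N).
Local Notation valid := (valid m).
Local Notation idl := (idl p).
Local Notation cofac := (cofac m).
Local Notation ideal_form := (ideal_form m).
Local Notation K := (quadratic_field (- p%:Z)).

Lemma form_pos e a b : valid e a b ->
  [/\ (0 < a)%N, (0 < cofac a b)%N & (2 * b + 1)%N%:Z ^+ 2 < 4 * a%:Z * (cofac a b)%:Z].
Proof.
move=> V; have D := form_disc p_pr pm V; have /and4P [_ a0 _ _] := V.
have p0 := prime_gt0 p_pr.
split=> //; last by lia.
rewrite lt0n; apply/eqP => c0; move: D; rewrite c0 mulr0 subr0 => D.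
by have := sqr_ge0 ((2 * b + 1)%N%:Z : int); rewrite D; lia.
Qed.

(** Both coordinates are bounded by completing the square in the one or the other. *)
Lemma form_small (a b M L : nat) u v : valid 1 a b -> (0 < M)%N ->
  ((a + cofac a b + 1) * M <= L)%N ->
  ideal_form a b u v < (M ^ 2)%N%:Z -> `|u| < L%:Z /\ `|v| < L%:Z.
Proof.
move=> V M0 ML QM; have [a0 c0 pd] := form_pos V.
have b1 := qform_lower a0 c0 pd u v.
have b2 : v ^+ 2 <= 4 * a%:Z * ideal_form a b u v.
  have pd' : (2 * b + 1)%N%:Z ^+ 2 < 4 * (cofac a b)%:Z * a%:Z by rewrite -mulrA [_ * a%:Z]mulrC mulrA.
  have := qform_lower c0 a0 pd' v u; congr (_ <= _ * _).
  by rewrite /ideal_form /qform; ring.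
have MM : (M ^ 2)%N%:Z = M%:Z ^+ 2 by rewrite -[LHS]natz natrX natz.
have bound (c : nat) (x : int) : (0 < c)%N -> x ^+ 2 <= 4 * c%:Z * ideal_form a b u v ->
    ((c + 1) * M <= L)%N -> `|x| < L%:Z.
  move=> cc xc cL; apply: lt_le_trans (_ : ((c + 1) * M)%N%:Z <= _); last by lia.
  rewrite ltNge; apply/negP => h.
  have : ((c + 1) * M)%N%:Z ^+ 2 <= x ^+ 2 by rewrite -[x ^+ 2]real_normK ?num_real // lerXn2r ?nnegrE.
  have h1 : 4 * c%:Z * ideal_form a b u v < 4 * c%:Z * M%:Z ^+ 2 by rewrite ltr_pM2l -?MM //; lia.
  have h2 : 4 * c%:Z * M%:Z ^+ 2 <= ((c + 1) * M)%N%:Z ^+ 2.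
    rewrite PoszM exprMn ler_wpM2r ?sqr_ge0 // PoszD.
    have := sqr_ge0 (c%:Z - 1); rewrite -subr_ge0 -[X in _ -> 0 <= X](_ : (c%:Z - 1) ^+ 2 = _) //; ring.
  by lia.
by split; [apply: (bound (cofac a b)) | apply: (bound a)] => //; nia.
Qed.

(** Sort the lattice vectors by the ideal they are linked to: the zero vector gives
    [F 0], and every ideal in the class of [(a, b + omega)] is hit by exactly two
    opposite vectors. *)
Lemma box_class_sum (a b M L : nat) (F : int -> int) : valid 1 a b -> (0 < M)%N ->
  ((a + cofac a b + 1) * M <= L)%N -> (forall n, (M ^ 2)%N%:Z <= n -> F n = 0) ->
  box L (fun u v => F (ideal_form a b u v)) =
  F 0 + \sum_(e' < M ^ 2) \sum_(a' < M ^ 2) \sum_(b' < M ^ 2 | valid e' a' b')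
     2 * `[< pair_class p (a, b) = ideal_class K (idl e' a' b') >]%:R * F (e' ^ 2 * a')%N%:Z.
Proof.
move=> V M0 ML FN; set N := (M ^ 2)%N in FN *.
pose lk (e' a' b' : nat) (u v : int) : bool := `[< link p a b e' a' b' u v >].
have L0 : (0 < L)%N by nia.
have pt (u v : int) : F (ideal_form a b u v) = ((u == 0) && (v == 0))%:R * F 0 +
   \sum_(e' < N) \sum_(a' < N) \sum_(b' < N | valid e' a' b') (lk e' a' b' u v)%:R * F (e' ^ 2 * a')%N%:Z.
  have [/andP [/eqP u0 /eqP v0]|uv0] := boolP ((u == 0) && (v == 0)).
    rewrite mul1r big1 ?addr0 => [|e' _]; first by rewrite u0 v0; congr F; rewrite /ideal_form /qform; ring.
    rewrite big1 // => a' _; rewrite big1 // => b' V'.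
    rewrite /lk asboolF ?mul0r // => lnk; have := link_neq0 V V' lnk.
    by rewrite /vec u0 v0 !mulr0 addr0 elt_int eqxx.
  rewrite mul0r add0r.
  have uv : (u, v) <> (0, 0) by case=> u0 v0; move: uv0; rewrite u0 v0.
  have [e0 [a0 [b0 [V0 lnk0]]]] := link_exists p_pr pm V uv.
  have N0 := link_norm p_pr pm V V0 lnk0.
  have [QN|NQ] := ltP (ideal_form a b u v) N%:Z; last first.
    rewrite FN // big1 // => e' _; rewrite big1 // => a' _; rewrite big1 // => b' V'.
    have [/asboolP lnk|] := boolP (lk e' a' b' u v); last by rewrite mul0r.
    by rewrite (link_norm p_pr pm V V' lnk) FN // mulr0.
  have /and4P [e0p a0p b0a _] := V0.
  have [eN aN bN] : [/\ (e0 < N)%N, (a0 < N)%N & (b0 < N)%N].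
    move: QN; rewrite -N0 ltz_nat => QN.
    have aN : (a0 < N)%N by apply: leq_ltn_trans QN; rewrite leq_pmull // expn_gt0 e0p.
    split=> //; last by apply: ltn_trans aN.
    by apply: leq_ltn_trans QN; rewrite -mulnn -mulnA leq_pmulr // muln_gt0 e0p.
  have uniq e' a' b' : valid e' a' b' -> lk e' a' b' u v -> [/\ e' = e0, a' = a0 & b' = b0].
    move=> V' /asboolP lnk; apply: (idl_inj p_pr pm V' V0) => z.
    have a0' : a%:R != 0 :> algC by case/and4P: V => _ ag _ _; rewrite pnatr_eq0 -lt0n.
    move: lnk; rewrite /link lnk0 => E; split=> zI.
      have : [set a%:R * y | y in idl e' a' b'] (a%:R * z) by exists z.
      by rewrite -E => -[y yI /(mulfI a0') <-].
    have : [set a%:R * y | y in idl e0 a0 b0] (a%:R * z) by exists z.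
    by rewrite E => -[y yI /(mulfI a0') <-].
  have lk0 : lk e0 a0 b0 u v by apply/asboolP.
  rewrite (bigD1 (Ordinal eN)) //= (bigD1 (Ordinal aN)) //= (bigD1 (Ordinal bN)) //= lk0 mul1r N0.
  rewrite big1 => [|b' /andP [V' bn]]; last first.
    have [/(uniq _ _ _ V') [_ _ E]|] := boolP (lk _ _ _ _ _); last by rewrite mul0r.
    by move: bn; rewrite -val_eqE /= E eqxx.
  rewrite big1 => [|a' an]; last first.
    rewrite big1 // => b' V'.
    have [/(uniq _ _ _ V') [_ E _]|] := boolP (lk _ _ _ _ _); last by rewrite mul0r.
    by move: an; rewrite -val_eqE /= E eqxx.
  rewrite big1 ?addr0 // => e' en.
  rewrite big1 // => a' _; rewrite big1 // => b' V'.
  have [/(uniq _ _ _ V') [E _ _]|] := boolP (lk _ _ _ _ _); last by rewrite mul0r.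
  by move: en; rewrite -val_eqE /= E eqxx.
rewrite /box.
under eq_bigr => i _ do under eq_bigr => j _ do rewrite pt.
under eq_bigr => i _ do rewrite big_split /= -mulr_suml.
rewrite big_split /= -mulr_suml sum_box_point ?mul1r //.
congr (_ + _).
under eq_bigr => i _.
  rewrite exchange_big /=.
  under eq_bigr => e' _.
    rewrite exchange_big /=.
    under eq_bigr => a' _ do rewrite exchange_big /=.
    over.
  over.
rewrite exchange_big /=; apply: eq_bigr => e' _.
rewrite exchange_big /=; apply: eq_bigr => a' _.
rewrite exchange_big /=; apply: eq_bigr => b' V'.
have [FN'|F0] := ltP (e' ^ 2 * a')%N%:Z N%:Z; last first.
  rewrite FN // mulr0 big1 // => i _; rewrite big1 // => j _; by rewrite mulr0.
under eq_bigr => i _ do rewrite -mulr_suml.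
rewrite -mulr_suml; congr (_ * _).
have NJ := idl_nonzero_ideal p_pr pm V'.
have [/asboolP cl|ncl] := boolP `[< _ >]; last first.
  rewrite mulr0 big1 // => i _; rewrite big1 // => j _; rewrite /lk asboolF // => lnk.
  move/asboolP: ncl; apply; apply/(ideal_class_eq p_pr pm) => //.
  exact: (link_equiv p_pr pm V V' lnk).
have /(ideal_class_eq p_pr pm) : ideal_class K (idl 1 a b) = ideal_class K (idl e' a' b') := cl.
move=> /(_ NJ) /(equiv_link p_pr pm V V') [u0 [v0 lnk]].
have lnk' := link_opp pm V lnk.
have Q0 := link_norm p_pr pm V V' lnk.
have [uL vL] : `|u0| < L%:Z /\ `|v0| < L%:Z by apply: (form_small V M0 ML); rewrite -Q0.
have uv0 : ~~ ((u0 == 0) && (v0 == 0)).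
  apply/negP => /andP [/eqP u00 /eqP v00]; have := link_neq0 V V' lnk.
  by rewrite /vec u00 v00 !mulr0 addr0 elt_int eqxx.
have lkE u v : ((lk e' a' b' u v)%:R : int) =
    ((u == u0) && (v == v0))%:R + ((u == - u0) && (v == - v0))%:R.
  have [/asboolP h|h] := boolP (lk e' a' b' u v).
    case: (link_unique p_pr pm p_gt3 V V' lnk h) => -[-> ->]; rewrite !eqxx /=.
      have -> // : (u0 == - u0) && (v0 == - v0) = false.
      by apply/negP => /andP [h1 h2]; move: uv0; lia.
    have -> // : (- u0 == u0) && (- v0 == v0) = false.
    by apply/negP => /andP [h1 h2]; move: uv0; lia.
  have -> : (u == u0) && (v == v0) = false.
    by apply/negP => /andP [/eqP uu /eqP vv]; move/asboolP: h; rewrite uu vv.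
  have -> // : (u == - u0) && (v == - v0) = false.
  by apply/negP => /andP [/eqP uu /eqP vv]; move/asboolP: h; rewrite uu vv.
under eq_bigr => i _ do under eq_bigr => j _ do rewrite lkE.
under eq_bigr => i _ do rewrite big_split /=.
by rewrite big_split /= !sum_box_point // normrN.
Qed.

Definition chi_seq (i : nat) : int := chi_nat p i.+1.

Lemma chi_seq_balanced : balanced p chi_seq.
Proof.
have p2 := p_gt2_of_4m p_pr pm.
split; first exact: prime_gt0.
  by move=> i; rewrite /chi_seq /chi_nat -addSn natrD pchar_Fp_0 // addr0.
have := sum_chi p_pr p2; rewrite sum_Fp_nat // => H.
have : \sum_(0 <= i < p.+1) chi_nat p i = chi_nat p 0 + \sum_(i < p) chi_seq i.
  by rewrite big_nat_recl // big_mkord.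
have c0 : chi_nat p 0 = 0 by rewrite /chi_nat chi0.
have cp : chi_nat p p = 0 by rewrite /chi_nat pchar_Fp_0 // chi0.
by rewrite big_nat_recr //= cp c0 addr0 add0r => <-.
Qed.

(** Dirichlet's class number formula; [abel_chi_seq] below brings the right-hand side into
    the usual form. *)
Theorem class_number_formula : p%:Z * (h (- p%:Z))%:Z = abel p chi_seq.
Proof.
rewrite (class_number_size p_pr pm).
pose forms := [seq (s.1, (2 * s.2 + 1)%N%:Z, cofac s.1 s.2) | s <- representatives p m].
have -> : size (representatives p m) = size forms by rewrite /forms size_map.
apply: (@constant_term p chi_seq forms (rep m)); first exact: chi_seq_balanced.
- by move=> f /mapP [s /representatives_valid V ->]; apply: form_pos V.
- move=> n; rewrite (rep_chi p_pr pm) //.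
  have P : perm_eq (divisors n.+1) [seq (nat_of_ord i).+1 | i <- enum 'I_n.+1 & ((nat_of_ord i).+1 %| n.+1)%N].
    apply: uniq_perm; first exact: divisors_uniq.
      rewrite map_inj_uniq; first by apply: filter_uniq; apply: enum_uniq.
      by move=> i j /succn_inj /val_inj.
    move=> d; rewrite -dvdn_divisors //; apply/idP/mapP => [dn|[i]].
      have d0 := dvdn_gt0 (ltn0Sn n) dn.
      have dl : (d.-1 < n.+1)%N by rewrite prednK // dvdn_leq.
      exists (Ordinal dl); last by rewrite /= prednK.
      by rewrite mem_filter mem_enum /= prednK ?dn.
    by rewrite mem_filter => /andP [dv _] ->.
  by rewrite (perm_big _ P) big_map big_filter big_enum_cond.
move=> M k F M0 k0 FN; rewrite big_map.
transitivity (\sum_(s <- representatives p m) (F 0 +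
   \sum_(e' < M ^ 2) \sum_(a' < M ^ 2) \sum_(b' < M ^ 2 | valid e' a' b')
     2 * `[< pair_class p s = ideal_class K (idl e' a' b') >]%:R * F (e' ^ 2 * a')%N%:Z)).
  rewrite big_seq [RHS]big_seq; apply: eq_bigr => -[a b] /representatives_valid V /=.
  by apply: (box_class_sum V M0 _ FN); rewrite leq_pmull.
rewrite big_split /=; congr (_ + _).
  by rewrite big_const_seq count_predT iter_addr_0 /forms [in RHS]size_map -[LHS]mulr_natl natz.
rewrite -(sum_over_triples m FN) mulr_sumr.
rewrite exchange_big /=; apply: eq_bigr => e' _; rewrite mulr_sumr.
rewrite exchange_big /=; apply: eq_bigr => a' _; rewrite mulr_sumr.
rewrite exchange_big /=; apply: eq_bigr => b' V'.
by rewrite -mulr_suml -mulr_sumr (sum_representatives p_pr pm V') mulr1.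
Qed.

End ClassNumberFormula.

Local Close Scope classical_set_scope.

(** * The half-sum of the character *)

Lemma sum_psum (th : nat -> int) k :
  \sum_(i < k) psum th i = k%:Z * \sum_(j < k) th j - \sum_(j < k) j%:Z * th j.
Proof.
elim: k => [|k IH]; first by rewrite !big_ord0; ring.
rewrite big_ord_recr /= IH !big_ord_recr /= /psum big_ord_recr /=.
by have -> : k.+1%:Z = k%:Z + 1 by [lia]; ring.
Qed.

Lemma sign_prod_sum n (s : 'I_n -> int) : (forall i, s i = 1 \/ s i = -1) ->
  exists2 t, \prod_i s i = (-1) ^+ t & \sum_i s i = n%:Z - (2 * t)%:Z.
Proof.
elim: n s => [|n IH] s s1; first by exists 0%N; rewrite !big_ord0.
have [t prodE sumE] := IH (fun i => s (lift ord0 i)) (fun i => s1 _).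
rewrite !big_ord_recl prodE sumE; case: (s1 ord0) => ->.
  by exists t; [rewrite mul1r | lia].
by exists t.+1; [rewrite exprS | lia].
Qed.

Section HalfSum.

Variables (p m : nat).
Hypotheses (p_pr : prime p) (pm : p.+1 = (4 * m)%N) (p_gt3 : (3 < p)%N).
Local Notation F := 'F_p.
Local Notation chi := (@chi p).
Local Notation n := (halfp p).

Lemma abel_chi_seq : abel p (chi_seq p) = - \sum_(x : F) (nat_of_ord x)%:Z * chi x.
Proof.
have [_ _ bal] := chi_seq_balanced p_pr pm.
rewrite /abel sum_psum bal mulr0 sub0r; congr (- _).
rewrite (sum_Fp_nat p_pr (fun x : F => (nat_of_ord x)%:Z * chi x)).
transitivity (\sum_(j < p) j.+1%:Z * chi_seq p j).
  rewrite -[LHS]addr0 -[X in _ + X = _]bal -big_split /=; apply: eq_bigr => j _.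
  by have -> : j.+1%:Z = j%:Z + 1 by [lia]; ring.
have E : \sum_(0 <= d < p.+1) d%:Z * chi_nat p d = \sum_(j < p) j.+1%:Z * chi_seq p j.
  by rewrite big_nat_recl // mul0r add0r big_mkord.
rewrite -E big_nat_recr //= {2}/chi_nat pchar_Fp_0 // chi0 mulr0 addr0.
rewrite big_nat [RHS]big_nat; apply: eq_bigr => d /andP [_ dp].
by rewrite val_Fp_nat // modn_small.
Qed.

Definition chi_half : int := \sum_(j < n) chi j.+1%:R.

Lemma chi_opp (x : F) : chi (- x) = - chi x.
Proof.
have p2 := p_gt2_of_4m p_pr pm.
by rewrite -[- x]mulN1r chiM // (chiN1_of_4m p_pr pm) mulN1r.
Qed.

Lemma val_opp (j : nat) : (0 < j < p)%N -> nat_of_ord (- j%:R : F) = (p - j)%N.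
Proof.
move=> /andP [j0 jp]; have -> : - j%:R = (p - j)%N%:R :> F.
  by rewrite natrB ?(ltnW jp) // pchar_Fp_0 // sub0r.
by rewrite val_Fp_nat // modn_small //; lia.
Qed.

(** Evaluate the sum S of x chi(x) over the residues 0 <= x < p in two ways, pairing x with
    p - x and, after the substitution of 2 x for x, 2 x with p - 2 x. Both express S by the
    half-sum and by B, the sum of j chi(j) for j <= n; eliminate B. *)
Lemma half_sum_class_number : chi_half = (2 - chi 2%:R) * (h (- p%:Z))%:Z.
Proof.
have p2 := p_gt2_of_4m p_pr pm; have np := half_dblS p_pr p2.
have p0 : p%:Z != 0 by have := prime_gt0 p_pr; lia.
apply: (mulfI p0); rewrite mulrCA (class_number_formula p_pr pm p_gt3) abel_chi_seq.
pose B : int := \sum_(j < n) j.+1%:Z * chi j.+1%:R.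
set S := \sum_x _.
have jp (j : 'I_n) : (2 * j.+1 < p)%N.
  by have := ltn_ord j; move: np; rewrite -addnn => np jn; lia.
have S1 : S = 2 * B - p%:Z * chi_half.
  rewrite /S (halfp_sum p_pr p2) mul0r add0r /B /chi_half !mulr_sumr -sumrB.
  apply: eq_bigr => j _; have jpj := jp j.
  rewrite val_opp ?val_Fp_nat ?modn_small //; try lia.
  by rewrite chi_opp -subzn; [ring | lia].
have S2 : S = chi 2%:R * (4 * B - p%:Z * chi_half).
  have n2 : 2%:R != 0 :> F := two_neq0 p_pr p2.
  pose f (x : F) : int := (nat_of_ord x)%:Z * chi x.
  have -> : S = \sum_x f (2%:R * x) by exact: (reindex_inj (mulfI n2)).
  rewrite (halfp_sum p_pr p2) [2%:R * 0]mulr0 {1}/f chi0 mulr0 add0r.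
  rewrite /B /chi_half !mulr_sumr -sumrB mulr_sumr.
  apply: eq_bigr => j _; have jpj := jp j.
  rewrite mulrN -natrM /f val_opp ?val_Fp_nat ?modn_small //.
  rewrite chi_opp natrM chiM // -subzn; last by lia.
  by rewrite PoszM; ring.
have := chi_sqr (two_neq0 p_pr p2); move: (chi 2%:R) S2 => x S2 xx.
have : x * S = 4 * B - p%:Z * chi_half by rewrite S2 mulrA xx mul1r.
by move: S1; move: (p%:Z * chi_half) => y S1 S3; rewrite mulrN mulrBl; lia.
Qed.

Lemma c_E : c_ p = chi_half.
Proof. by rewrite half_sum_class_number /c_ (legendreE p_pr). Qed.

(** The half-sum has n summands 1 or -1, and n is odd. *)
Lemma odd_class_number : odd (h (- p%:Z)).
Proof.
have p2 := p_gt2_of_4m p_pr pm.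
have [|t _] := @sign_prod_sum n (fun j => chi j.+1%:R).
  move=> j; have := halfp_neq0 p_pr p2 j; rewrite -chi_eq0.
  by case: (chi_cases (j.+1%:R : F)) => -> // _; [left | right].
rewrite -/chi_half half_sum_class_number.
have := half_of_4m p_pr pm.
have := two_neq0 p_pr p2; rewrite -chi_eq0.
by case: (chi_cases (2%:R : F)) => -> // _; lia.
Qed.

End HalfSum.

(** * The sign of the quadratic Gauss sum *)

Section EulerOperator.

Variable R : comNzRingType.
Implicit Types f g : {poly R}.

(** The derivation X d/dX, which multiplies X^b by b. *)
Definition euler f : {poly R} := 'X * f^`().

Lemma euler_iter_sum (I : Type) (r : seq I) (P : pred I) (F : I -> {poly R}) k :
  iter k euler (\sum_(i <- r | P i) F i) = \sum_(i <- r | P i) iter k euler (F i).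
Proof.
elim: k => [//|k IH]; rewrite iterS IH /euler raddf_sum mulr_sumr.
by apply: eq_bigr.
Qed.

Lemma euler_iterZ c f k : iter k euler (c *: f) = c *: iter k euler f.
Proof. by elim: k => [//|k IH]; rewrite iterS IH /euler derivZ scalerAr. Qed.

Lemma euler_iterB f g k : iter k euler (f - g) = iter k euler f - iter k euler g.
Proof. by elim: k => [//|k IH]; rewrite !iterS IH /euler derivB mulrBr. Qed.

Lemma euler_iterXn b k : iter k euler 'X^b = (b ^ k)%:R *: 'X^b.
Proof.
elim: k => [|k IH]; first by rewrite scale1r.
rewrite iterS IH /euler derivZ derivXn -scalerAr expnSr natrM -scalerA; congr (_ *: _).
case: b {IH} => [|b]; first by rewrite mulr0n mulr0 scale0r.
by rewrite /= mulrnAr -exprS scaler_nat.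
Qed.

(** Each application lowers the order of the zero at 1 by one; the leading coefficient
    there picks up the falling factorial. *)
Lemma euler_pow (N k : nat) (f : {poly R}) : (k <= N)%N ->
  exists2 g, iter k euler (('X - 1) ^+ N * f) = ('X - 1) ^+ (N - k) * g
    & g.[1] = (N ^_ k)%:R * f.[1].
Proof.
elim: k => [|k IH] kN; first by exists f; rewrite ?subn0 // ffactn0 mul1r.
have [g gE g1] := IH (ltnW kN).
exists ('X * ((N - k)%:R * g + ('X - 1) * g^`())).
  rewrite iterS gE /euler derivM deriv_exp derivB derivX derivC subr0 mul1r.
  have -> : (N - k = (N - k.+1).+1)%N by rewrite subnSK.
  by rewrite /= exprS -[_ *+ _.+1]mulr_natl; ring.
rewrite !hornerE g1 subrr mul0r addr0 ffactnSr natrM.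
by rewrite hornerMn hornerC; ring.
Qed.

End EulerOperator.

Section GaussSign.

Variables (p m : nat).
Hypotheses (p_pr : prime p) (pm : p.+1 = (4 * m)%N).
Local Notation F := 'F_p.
Local Notation chi := (@chi p).
Local Notation n := (halfp p).

(** Integer polynomials with the values [gauss p z] and [half_prod] at z. *)
Definition gauss_poly : {poly int} := \sum_(b < p) (chi b%:R) *: 'X^b.

Definition half_prod_poly : {poly int} := \prod_(j < n) ('X^(j.+1) - 'X^(p - j.+1)).

Variable z : algC.
Hypothesis prim_z : p.-primitive_root z.
Local Notation ec := (@ec p algC z).

Let p2 : (2 < p)%N := p_gt2_of_4m p_pr pm.
Let zp : z ^+ p = 1 := (prim_root_prime p_pr prim_z).1.

Definition half_prod : algC := \prod_(j < n) (ec j.+1%:R - ec (- j.+1%:R)).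

Lemma gauss_polyE : (map_poly intr gauss_poly).[z] = gauss p z.
Proof.
rewrite /gauss_poly rmorph_sum /= horner_sum /gauss.
rewrite (sum_Fp_nat p_pr (fun b : F => (chi b)%:~R * ec b)) big_mkord.
apply: eq_bigr => b _; rewrite map_polyZ map_polyXn !hornerE /=.
by rewrite (ec_nat p_pr zp).
Qed.

Lemma half_prod_polyE : (map_poly intr half_prod_poly).[z] = half_prod.
Proof.
rewrite /half_prod_poly rmorph_prod /= horner_prod; apply: eq_bigr => j _.
rewrite rmorphB /= !map_polyXn !hornerE /= -!(ec_nat p_pr zp); congr (_ - ec _).
rewrite natrB ?pchar_Fp_0 ?sub0r //.
by have := half_dblS p_pr p2; have := ltn_ord j; rewrite -addnn; lia.
Qed.

Lemma cyclotomic_mod_p : map_poly intr 'Phi_p = ('X - 1) ^+ (n.*2) :> {poly F}.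
Proof.
have P : perm_eq (divisors p) [:: 1%N; p].
  apply: uniq_perm; [exact: divisors_uniq | by rewrite /= inE; have := prime_gt1 p_pr; lia |].
  move=> d; rewrite -dvdn_divisors ?prime_gt0 // !inE.
  apply/idP/idP; first exact: (primeP p_pr).2.
  by case/orP => /eqP ->.
have := prod_Cyclotomic (prime_gt0 p_pr); rewrite (perm_big _ P) /= big_cons big_seq1.
have := prod_Cyclotomic (ltn0Sn 0); rewrite (_ : divisors 1 = [:: 1%N]) // big_seq1 expr1 => -> E.
have := congr1 (map_poly (intr : int -> F)) E.
rewrite rmorphM !rmorphB rmorph1 /= map_polyX map_polyXn => E'.
have X1 : ('X - 1 : {poly F}) != 0 by rewrite -[1]/(1%:P) polyXsubC_eq0.
apply: (mulfI X1); rewrite E' -exprS half_dblS //.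
have pF : p \in [pchar {poly F}] by rewrite pchar_poly pchar_Fp.
have := pFrobenius_autE pF ('X - 1); rewrite rmorphB rmorph1 /= pFrobenius_autE => ->.
by [].
Qed.

(** The difference of the two polynomials vanishes at z, so it is divisible by the p-th
    cyclotomic polynomial, which is (X-1)^(2n) modulo p. Hence n applications of X d/dX
    modulo p give a polynomial that vanishes at 1. On the Gauss sum, where b^n = chi b, they
    give the sum of chi(b)^2, which is -1; on the product, which has a zero of order n,
    they give n! times the product of the 2 j. *)
Lemma sign_congruence (ep : int) : half_prod = ep%:~R * gauss p z ->
  ep%:~R = - (2 ^+ n * (n`!)%:R ^+ 2) :> F.
Proof.
move=> E; pose D := half_prod_poly - ep *: gauss_poly.
have rD : root (map_poly ratr (map_poly intr D : {poly rat})) z.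
  have -> : map_poly ratr (map_poly intr D : {poly rat}) = map_poly intr D :> {poly algC}.
    by apply/polyP => i; rewrite !coef_map /= ratr_int.
  rewrite rootE rmorphB /= map_polyZ hornerD hornerN hornerZ half_prod_polyE gauss_polyE E.
  by rewrite subrr.
have [r Dr] : {r | D = 'Phi_p * r}.
  have := minCpolyP z => -[q [qE qm] qP].
  have : 'Phi_p %| D.
    rewrite -dvdp_rat_int.
    have -> : map_poly intr 'Phi_p = q.
      apply: (@map_poly_inj _ _ (@ratr algC)); rewrite -qE (minCpoly_cyclotomic prim_z) -(Cintr_Cyclotomic prim_z).
      by apply/polyP => i; rewrite !coef_map /= ratr_int.
    by have := qP (map_poly intr D); rewrite rD => /esym.
  by move/dvdpP_int => [r Dr]; exists r; rewrite Dr zprimitive_monic // Cyclotomic_monic.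
have n0 : (0 < n)%N := halfp_gt0 p_pr p2.
have := congr1 (map_poly (intr : int -> F)) Dr.
rewrite rmorphM /= cyclotomic_mod_p rmorphB /= map_polyZ => E1.
have left0 : (iter n (@euler F) (('X - 1) ^+ n.*2 * map_poly intr r)).[1] = 0.
  have [|g -> _] := @euler_pow F n.*2 n (map_poly intr r); first by rewrite -addnn leq_addr.
  by rewrite -addnn addnK !hornerE subrr expr0n; case: (halfp p) n0 => //= *; rewrite mul0r.
have gaussE : (iter n (@euler F) (map_poly intr gauss_poly)).[1] = -1.
  rewrite /gauss_poly rmorph_sum /= euler_iter_sum horner_sum.
  transitivity (\sum_(x : F) (x != 0)%:R : F).
    rewrite (sum_Fp_nat p_pr (fun x : F => (x != 0)%:R)) big_mkord; apply: eq_bigr => b _.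
    rewrite map_polyZ map_polyXn euler_iterZ euler_iterXn !hornerE /= expr1n mulr1.
    rewrite natrX -(chi_euler p_pr p2) -rmorphM /=.
    have [->|b0] := eqVneq (b%:R : F) 0; first by rewrite chi0.
    by rewrite chi_sqr.
  rewrite (bigD1 0) //= add0r (eq_bigr (fun=> 1)) => [|x ->] //.
  rewrite sumr_const (eq_card (B := predC1 (0 : F))) // cardC1 card_Fp //.
  by rewrite -subn1 natrB ?prime_gt0 // pchar_Fp_0 // sub0r.
have prodE : (iter n (@euler F) (map_poly intr half_prod_poly)).[1] = (n`!)%:R * (2 ^+ n * (n`!)%:R).
  have factor (j : nat) : (j.+1 < p)%N -> exists2 q : {poly F},
      'X^(j.+1) - 'X^(p - j.+1) = ('X - 1) * q & q.[1] = (2 * j.+1)%:R.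
    move=> jp.
    have r1 : root ('X^(j.+1) - 'X^(p - j.+1) : {poly F}) 1.
      by rewrite rootE !hornerE /= !expr1n subrr.
    have [q qE] := factor_theorem _ _ r1; exists q; first by rewrite mulrC.
    have := congr1 (fun f : {poly F} => f^`().[1]) qE.
    rewrite derivB !derivXn derivM derivB derivX derivC !hornerE subrr mulr0 add0r subr0 mulr1.
    rewrite !hornerMn !hornerXn !expr1n => <-.
    rewrite natrB ?(ltnW jp) // pchar_Fp_0 // sub0r opprK -natrD; congr (_%:R); lia.
  have [Q QE Q1] : exists2 Q : {poly F}, map_poly intr half_prod_poly = ('X - 1) ^+ n * Q
     & Q.[1] = 2 ^+ n * (n`!)%:R.
    rewrite /half_prod_poly rmorph_prod /=.
    have : (n < p)%N by have := half_dblS p_pr p2; rewrite -addnn; lia.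
    elim: (halfp p) => [|k IH] kp.
      by exists 1; [rewrite big_ord0 expr0 mulr1 | rewrite fact0 hornerC expr0 mulr1].
    have [Q QE Q1] := IH (ltnW kp); have [q qE q1] := factor k kp.
    exists (Q * q); rewrite ?big_ord_recr /=.
      by rewrite QE rmorphB /= !map_polyXn qE exprSr; ring.
    by rewrite hornerM Q1 q1 factS !natrM exprSr; ring.
  have [g gE g1] := euler_pow Q (leqnn n).
  by rewrite QE gE subnn expr0 mul1r g1 ffactnn Q1.
have := congr1 (fun f => (iter n (@euler F) f).[1]) E1.
rewrite /= left0 euler_iterB euler_iterZ hornerD hornerN hornerZ gaussE prodE mulrN1 opprK.
move=> /eqP; rewrite addrC addr_eq0 => /eqP ->; congr (- _); ring.
Qed.

(** Both sides have the same square. In the congruence for the sign 2^n is chi 2, and the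
    remaining factor n!^2 is a square, hence not -1, so that it must be 1. *)
Lemma half_prod_gauss : half_prod ^+ 2 = - p%:R -> half_prod = - (chi 2%:R)%:~R * gauss p z.
Proof.
move=> sq; have g2 := gauss_sqr p_pr p2 zp (prim_root_prime p_pr prim_z).2.
rewrite (chiN1_of_4m p_pr pm) rmorphN1 mulN1r -sq in g2.
have [ep [epE ep1]] : exists ep : int, half_prod = ep%:~R * gauss p z /\ (ep = 1 \/ ep = -1).
  move/eqP: g2; rewrite eq_sym eqf_sqr => /orP [/eqP ->|/eqP ->].
    by exists 1; rewrite mul1r; split; [|left].
  by exists (-1); rewrite rmorphN1 mulN1r; split; [|right].
rewrite epE -rmorphN; congr (_%:~R * _).
have := sign_congruence epE; have chi2 := chi_euler p_pr p2 (2%:R : F).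
rewrite -chi2 => H.
have fact0 k : (k < p)%N -> (k`!)%:R != 0 :> F.
  elim: k => [|k IH] kp; first by rewrite oner_eq0.
  by rewrite factS natrM mulf_neq0 ?IH ?natFp_neq0 ?(ltnW kp).
have nf : chi ((n`!)%:R ^+ 2) = 1.
  rewrite expr2 chiM // chi_sqr // fact0 //.
  by have := half_dblS p_pr p2; rewrite -addnn; lia.
have c0 : chi (2%:R : F) != 0 by rewrite chi_eq0 two_neq0.
suff [//|E] : ep = - chi 2%:R \/ ep = chi 2%:R.
  move: H; rewrite E => /eqP; rewrite -subr_eq0 opprK -{1}[_%:~R]mulr1 -mulrDr mulf_eq0.
  rewrite chi2 -chi_euler // int_small_eq0 ?(le_trans (chi_le1 _)) // (negbTE c0) /=.
  rewrite addrC addr_eq0 => /eqP s1; move: nf; rewrite s1 (chiN1_of_4m p_pr pm).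
  by [].
by move: c0; case: ep1 => ->; case: (chi_cases (2%:R : F)) => -> // _; [right|left|left|right].
Qed.

End GaussSign.

(** * Determinants *)

(** Sylvester's identity: expand the determinant of [[1, -A], [B, 1]] in both ways. *)
Lemma det_add1_mulmx (R : comNzRingType) k l (A : 'M[R]_(k, l)) (B : 'M[R]_(l, k)) :
  \det (1%:M + A *m B) = \det (1%:M + B *m A).
Proof.
have E1 : block_mx 1%:M (- A) B 1%:M = block_mx 1%:M 0 B 1%:M *m block_mx 1%:M (- A) 0 (1%:M + B *m A).
  by rewrite mulmx_block !mul1mx !mulmx0 !mul0mx !addr0 mulmxN mulmx1 addrCA addNr addr0.
have E2 : block_mx 1%:M (- A) B 1%:M = block_mx 1%:M (- A) 0 1%:M *m block_mx (1%:M + A *m B) 0 B 1%:M.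
  by rewrite mulmx_block !mul1mx !mulmx1 !mulmx0 !mul0mx !add0r mulNmx addrK.
have D1 : \det (block_mx 1%:M (- A) B 1%:M) = \det (1%:M + B *m A).
  by rewrite E1 det_mulmx det_lblock det_ublock !det1 !mul1r.
have D2 : \det (block_mx 1%:M (- A) B 1%:M) = \det (1%:M + A *m B).
  by rewrite E2 det_mulmx det_lblock det_ublock !det1 !mul1r mulr1.
by rewrite -D1 -D2.
Qed.

Lemma det_scalar_sub_ones (K : fieldType) k (c d : K) : (0 < k)%N -> c != 0 ->
  \det (c%:M - const_mx d : 'M[K]_k) = c ^+ k.-1 * (c - d * k%:R).
Proof.
case: k => [//|k] _ c0.
have -> : c%:M - const_mx d = c *: (1%:M + (const_mx (- d / c) : 'cV_k.+1) *m (const_mx 1 : 'rV_k.+1)).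
  rewrite scalerDr scalemx1; congr (_ + _); apply/matrixP => i j.
  by rewrite !mxE big_ord1 !mxE mulr1 mulrC mulfVK.
rewrite detZ det_add1_mulmx det_mx11 !mxE eqxx mulr1n.
under eq_bigr => i _ do rewrite !mxE mul1r.
by rewrite sumr_const card_ord -[_ *+ k.+1]mulr_natr exprSr /=; field.
Qed.

Section Indices.

Variable p : nat.
Hypotheses (p_pr : prime p) (p2 : (2 < p)%N).
Local Notation F := 'F_p.
Local Notation chi := (@chi p).
Local Notation n := (halfp p).

Definition idx (j : 'I_n) : F := j.+1%:R.

(** The matrix of the theorem for x = y = z = w = 0. *)
Definition core_mx : 'M[int]_n := \matrix_(j, k) (chi (idx j + idx k) + chi (idx j - idx k)).

Definition chi_prod : int := \prod_(j < n) chi (idx j).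

Lemma idx_add_neq0 j k : idx j + idx k != 0.
Proof.
rewrite -natrD natFp_neq0 //; have [jn kn] := (ltn_ord j, ltn_ord k).
by have := half_dblS p_pr p2; rewrite -addnn; lia.
Qed.

Lemma idx_sub_eq0 j k : (idx j - idx k == 0) = (j == k).
Proof.
rewrite subr_eq0; apply/eqP/eqP => [|-> //] E.
apply: val_inj; apply: succn_inj; apply: (natFp_inj p_pr) E.
  by have := ltn_ord j; have := half_dblS p_pr p2; rewrite -addnn; lia.
by have := ltn_ord k; have := half_dblS p_pr p2; rewrite -addnn; lia.
Qed.

End Indices.

Section FourierFactorisation.

Variable p : nat.
Hypotheses (p_pr : prime p) (p2 : (2 < p)%N).
Variable z : algC.
Hypothesis prim_z : p.-primitive_root z.
Local Notation F := 'F_p.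
Local Notation chi := (@chi p).
Local Notation ec := (@ec p algC z).
Local Notation n := (halfp p).
Local Notation core_mx := (core_mx p).
Local Notation chi_prod := (chi_prod p).

Let zp : z ^+ p = 1 := (prim_root_prime p_pr prim_z).1.
Let z1 : z != 1 := (prim_root_prime p_pr prim_z).2.

Definition cos_mx : 'M[algC]_n := \matrix_(j, k) (ec (idx j * idx k) + ec (- (idx j * idx k))).

Definition sin_mx : 'M[algC]_n := \matrix_(j, k) (ec (idx j * idx k) - ec (- (idx j * idx k))).

Lemma half_ec (a : F) : \sum_(j < n) (ec (idx j * a) + ec (- (idx j * a))) =
  (if a == 0 then p%:R else 0) - 1.
Proof.
rewrite -(sum_ecM p_pr zp z1) (halfp_sum p_pr p2) mul0r ec0 //.
by rewrite addrAC subrr add0r; apply: eq_bigr => j _; rewrite mulNr.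
Qed.

Lemma opp_angles (a b : F) : - (a + b) = - a + - b /\ - (a - b) = - a + b.
Proof. by split; ring. Qed.

Lemma cos_cos a b : (ec a + ec (- a)) * (ec b + ec (- b)) =
  ec (a + b) + ec (- (a + b)) + (ec (a - b) + ec (- (a - b))).
Proof. by have [-> ->] := opp_angles a b; rewrite !(ecD p_pr zp); ring. Qed.

Lemma sin_sin a b : (ec a - ec (- a)) * (ec b - ec (- b)) =
  ec (a + b) + ec (- (a + b)) - (ec (a - b) + ec (- (a - b))).
Proof. by have [-> ->] := opp_angles a b; rewrite !(ecD p_pr zp); ring. Qed.

Lemma sin_cos a b : (ec a - ec (- a)) * (ec b + ec (- b)) =
  ec (a + b) - ec (- (a + b)) + (ec (a - b) - ec (- (a - b))).
Proof. by have [-> ->] := opp_angles a b; rewrite !(ecD p_pr zp); ring. Qed.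

Lemma cos_sin a b : (ec a + ec (- a)) * (ec b - ec (- b)) =
  ec (a + b) - ec (- (a + b)) - (ec (a - b) - ec (- (a - b))).
Proof. by have [-> ->] := opp_angles a b; rewrite !(ecD p_pr zp); ring. Qed.

(** Orthogonality: a product of two cosines is a sum of cosines of (j + k) b and (j - k) b,
    and j + k never vanishes while j - k vanishes on the diagonal. *)
Lemma cos_mx_sqr : cos_mx *m cos_mx = p%:R%:M - const_mx 2.
Proof.
apply/matrixP => j k; rewrite !mxE.
under eq_bigr => b _ do rewrite !mxE [idx j * _]mulrC cos_cos -mulrDr -mulrBr.
rewrite big_split /= !half_ec (negbTE (idx_add_neq0 p_pr p2 j k)) idx_sub_eq0 //.
by case: (j == k); rewrite /= ?mulr1n ?mulr0n; ring.
Qed.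

Lemma sin_mx_sqr : sin_mx *m sin_mx = - p%:R%:M.
Proof.
apply/matrixP => j k; rewrite !mxE.
under eq_bigr => b _ do rewrite !mxE [idx j * _]mulrC sin_sin -mulrDr -mulrBr.
rewrite sumrB !half_ec (negbTE (idx_add_neq0 p_pr p2 j k)) idx_sub_eq0 //.
by case: (j == k); rewrite /= ?mulr1n ?mulr0n; ring.
Qed.

Lemma det_cos_sqr : \det cos_mx ^+ 2 = p%:R ^+ n.-1.
Proof.
have p0 : p%:R != 0 :> algC by rewrite pnatr_eq0 -lt0n prime_gt0.
rewrite expr2 -det_mulmx cos_mx_sqr det_scalar_sub_ones ?halfp_gt0 //.
have -> : p%:R - 2 * n%:R = 1 :> algC.
  by rewrite -{1}(half_dblS p_pr p2) -addnn -natr1 natrD; ring.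
by rewrite mulr1.
Qed.

Lemma det_sin_sqr : \det sin_mx ^+ 2 = (- p%:R) ^+ n.
Proof. by rewrite expr2 -det_mulmx sin_mx_sqr -[p%:R%:M]scalemx1 -scaleNr scalemx1 det_scalar. Qed.

Lemma det_diag_chi : \det (diag_mx (\row_j (chi (idx j))%:~R) : 'M[algC]_n) = chi_prod%:~R.
Proof. by rewrite det_diag rmorph_prod; apply: eq_bigr => j _; rewrite mxE. Qed.

(** Insert the Fourier transform of chi for chi(j + k) and chi(j - k), and group b with -b. *)
Lemma core_factor (s : algC) : s = (chi (-1))%:~R ->
  gauss p z *: map_mx intr core_mx =
  (\matrix_(j, k) (ec (idx j * idx k) + s * ec (- (idx j * idx k)))) *m
    diag_mx (\row_j (chi (idx j))%:~R) *m cos_mx.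
Proof.
move=> sE; apply/matrixP => j k; rewrite !mxE.
under eq_bigr => b _ do rewrite mul_mx_diag !mxE.
rewrite rmorphD /= mulrDr ![gauss p z * _]mulrC -!(gauss_twist p_pr p2 zp) -big_split /=.
rewrite (halfp_sum p_pr p2) chi0 rmorph0 !mul0r add0r add0r; apply: eq_bigr => b _.
rewrite -[- b.+1%:R]mulN1r (chiM p_pr p2 (-1)) rmorphM /= -sE -/(idx b).
have e1 : (idx j + idx k) * idx b = idx j * idx b + idx b * idx k by ring.
have e2 : (idx j - idx k) * idx b = idx j * idx b + - (idx b * idx k) by ring.
have e3 : (idx j + idx k) * (-1 * idx b) = - (idx j * idx b) + - (idx b * idx k) by ring.
have e4 : (idx j - idx k) * (-1 * idx b) = - (idx j * idx b) + idx b * idx k by ring.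
by rewrite e1 e2 e3 e4 !(ecD p_pr zp); ring.
Qed.

(** * The sine determinant in terms of the cosine determinant *)

(* With n + 1 = 1/2 in the field, the reversal of the indices is k |-> 1/2 - k. *)
Let hf : F := 2%:R^-1.

Let two_hf : 2%:R * hf = 1. Proof. by rewrite mulfV // two_neq0. Qed.

Definition rev_mx : 'M[algC]_n := \matrix_(i, j) (i == rev_ord j)%:R.

Lemma mul_rev_mx (M : 'M[algC]_n) j k : (M *m rev_mx) j k = M j (rev_ord k).
Proof.
rewrite mxE (bigD1 (rev_ord k)) //= mxE eqxx mulr1 big1 ?addr0 // => i ik.
by rewrite mxE (negbTE ik) mulr0.
Qed.

Lemma det_rev_sqr : \det rev_mx ^+ 2 = 1.
Proof.
rewrite expr2 -det_mulmx (_ : rev_mx *m rev_mx = 1%:M) ?det1 //.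
apply/matrixP => i j; rewrite mul_rev_mx !mxE rev_ordK; by [].
Qed.

Lemma hf_dbl : hf + hf = 1. Proof. by rewrite -two_hf mulr_natl. Qed.

Lemma idx_rev k : idx (rev_ord k) = hf - idx k.
Proof.
apply: (addIr (idx k)); rewrite subrK -natrD.
apply: (mulfI (two_neq0 p_pr p2)); rewrite two_hf -natrM.
have -> : (2 * ((rev_ord k).+1 + k.+1) = p + 1)%N.
  by rewrite /=; have := half_dblS p_pr p2; rewrite -addnn; have := ltn_ord k; lia.
by rewrite natrD pchar_Fp_0 // add0r.
Qed.

Definition shift_mx (s : algC) : 'M[algC]_n :=
  \matrix_(i, k) ((i == k)%:R + s * (i.+1 == k :> nat)%:R).

Lemma det_shift s : \det (shift_mx s) = 1.
Proof.
rewrite -det_tr det_trig.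
  by apply: big1 => i _; rewrite !mxE eqxx eqn_leq ltnn mulr0 addr0.
apply/is_trig_mxP => i j ij; rewrite !mxE.
have -> : (j == i) = false by apply/negP => /eqP E; move: ij; rewrite E ltnn.
have -> : (j.+1 == i :> nat) = false by apply/negP => /eqP E; lia.
by rewrite mulr0 addr0.
Qed.

Lemma sin_shift s j k : (sin_mx *m shift_mx s) j k =
  sin_mx j k + s * (ec (idx j * (idx k - 1)) - ec (- (idx j * (idx k - 1)))).
Proof.
have -> : idx k - 1 = (k : nat)%:R by rewrite /idx -natr1 addrK.
rewrite mxE; under eq_bigr => i _ do rewrite [shift_mx s i k]mxE mulrDr mulrCA.
rewrite big_split /= -mulr_sumr; congr (_ + _ * _).
  rewrite (bigD1 k) //= eqxx mulr1 big1 ?addr0 // => i ik.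
  by rewrite (negbTE ik) mulr0.
case: (posnP k) => [k0|k0].
  rewrite k0 mulr0 oppr0 subrr big1 // => i _.
  by rewrite mulr0.
have kn : (k.-1 < n)%N by have := ltn_ord k; lia.
rewrite (bigD1 (Ordinal kn)) //= prednK // eqxx mulr1 big1 ?addr0 => [|i ik].
  by rewrite mxE /idx /= prednK.
case: eqP => [E|]; last by rewrite mulr0.
by case/eqP: ik; apply: val_inj; rewrite /= -E.
Qed.

Definition half_sin : 'rV[algC]_n := \row_j (ec (idx j * hf) - ec (- (idx j * hf))).
Definition half_cos : 'rV[algC]_n := \row_j (ec (idx j * hf) + ec (- (idx j * hf))).

Lemma half_angles j k : idx j * hf + idx j * (hf - idx k) = - (idx j * (idx k - 1)) /\
  idx j * hf - idx j * (hf - idx k) = idx j * idx k.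
Proof.
split; last by ring.
by rewrite -mulrDr addrA hf_dbl -mulrN opprB.
Qed.

(** 2 sin(j/2) cos(j (1/2 - k)) = sin(j k) - sin(j (k - 1)), and the sine of j (k - 1) is
    the preceding column, or 0 for k = 1. *)
Lemma cos_to_sin : diag_mx half_sin *m cos_mx *m rev_mx = sin_mx *m shift_mx (-1).
Proof.
apply/matrixP => j k; rewrite mul_rev_mx sin_shift mul_diag_mx !mxE idx_rev.
by have [e1 e2] := half_angles j k; rewrite sin_cos e1 e2 opprK; ring.
Qed.

(** The same with 2 cos(j/2) sin(j (1/2 - k)) = - sin(j k) - sin(j (k - 1)). *)
Lemma sin_to_sin : diag_mx half_cos *m sin_mx *m rev_mx = -1 *: (sin_mx *m shift_mx 1).
Proof.
apply/matrixP => j k; rewrite mul_rev_mx [RHS]mxE sin_shift mul_diag_mx !mxE idx_rev.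
by have [e1 e2] := half_angles j k; rewrite cos_sin e1 e2 opprK; ring.
Qed.

Lemma half_sin_cos : \det (diag_mx half_sin) * \det (diag_mx half_cos) = half_prod p z.
Proof.
rewrite !det_diag -big_split /=; apply: eq_bigr => j _; rewrite !mxE sin_cos.
by rewrite subrr oppr0 subrr addr0 -mulrDr hf_dbl mulr1.
Qed.

(** As the sine matrix is invertible, [sin_to_sin] gives the product of the half-angle
    cosines up to sign, and the half-angle sines follow by duplication. *)
Lemma det_sin_cos : \det sin_mx = (-1) ^+ n * half_prod p z * \det cos_mx.
Proof.
have s0 : \det sin_mx != 0.
  by rewrite -sqrf_eq0 det_sin_sqr expf_eq0 oppr_eq0 pnatr_eq0 andbC -[p == _]negbK -lt0n prime_gt0.
have := congr1 determinant cos_to_sin; have := congr1 determinant sin_to_sin.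
rewrite detZ !det_mulmx !det_shift !mulr1 -half_sin_cos => E2 E1.
have {}E2 : \det (diag_mx half_cos) * \det rev_mx = (-1) ^+ n.
  by apply: (mulfI s0); rewrite mulrCA mulrA E2 mulrC.
have C2 : \det (diag_mx half_cos) ^+ 2 = 1.
  by rewrite -(sqrr_sign algC n) -E2 exprMn det_rev_sqr mulr1.
by rewrite -E2 -[LHS]mul1r -C2 -E1; ring.
Qed.

End FourierFactorisation.

(** * The determinant of the core matrix *)

Section CoreDeterminant.

Variable p : nat.
Hypotheses (p_pr : prime p) (p2 : (2 < p)%N).
Local Notation chi := (@chi p).
Local Notation n := (halfp p).

Lemma chi_prod_sum : exists2 t, chi_prod p = (-1) ^+ t & chi_half p = n%:Z - (2 * t)%:Z.
Proof.
apply: sign_prod_sum => i; have : chi (idx i) != 0 by rewrite chi_eq0 halfp_neq0.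
by case: (chi_cases (idx i)) => ->; [ | left | right].
Qed.

Let p0 : p%:R != 0 :> algC. Proof. by rewrite pnatr_eq0 -lt0n prime_gt0. Qed.

Let prim_root : {z : algC | p.-primitive_root z}.
Proof. exact: C_prim_root_exists (prime_gt0 p_pr). Qed.

(** Here g^2 = p, and both outer factors are the cosine matrix. *)
Lemma det_core_1mod4 k : n = (2 * k.+1)%N -> \det (core_mx p) = chi_prod p * p%:R ^+ k.
Proof.
move=> nk; have [z prim_z] := prim_root.
have [zp z1] := prim_root_prime p_pr prim_z.
have chiN1E : chi (-1) = 1 by rewrite (chiN1 p_pr p2) nk exprM sqrrN expr1n.
have := congr1 determinant (core_factor p_pr p2 prim_z (erefl _)).
rewrite chiN1E detZ !det_mulmx det_diag_chi (_ : \matrix_(_, _) _ = cos_mx p z); last first.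
  by apply/matrixP => i j; rewrite !mxE mul1r.
rewrite mulrAC -expr2 det_cos_sqr // det_map_mx.
have -> : gauss p z ^+ n = p%:R ^+ k.+1 by rewrite nk exprM gauss_sqr // chiN1E mul1r.
move=> E.
apply: (@intr_inj algC); rewrite rmorphM rmorphXn /= rmorph_nat.
apply: (mulfI (expf_neq0 k.+1 p0)); rewrite E.
have -> : n.-1 = (k.+1 + k)%N by lia.
by rewrite exprD; ring.
Qed.

(** Here g^2 = -p and n is odd; the outer factors are the sine and the cosine matrix, whose
    determinants differ by the product that [half_prod_gauss] compares with g. *)
Lemma det_core_3mod4 m k : p.+1 = (4 * m)%N -> n = (2 * k).+1 ->
  \det (core_mx p) = chi 2%:R * chi_prod p * (- p%:R) ^+ k.
Proof.
move=> pm nk; have [z prim_z] := prim_root.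
have [zp z1] := prim_root_prime p_pr prim_z.
have chiN1E := chiN1_of_4m p_pr pm.
have pk (j : nat) : p%:R ^+ j != 0 :> algC by apply: expf_neq0.
have sq : half_prod p z ^+ 2 = - p%:R.
  have := det_sin_sqr p_pr p2 prim_z; rewrite det_sin_cos // !exprMn sqrr_sign mul1r det_cos_sqr //.
  have -> : (- p%:R) ^+ n = p%:R ^+ (2 * k) * - p%:R :> algC.
    by rewrite nk exprSr !exprM sqrrN.
  by rewrite nk mulrC => /(mulfI (pk _)).
have hp := half_prod_gauss p_pr pm prim_z sq.
have g2 : gauss p z ^+ 2 = - p%:R by rewrite gauss_sqr // chiN1E rmorphN1 mulN1r.
have g0 : gauss p z != 0 by rewrite -sqrf_eq0 g2 oppr_eq0.
have := congr1 determinant (core_factor p_pr p2 prim_z (erefl _)).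
rewrite chiN1E detZ !det_mulmx det_diag_chi (_ : \matrix_(_, _) _ = sin_mx p z); last first.
  by apply/matrixP => i j; rewrite !mxE rmorphN1 mulN1r.
rewrite det_sin_cos // det_map_mx.
have regroup (a b c d : algC) : a * b * c * d * c = a * b * d * c ^+ 2 by ring.
rewrite regroup det_cos_sqr // hp.
have -> : (-1) ^+ n = -1 :> algC by rewrite nk exprS exprM sqrrN !expr1n mulr1.
have -> : gauss p z ^+ n = gauss p z * (- p%:R) ^+ k by rewrite nk exprS exprM g2.
have -> : n.-1 = (2 * k)%N by rewrite nk.
move=> E.
apply: (@intr_inj algC); rewrite !rmorphM rmorphXn rmorphN /= rmorph_nat.
have pk' : (- p%:R) ^+ k != 0 :> algC by rewrite expf_neq0 ?oppr_eq0.
apply: (mulfI g0); apply: (mulfI pk'); rewrite mulrCA mulrA E.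
have -> : p%:R ^+ (2 * k) = (- p%:R) ^+ k * (- p%:R) ^+ k :> algC.
  by rewrite -exprD addnn -mul2n !exprM sqrrN.
ring.
Qed.

End CoreDeterminant.

(** With t the number of j <= n such that chi(j) = -1, n - 2 t is h or 3 h according to
    chi 2; this fixes the parity of t + k in terms of h, which is odd. *)
Lemma det_core_class_number (p m k : nat) : prime p -> (3 < p)%N -> p.+1 = (4 * m)%N ->
  halfp p = (2 * k).+1 ->
  \det (core_mx p) = (-1) ^+ ((h (- p%:Z) - 1) %/ 2) * p%:R ^+ k.
Proof.
move=> p_pr p3 pm nk; have p2 := ltnW p3.
rewrite (det_core_3mod4 p_pr p2 pm nk) exprNn mulrA; congr (_ * _).
have [t -> ] := chi_prod_sum p_pr p2.
rewrite (half_sum_class_number p_pr pm p3) nk.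
have := odd_class_number p_pr pm p3; set H := h _ => oddH cE.
have [u hE] : exists u, H = (2 * u).+1 by exists ((H - 1) %/ 2)%N; lia.
rewrite hE in cE *; have -> : ((((2 * u).+1 - 1) %/ 2)%N = u)%N by lia.
have parity a b : odd a = odd b -> (-1) ^+ a = (-1) ^+ b :> int.
  by move=> ab; rewrite -(signr_odd _ a) ab signr_odd.
have chi20 : chi (2%:R : 'F_p) != 0 by rewrite chi_eq0 two_neq0.
rewrite -mulrA -exprD; case: (chi_cases (2%:R : 'F_p)) => c2.
- by rewrite c2 in chi20.
- by rewrite c2 mul1r; apply: parity; rewrite c2 in cE; lia.
- by rewrite c2 -exprS; apply: parity; rewrite c2 in cE; lia.
Qed.

(** * Character sums in the core matrix *)

Section CoreSums.

Variable p : nat.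
Hypotheses (p_pr : prime p) (p2 : (2 < p)%N).
Local Notation F := 'F_p.
Local Notation chi := (@chi p).
Local Notation n := (halfp p).

Lemma core_row_sum (a : F) : \sum_(k < n) (chi (a + idx k) + chi (a - idx k)) = - chi a.
Proof.
have := sum_chi p_pr p2; rewrite (reindex_inj (addrI a)) /= (halfp_sum p_pr p2) addr0.
by move/eqP; rewrite addrC addr_eq0 => /eqP.
Qed.

(** The left-hand side is the sum of chi(x) chi(x + a) over the field. *)
Lemma core_row_chi_sum (a : F) : a != 0 ->
  \sum_(k < n) chi (idx k) * (chi (a + idx k) + chi (-1) * chi (a - idx k)) = -1.
Proof.
move=> a0; have := sum_chi_shift p_pr p2 a; rewrite (negbTE a0) (halfp_sum p_pr p2) chi0 mul0r add0r.
move=> <-; apply: eq_bigr => k _.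
by rewrite -[- k.+1%:R]mulN1r chiM // -/(idx k) mulN1r [- idx k + a]addrC [idx k + a]addrC; ring.
Qed.

Hypothesis chiN1E : chi (-1) = -1.

(** The summand is an even function of j that vanishes at 0, so twice the left-hand side is
    a sum over the whole field, namely of four shifted products of characters. *)
Lemma core_col_mul (k l : 'I_n) :
  \sum_(j < n) (chi (idx j + idx k) + chi (idx j - idx k)) * (chi (idx j + idx l) + chi (idx j - idx l)) =
  p%:Z * (k == l)%:R - 2.
Proof.
pose f x := (chi (x + idx k) + chi (x - idx k)) * (chi (x + idx l) + chi (x - idx l)).
have chiN x : chi (- x) = - chi x by rewrite -[- x]mulN1r chiM // chiN1E mulN1r.
have oddN x b : chi (- x + b) + chi (- x - b) = - (chi (x + b) + chi (x - b)).
  have [-> ->] : - x + b = - (x - b) /\ - x - b = - (x + b) by split; ring.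
  by rewrite !chiN; ring.
have fN x : f (- x) = f x by rewrite /f !oddN mulrNN.
have f0 : f 0 = 0 by rewrite /f !add0r chiN subrr mul0r.
have S (b c : F) : \sum_x chi (x + b) * chi (x + c) = p%:Z * (b == c)%:R - 1.
  rewrite (reindex_inj (addIr (- b))) /=; under eq_bigr => x _ do rewrite subrK -addrA.
  rewrite sum_chi_shift // addrC subr_eq0 [c == b]eq_sym.
  by case: (b == c); rewrite ?mulr1 ?mulr0 // add0r.
have : \sum_x f x = 2 * (p%:Z * (k == l)%:R - 2).
  have -> : \sum_x f x = \sum_x chi (x + idx k) * chi (x + idx l)
     + \sum_x chi (x + idx k) * chi (x + - idx l)
     + \sum_x chi (x + - idx k) * chi (x + idx l)
     + \sum_x chi (x + - idx k) * chi (x + - idx l).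
    by rewrite -!big_split; apply: eq_bigr => x _; rewrite /f /=; ring.
  rewrite !S eqr_opp -[idx k == - idx l]subr_eq0 opprK -[- idx k == _]subr_eq0 -opprD oppr_eq0.
  rewrite (negbTE (idx_add_neq0 p_pr p2 k l)) -[idx k == _]subr_eq0 idx_sub_eq0 //.
  by case: (k == l) => /=; ring.
rewrite (halfp_sum p_pr p2) f0 add0r.
under eq_bigr => j _ do rewrite fN.
under eq_bigr => j _ do rewrite -[j.+1%:R]/(idx j) -mulr2n.
rewrite sumrMnl mulr2n => E; transitivity (\sum_(i < n) f (idx i)) => //.
apply: (mulfI (isT : 2%:R != 0 :> int)); rewrite -E; ring.
Qed.

(** For each j the sum of chi(k) chi(j - k) exceeds that of chi(k) chi(j + k) by 1, by
    [core_row_chi_sum]. *)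
Lemma core_col_sum_chi :
  \sum_(k < n) chi (idx k) * \sum_(j < n) (chi (idx j + idx k) + chi (idx j - idx k)) = 2 * d_ p + n%:Z.
Proof.
have dE : d_ p = \sum_(j < n) \sum_(k < n) chi (idx k) * chi (idx j + idx k).
  rewrite exchange_big /d_ big_add1 /= big_mkord; apply: eq_bigr => j _.
  rewrite big_add1 /= big_mkord; apply: eq_bigr => k _.
  rewrite legendreE // -chiM // rmorphD /= rmorphXn rmorphM /= -!pmulrn; congr (chi _).
  by rewrite /idx; ring.
under eq_bigr => k _ do rewrite mulr_sumr.
rewrite exchange_big /= dE mulr_sumr.
have -> : n%:Z = \sum_(j < n) 1 by rewrite sumr_const card_ord -mulr_natr mul1r natz.
rewrite -big_split /=; apply: eq_bigr => j _.
have := core_row_chi_sum (halfp_neq0 p_pr p2 j); rewrite chiN1E => E.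
rewrite -[1]opprK -[X in _ - X]E -sumrN mulr_sumr -big_split /=; apply: eq_bigr => k _.
by rewrite -/(idx j); ring.
Qed.

End CoreSums.

(** * Rank two corrections *)

Lemma det_block_scalar (R : comNzRingType) (a b c d : R) :
  \det (block_mx a%:M b%:M c%:M d%:M : 'M_(1 + 1)) = a * d - b * c.
Proof.
have e1 : lift (lshift 1 (0 : 'I_1)) 0 = rshift 1 (0 : 'I_1) by apply: val_inj.
have e2 : lift (rshift 1 (0 : 'I_1)) 0 = lshift 1 (0 : 'I_1) by apply: val_inj.
rewrite (expand_det_row _ (lshift 1 0)) big_split_ord /= !big_ord1 /cofactor !det_mx11.
have s1 : split (rshift 1 (0 : 'I_1)) = inr (0 : 'I_1) := unsplitK (inr _).
rewrite block_mxEul block_mxEur !mxE e1 e2 s1 row_mxEl row_mxEr !mxE /=.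
by rewrite expr0 expr1 mulr1n; ring.
Qed.

(** Both corrections to A lie in the span of a and b, so only the 2 x 2 matrix of the
    inner products with A^-1 a and A^-1 b matters. *)
Lemma det_add_rank2 (K : comNzRingType) n (A : 'M[K]_n) (a b va vb : 'cV[K]_n)
    (x y z w aa ab ba bb : K) :
  A *m va = a -> A *m vb = b ->
  a^T *m va = aa%:M -> a^T *m vb = ab%:M -> b^T *m va = ba%:M -> b^T *m vb = bb%:M ->
  \det (A + a *m (x *: a^T + z *: b^T) + b *m (y *: a^T + w *: b^T)) =
  \det A * ((1 + x * aa + z * ba) * (1 + y * ab + w * bb)
            - (x * ab + z * bb) * (y * aa + w * ba)).
Proof.
move=> Ea Eb Eaa Eab Eba Ebb.
set r := x *: _ + _; set s := y *: _ + _.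
have -> : A + a *m r + b *m s = A *m (1%:M + row_mx va vb *m col_mx r s).
  by rewrite mul_row_col !mulmxDr mulmx1 !mulmxA Ea Eb !addrA.
rewrite det_mulmx det_add1_mulmx mul_col_row; congr (_ * _).
rewrite !mulmxDl -!scalemxAl Eaa Eab Eba Ebb scalar_mx_block add_block_mx !add0r.
by rewrite !scale_scalar_mx -!raddfD /= det_block_scalar !addrA.
Qed.

Section TheDeterminant.

Variables (C : numClosedFieldType) (p : nat).
Hypotheses (p_pr : prime p) (p2 : (2 < p)%N).
Local Notation F := 'F_p.
Local Notation chi := (@chi p).
Local Notation n := (halfp p).

Let A : 'M[C]_n := map_mx intr (core_mx p).
Let ones : 'cV[C]_n := const_mx 1.
Let chis : 'cV[C]_n := \col_j (chi (idx j))%:~R.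

Lemma legendre_mxE (x y z w : C) : legendre_mx p x y z w =
  A + ones *m (x *: ones^T + z *: chis^T) + chis *m (y *: ones^T + w *: chis^T).
Proof.
apply/matrixP => j k; rewrite !mxE !big_ord1 !mxE; cbv zeta; rewrite !legendreE //.
rewrite !rmorphD rmorphN rmorphM /= -!pmulrn -!/(idx _) chiM // rmorphM /=; ring.
Qed.

Lemma ones_ones : ones^T *m ones = n%:R%:M.
Proof.
apply/matrixP => i j; rewrite !mxE !ord1 eqxx; under eq_bigr => k _ do rewrite !mxE mulr1.
by rewrite sumr_const card_ord.
Qed.

Lemma chis_chis : chis^T *m chis = n%:R%:M.
Proof.
apply/matrixP => i j; rewrite !mxE !ord1 eqxx.
under eq_bigr => k _ do rewrite !mxE -rmorphM /= chi_sqr ?halfp_neq0 //.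
by rewrite sumr_const card_ord.
Qed.

Lemma ones_chis : ones^T *m chis = (chi_half p)%:~R%:M.
Proof.
apply/matrixP => i j; rewrite !mxE !ord1 eqxx mulr1n rmorph_sum.
by apply: eq_bigr => k _; rewrite !mxE mul1r.
Qed.

Lemma chis_ones : chis^T *m ones = (chi_half p)%:~R%:M.
Proof. by rewrite -[LHS]trmxK trmx_mul trmxK ones_chis tr_scalar_mx. Qed.

Lemma core_ones : A *m ones = - chis.
Proof.
apply/matrixP => j k; rewrite !mxE -rmorphN -core_row_sum // rmorph_sum /=.
by apply: eq_bigr => i _; rewrite !mxE mulr1.
Qed.

Lemma det_1mod4 k (x y z w : C) : n = (2 * k.+1)%N ->
  \det (legendre_mx p x y z w) =
    (- p%:R) ^+ k * (n%:R ^+ 2 * (w * x) - (n%:R * y - 1) * (n%:R * z - 1)).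
Proof.
move=> nk.
have chiN1E : chi (-1) = 1 by rewrite (chiN1 p_pr p2) nk exprM sqrrN expr1n.
have ch0 : chi_half p = 0.
  have := sum_chi p_pr p2; rewrite (halfp_sum p_pr p2) chi0 add0r.
  under eq_bigr => j _ do rewrite -[- _]mulN1r chiM // chiN1E mul1r -mulr2n.
  by rewrite sumrMnl => /eqP; rewrite mulrn_eq0 /= => /eqP.
have core_chis : A *m chis = - ones.
  apply/matrixP => j i; rewrite !mxE.
  transitivity ((-1 : int)%:~R : C); last by rewrite rmorphN1.
  rewrite -(core_row_chi_sum p_pr p2 (halfp_neq0 p_pr p2 j)) rmorph_sum /=.
  by apply: eq_bigr => b _; rewrite !mxE -rmorphM /= chiN1E mul1r mulrC.
have [t prodE sumE] := chi_prod_sum p_pr p2.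
have tk : t = k.+1 by rewrite ch0 in sumE; lia.
have detA : \det A = - (- p%:R) ^+ k.
  rewrite det_map_mx (det_core_1mod4 p_pr p2 nk) prodE tk rmorphM rmorphXn rmorphN1 rmorphXn /= rmorph_nat.
  by rewrite exprS -mulrA mulN1r [in RHS]exprNn.
rewrite legendre_mxE (@det_add_rank2 _ _ A ones chis (- chis) (- ones) x y z w
  0 (- n%:R) (- n%:R) 0); first by rewrite detA; ring.
- by rewrite mulmxN core_chis opprK.
- by rewrite mulmxN core_ones opprK.
- by rewrite mulmxN ones_chis ch0 rmorph0 -raddfN oppr0.
- by rewrite mulmxN ones_ones -raddfN.
- by rewrite mulmxN chis_chis -raddfN.
- by rewrite mulmxN chis_ones ch0 rmorph0 -raddfN oppr0.
Qed.

Section ThreeMod4.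

Hypothesis chiN1E : chi (-1) = -1.

Let J : 'M[C]_n := ones *m ones^T.

Let p0 : p%:R != 0 :> C. Proof. by rewrite pnatr_eq0 -lt0n prime_gt0. Qed.

Let pn : p%:R = 1 + 2 * n%:R :> C.
Proof. by rewrite -{1}(half_dblS p_pr p2) -addnn -natr1 natrD; ring. Qed.

Lemma core_gram : A^T *m A = p%:R%:M - 2%:R *: J.
Proof.
apply/matrixP => k l; rewrite !mxE big_ord1 !mxE mulr1.
transitivity ((p%:Z * (k == l)%:R - 2)%:~R : C); last first.
  rewrite rmorphB rmorphM /= -!pmulrn.
  by case: (k == l); rewrite ?mulr1 ?mulr0 ?mulr1n ?mulr0n.
rewrite -(core_col_mul p_pr p2 chiN1E) rmorph_sum; apply: eq_bigr => j _.
by rewrite !mxE -rmorphM.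
Qed.

(* As J^2 = n J and 2 n = p - 1, the inverse of p I - 2 J is (I + 2 J) / p. *)
Let B : 'M[C]_n := p%:R^-1 *: ((1%:M + 2%:R *: J) *m A^T).

Lemma core_inv : A *m B = 1%:M.
Proof.
apply: mulmx1C; rewrite -scalemxAl -mulmxA core_gram.
have JJ : J *m J = n%:R *: J.
  by rewrite mulmxA -[_ *m ones^T *m ones]mulmxA ones_ones mul_mx_scalar -scalemxAl.
rewrite mulmxDl mul1mx -scalemxAl mulmxBr mul_mx_scalar -scalemxAr JJ.
rewrite scalerBr !scalerA -addrA -scalerBl -scaleNr -scalerDl.
have -> : - 2%:R + (2%:R * p%:R - 2%:R * 2%:R * n%:R) = 0 :> C by rewrite pn; ring.
by rewrite scale0r addr0 scale_scalar_mx mulVf.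
Qed.

Let c : C := (chi_half p)%:~R.
Let d : C := (d_ p)%:~R.

Let vone : 'cV[C]_n := B *m ones.

(** J A^T 1 = 1 (A 1)^T 1 and A 1 = - chi. *)
Lemma vone_E : vone = p%:R^-1 *: (A^T *m ones - (2%:R * c) *: ones).
Proof.
rewrite /vone -scalemxAl -mulmxA mulmxDl mul1mx -scalemxAl -mulmxA.
have -> : ones^T *m (A^T *m ones) = - c%:M.
  by rewrite mulmxA -trmx_mul core_ones linearN /= mulNmx chis_ones.
by rewrite mulmxN mul_mx_scalar scalerN scalerA.
Qed.

Lemma ones_vone : ones^T *m vone = (- c)%:M.
Proof.
rewrite vone_E -scalemxAr mulmxBr mulmxA -trmx_mul core_ones linearN /= mulNmx chis_ones.
rewrite -scalemxAr ones_ones scale_scalar_mx -raddfN -raddfB /= scale_scalar_mx.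
by congr (_%:M); apply: (mulfI p0); rewrite mulrA mulfV // mul1r pn /c; ring.
Qed.

Let s : C := p%:R^-1 * (n%:R + 2%:R * (d - c ^+ 2)).

Lemma chis_vone : chis^T *m vone = s%:M.
Proof.
rewrite vone_E -scalemxAr mulmxBr -scalemxAr chis_ones.
have -> : chis^T *m (A^T *m ones) = (2%:R * d + n%:R)%:M.
  apply/matrixP => i j; rewrite !mxE !ord1 eqxx mulr1n.
  transitivity ((2 * d_ p + n%:Z)%:~R : C); last by rewrite rmorphD rmorphM.
  rewrite -(core_col_sum_chi p_pr p2 chiN1E) rmorph_sum; apply: eq_bigr => k _ /=.
  rewrite !mxE rmorphM rmorph_sum; congr (_ * _); apply: eq_bigr => b _ /=.
  by rewrite !mxE mulr1.
rewrite scale_scalar_mx -raddfB /= scale_scalar_mx; congr (_%:M).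
by rewrite /s; congr (_ * _); rewrite -/c; ring.
Qed.

Lemma det_3mod4 (x y z w : C) :
  \det (legendre_mx p x y z w) = (\det (core_mx p))%:~R *
    (1 - n%:R * y - c * (w + x) + c ^+ 2 * (w * x - y * z)
     + s * (z + n%:R * (w * x - y * z))).
Proof.
rewrite legendre_mxE (@det_add_rank2 _ _ A ones chis vone (- ones) x y z w (- c) (- n%:R) s (- c)).
- by rewrite det_map_mx; congr (_ * _); ring.
- by rewrite mulmxA core_inv mul1mx.
- by rewrite mulmxN core_ones opprK.
- exact: ones_vone.
- by rewrite mulmxN ones_ones -raddfN.
- exact: chis_vone.
- by rewrite mulmxN chis_ones -raddfN.
Qed.

End ThreeMod4.

End TheDeterminant.

Theorem theorem1p2 (C : numClosedFieldType) (p : nat) (x y z w : C)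
    (p_prime : prime p) (p_gt3 : (3 < p)%N) :
  ((p %% 4 = 1)%N ->
     \det (legendre_mx p x y z w) =
       (- p%:R) ^+ ((p - 5) %/ 4) *
       (((p%:R - 1) / 2%:R) ^+ 2 * (w * x)
        - ((p%:R - 1) / 2%:R * y - 1) * ((p%:R - 1) / 2%:R * z - 1)))
  /\
  ((p %% 4 = 3)%N ->
     let n : C := (p%:R - 1) / 2%:R in
     let c : C := (c_ p)%:~R in
     let d : C := (d_ p)%:~R in
     let e : C := (-1) ^+ ((h (- p%:Z) - 1) %/ 2) in
     \det (legendre_mx p x y z w) =
       e * p%:R ^+ ((p - 3) %/ 4) *
         (1 - n * y - c * (w + x) + c ^+ 2 * (w * x - y * z))
       + e * p%:R ^+ ((p - 7) %/ 4) *
         (n + 2%:R * (d - c ^+ 2)) * (z + n * (w * x - y * z))).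
Proof.
have p2 := ltnW p_gt3; have pn := half_dblS p_prime p2.
have -> : (p%:R - 1) / 2%:R = (halfp p)%:R :> C.
  by rewrite -{1}pn -natr1 addrK -muln2 natrM mulfK ?pnatr_eq0.
split=> p4.
  have nk : halfp p = (2 * ((p - 5) %/ 4).+1)%N by lia.
  exact: det_1mod4.
move=> n c d e.
have pm : p.+1 = (4 * (p.+1 %/ 4))%N by lia.
have p0 : p%:R != 0 :> C by rewrite pnatr_eq0 -lt0n prime_gt0.
have [k [nk k3 k7]] : exists k, [/\ halfp p = (2 * k.+1).+1, (p - 3) %/ 4 = k.+1 & (p - 7) %/ 4 = k]%N.
  by exists ((p - 7) %/ 4)%N; split; lia.
rewrite (det_3mod4 p_prime p2 (chiN1_of_4m p_prime pm)) -(c_E p_prime pm p_gt3) -/c -/d -/n.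
rewrite (det_core_class_number p_prime p_gt3 pm nk) k3 k7 rmorphM !rmorphXn rmorphN1 /= rmorph_nat -/e.
by rewrite exprSr; field.
Qed.
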